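(* For every $m\in\mathbb{N}$ ($m\ge1$), $$\operatorname{mon}H_p^m(\mathbb{T}^\infty)=\begin{cases}\ell_2\cap\mathbb{D}^\infty & \text{for } 1\le p<\infty,\\ \ell_{\frac{2m}{m-1},\infty}\cap\mathbb{D}^\infty & \text{for } p=\infty.\end{cases}$$ Moreover, there exists a universal constant $C>0$ such that for all $m\in\mathbb{N}$, $1\le p\le\infty$, $z\in\operatorname{mon}H_p^m(\mathbb{T}^\infty)$ and $f\in H_p^m(\mathbb{T}^\infty)$, $$\sum_{|\alpha|=m}|\hat f(\alpha)z^\alpha|\le C^m\|z\|^m\|f\|_p,$$ where $\|z\|$ is the norm in the corresponding sequence space ($\ell_2$ if $p<\infty$, $\ell_{\frac{2m}{m-1},\infty}$ if $p=\infty$).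
   Context: $\mathbb{T}$ is the unit circle in $\mathbb{C}$, $\mathbb{T}^\infty$ the countable product of copies of $\mathbb{T}$, with $m$ also denoting (as a measure, $dm$) the product of the normalized Lebesgue measures. $\mathbb{D}^\infty$ is the open unit ball of the space $\ell_\infty$ of bounded complex sequences. $\mathbb{Z}^{(\mathbb{N})}$ (resp. $\mathbb{N}_0^{(\mathbb{N})}$) is the set of finitely supported sequences of integers (resp. non-negative integers); $|\alpha|=\sum_j\alpha_j$ for $\alpha\in\mathbb{N}_0^{(\mathbb{N})}$ and $z^\alpha=\prod_jz_j^{\alpha_j}$. For $f\in L_p(\mathbb{T}^\infty)$ and $\alpha\in\mathbb{Z}^{(\mathbb{N})}$, $\hat f(\alpha)=\int_{\mathbb{T}^\infty}f(w)w^{-\alpha}\,dm(w)$. The Hardy space is $$H_p(\mathbb{T}^\infty)=\{f\in L_p(\mathbb{T}^\infty):\hat f(\alpha)=0\ \ \forall\alpha\in\mathbb{Z}^{(\mathbb{N})}\setminus\mathbb{N}_0^{(\mathbb{N})}\},$$ and for $m\in\mathbb{N}$, $H_p^m(\mathbb{T}^\infty)=\{f\in H_p(\mathbb{T}^\infty):\hat f(\alpha)\ne0\Rightarrow|\alpha|=m\}$, both with the $L_p$-norm $\|\cdot\|_p$. Further, $$\operatorname{mon}H_p^m(\mathbb{T}^\infty)=\Big\{z\in\mathbb{D}^\infty:\sum_\alpha|\hat f(\alpha)z^\alpha|<\infty\text{ for all }f\in H_p^m(\mathbb{T}^\infty)\Big\}.$$ For $z\in\ell_\infty$ the decreasing rearrangement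 is $z_n^*=\inf\{\sup_{j\in\mathbb{N}\setminus J}|z_j|:J\subseteq\mathbb{N},\ \operatorname{card}(J)<n\}$. For $1\le q<\infty$, $\ell_{q,\infty}$ is the space of $z\in\ell_\infty$ with $\|z\|=\sup_nz_n^*n^{1/q}<\infty$. For $m=1$, where $\frac{2m}{m-1}$ is read as $\infty$, $\ell_{\infty,\infty}$ means $\ell_\infty$ with the sup norm. *)

(* Defs.v *)
From HB Require Import structures.
From mathcomp Require Import all_boot all_order all_algebra finmap.
From mathcomp Require Import complex.
From mathcomp Require Import all_classical all_reals all_analysis.
From mathcomp Require Import measurable_realfun ring lra.

Set Implicit Arguments.
Unset Strict Implicit.
Unset Printing Implicit Defensive.
Import Order.TTheory GRing.Theory Num.Theory.
Import numFieldNormedType.Exports.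

Local Open Scope classical_set_scope.
Local Open Scope ring_scope.
Local Open Scope complex_scope.

(* The modulus as an element of R: `|z| itself lives in R[i] *)
Definition cmod (R : realType) (z : R[i]) : R := complex.Re `|z|.

Section circle.
Context {R : realType}.

Definition unit_circle : Type := {z : R[i] | `|z| == 1}.

Fact unit_circle_subproof : `|1 : R[i]| == 1. Proof. by rewrite normr1. Qed.

HB.instance Definition _ := Choice.on unit_circle.
HB.instance Definition _ := isPointed.Build unit_circle
  (exist _ 1 unit_circle_subproof).

Definition circle_coord (w : unit_circle) : R * R :=
  (complex.Re (sval w), complex.Im (sval w)).

(* T with its Borel sigma-algebra, the trace of that of the plane R * R *)
Definition circle : Type := g_sigma_algebra_preimageType circle_coord.
HB.instance Definition _ := Measurable.on circle.

Fact expi_subproof (t : R) :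
  `|(cos (2 * pi * t) +i* sin (2 * pi * t) : R[i])| == 1.
Proof. by rewrite normc_def /= cos2Dsin2 sqrtr1. Qed.

Definition expi (t : measurableTypeR R) : circle :=
  exist (fun z : R[i] => `|z| == 1) _ (expi_subproof t).

Lemma measurable_expi : measurable_fun [set: measurableTypeR R] expi.
Proof.
move=> _ _ [B mB <-]; rewrite !setTI.
have mg : measurable_fun [set: R]
    (fun t : R => (cos (2 * pi * t), sin (2 * pi * t))).
  apply: measurable_fun_pair.
  - apply: (measurableT_comp (f := cos)); last exact: measurable_funM.
    by apply: continuous_measurable_fun; exact: continuous_cos.
  - apply: (measurableT_comp (f := sin)); last exact: measurable_funM.
    by apply: continuous_measurable_fun; exact: continuous_sin.
by rewrite -[X in measurable X]setTI; exact: mg.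
Qed.

HB.instance Definition _ := isMeasurableFun.Build _ _ _ _ expi measurable_expi.

(* Normalized arc length: the law of exp (2 pi i t) for t uniform on [0, 1] *)
Definition circle_measure : probability circle R :=
  distribution (uniform_prob (@ltr01 R)) expi.

End circle.
Arguments unit_circle : clear implicits.
Arguments circle : clear implicits.
Arguments circle_measure : clear implicits.

Section infinite_torus.
Context {R : realType}.

(* T^oo with the product sigma-algebra, generated by the coordinate maps; as
   T is second countable, it is also the Borel sigma-algebra of T^oo *)
Definition torus_cylinders : set (set (nat -> circle R)) :=
  \bigcup_j preimage_set_system setT (fun w : nat -> circle R => w j) measurable.

Definition torus : Type := g_sigma_algebraType torus_cylinders.
HB.instance Definition _ := Measurable.on torus.

Definition is_product_measure (P : probability torus R) : Prop :=
  forall (n : nat) (A : nat -> set (circle R)), (forall j, measurable (A j)) ->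
    P [set w | forall j, (j < n)%N -> A j (w j)] =
    (\prod_(j < n) circle_measure R (A j))%E.

End infinite_torus.
Arguments torus : clear implicits.

(* Existence of the product measure.  The binary digits of even and of odd rank
   of a uniform t on [0, 1] form two independent uniform numbers [evens t] and
   [odds t]; iterating, [unif_seq] is an i.i.d. uniform sequence, whose image
   under [expi] has the product of the [circle_measure]s as its law. *)
Module ProductMeasure.

Section binary_digits.
Context {R : realType}.
Local Notation Rm := (measurableTypeR R).
Local Notation mu := (@lebesgue_measure R).

Definition unif : probability Rm R := uniform_prob (@ltr01 R).

Lemma unifE (A : set Rm) : measurable A -> unif A = mu (A `&` `[0, 1]).
Proof.
move=> mA; rewrite /unif/= /uniform_prob integral_uniform_pdf.
rewrite (eq_integral (fun=> 1%:E)); last first.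
  move=> x; rewrite inE/= in_itv/= => -[_ x01].
  by rewrite /uniform_pdf x01 subr0 invr1.
by rewrite integral_cst ?mul1e//; exact: measurableI.
Qed.

Lemma lebesgue_affine (a : R) (A : set Rm) : measurable A ->
  mu A = (2%:E * mu ((fun t => 2 * t - a)%R @^-1` A))%E.
Proof.
move=> mA.
have mf : measurable_fun [set: Rm] (fun t : Rm => (2 * t - a)%R : Rm).
  exact: (measurable_funB (measurable_funM _ _) _).
have h2 : (0 <= 2 :> R) by [].
apply: (@lebesgue_measure_unique R
  (mscale (NngNum h2) (pushforward mu (fun t : Rm => (2 * t - a)%R : Rm)))) => //.
move=> _ [[x y] _ <-]/=.
rewrite /mscale/= /pushforward/=.
have -> : (fun t : R => 2 * t - a) @^-1` `]x, y] =
    `](x + a) / 2, (y + a) / 2]%classic.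
  apply/seteqP; split => t /=; rewrite !in_itv/= => /andP[h1 h3]; apply/andP; split; lra.
rewrite !lebesgue_measure_itv/= !lte_fin ltr_pM2r ?invr_gt0// ltrD2r.
case: ifPn => _; rewrite ?mule0// -!EFinB -EFinM; congr EFin; by field.
Qed.

Definition bit (t : R) : R := if t < 2^-1 then 0 else 1.
Definition shift (t : Rm) : Rm := 2 * t - bit t.

Lemma measurable_bit : measurable_fun [set: Rm] bit.
Proof. by apply: measurable_fun_if => //; exact: measurable_fun_ltr. Qed.

Lemma measurable_shift : measurable_fun [set: Rm] shift.
Proof.
by apply: measurable_funB; [exact: measurable_funM|exact: measurable_bit].
Qed.

Lemma measurable_preimage d d' (T : measurableType d) (T' : measurableType d')
  (f : T -> T') (B : set T') : measurable_fun setT f -> measurable B ->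
  measurable (f @^-1` B).
Proof. by move=> mf mB; rewrite -[X in measurable X]setTI; exact: mf. Qed.

Lemma unif_shift (c : bool) (B : set Rm) : measurable B ->
  unif B = (2%:E * unif ([set t | bit t = c%:R] `&` shift @^-1` B))%E.
Proof.
move=> mB.
have mbit : measurable [set t : Rm | bit t = c%:R].
  exact: (measurable_preimage measurable_bit (measurable_set1 c%:R)).
rewrite !unifE//; last first.
  by apply: measurableI => //; exact: measurable_preimage measurable_shift mB.
have m01 : mu (B `&` `[0, 1]) = mu (B `&` `[0, 1[).
  have -> : B `&` `[0, 1[ = (B `&` `[0, 1]) `\` [set 1].
    apply/seteqP; split => t /=; rewrite !in_itv/=.
      move=> [Bt /andP[t0 t1]]; rewrite t0 ltW//; split => [|te]; first by [].
      by move: t1; rewrite te ltxx.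
    move=> [[Bt /andP[t0 t1]] /eqP tn]; split => //.
    by rewrite t0 lt_neqAle tn.
  rewrite measureD//=; last 2 first.
    exact: measurableI.
    apply: le_lt_trans (measureIr _ _ _) _ => //=.
    by rewrite lebesgue_measure_itv/= lte_fin ltr01 oppr0 adde0 ltry.
  suff -> : mu (B `&` `[0, 1] `&` [set 1]) = 0%E by rewrite sube0.
  apply: (@subset_measure0 _ _ _ mu _ [set 1]) => //.
  - by apply: measurableI => //; exact: measurableI.
  - exact: lebesgue_measure_set1.
case: c mbit => mbit.
- rewrite (lebesgue_affine 1); last exact: measurableI.
  congr (_ * mu _)%E; apply/seteqP; split => t /=; rewrite !in_itv/= /shift /bit.
    move=> [Bt /andP[t0 t1]].
    have -> : (t < 2^-1) = false by apply/negbTE; rewrite -leNgt; lra.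
    split; last by apply/andP; split; lra.
    by split.
  case: ifPn => [_ [[/esym/eqP]]|]; first by rewrite oner_eq0.
  rewrite -leNgt => th [[_ Bt] /andP[t0 t1]]; split => //.
  by apply/andP; split; lra.
- rewrite m01 (lebesgue_affine 0); last exact: measurableI.
  congr (_ * mu _)%E; apply/seteqP; split => t /=; rewrite !in_itv/= /shift /bit.
    move=> [Bt /andP[t0 t1]].
    have -> : t < 2^-1 by lra.
    split; last by apply/andP; split; lra.
    by split.
  case: ifPn => [th|_ [[/eqP]]]; last by rewrite oner_eq0.
  move=> [[_ Bt] /andP[t0 t1]]; split => //.
  by apply/andP; split; lra.
Qed.

Definition Pr (A : set Rm) : R := fine (unif A).

Lemma PrE (A : set Rm) : measurable A -> unif A = (Pr A)%:E.
Proof. by move=> mA; rewrite /Pr fineK// fin_num_measure. Qed.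

Lemma Pr_shift (c : bool) (B : set Rm) : measurable B ->
  Pr ([set t | bit t = c%:R] `&` shift @^-1` B) = Pr B / 2.
Proof.
move=> mB; have := unif_shift c mB; rewrite !PrE//.
  by rewrite -EFinM => -[->]; field.
apply: measurableI; last exact: measurable_preimage measurable_shift mB.
exact: (measurable_preimage measurable_bit (measurable_set1 c%:R)).
Qed.

Lemma bitP t : bit t = false%:R \/ bit t = true%:R.
Proof. by rewrite /bit; case: ifPn; [left|right]. Qed.

Lemma Pr_bit (A B0 B1 : set Rm) : measurable A -> measurable B0 ->
    measurable B1 ->
    (forall t, bit t = 0 -> A t <-> B0 (shift t)) ->
    (forall t, bit t = 1 -> A t <-> B1 (shift t)) ->
  Pr A = (Pr B0 + Pr B1) / 2.
Proof.
move=> mA mB0 mB1 h0 h1.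
have mbit (c : bool) : measurable [set t : Rm | bit t = c%:R].
  exact: (measurable_preimage measurable_bit (measurable_set1 c%:R)).
have mS B : measurable B -> measurable (shift @^-1` B).
  exact: measurable_preimage measurable_shift.
have -> : A = ([set t | bit t = false%:R] `&` shift @^-1` B0) `|`
              ([set t | bit t = true%:R] `&` shift @^-1` B1).
  apply/seteqP; split => t /=.
    by move=> At; case: (bitP t) => bt; [left|right]; split => //;
      [exact/h0|exact/h1].
  by move=> [[bt]|[bt]]; [move/(h0 _ bt)|move/(h1 _ bt)].
rewrite /Pr measureU; first rewrite fineD ?fin_num_measure//.
- by rewrite -!/(Pr _) !Pr_shift// mulrDl.
- by apply: measurableI => //; exact: mS.
- by apply: measurableI => //; exact: mS.
- by apply: measurableI => //; exact: mS.
- by apply: measurableI => //; exact: mS.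
- apply/seteqP; split => // t /= [[-> _] [/eqP]].
  by rewrite eq_sym oner_eq0.
Qed.

Fixpoint digit_sum (k : nat) (t : Rm) : Rm :=
  if k is k'.+1 then (bit t + digit_sum k' (shift (shift t))) / 2 else 0.

Lemma measurable_digit_sum k : measurable_fun [set: Rm] (digit_sum k).
Proof.
elim: k => [|k ih] /=; first exact: measurable_cst.
apply: measurable_funM => //; apply: measurable_funD; first exact: measurable_bit.
apply: (measurableT_comp ih).
exact: (measurableT_comp measurable_shift measurable_shift).
Qed.

Lemma bit01 t : 0 <= bit t <= 1.
Proof. by rewrite /bit; case: ifPn => _; rewrite ?lexx ler01. Qed.

Lemma digit_sum01 k t : 0 <= digit_sum k t <= 1.
Proof.
elim: k t => [|k ih] t /=; first by rewrite lexx ler01.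
have /andP[? ?] := ih (shift (shift t)); have /andP[? ?] := bit01 t.
by apply/andP; split; lra.
Qed.

Lemma digit_sum_nd t : nondecreasing_seq (digit_sum ^~ t).
Proof.
apply/nondecreasing_seqP => k; elim: k t => [|k ih] t.
  by have /andP[] := digit_sum01 1 t.
have := ih (shift (shift t)) => /= ?; lra.
Qed.

Definition evens (t : Rm) : Rm := limn (digit_sum ^~ t).
Definition odds (t : Rm) : Rm := evens (shift t).

Lemma digit_sum_cvg t : digit_sum ^~ t @ \oo --> evens t.
Proof.
apply: nondecreasing_is_cvgn; first exact: digit_sum_nd.
by exists 1 => _ [k _ <-]; have /andP[] := digit_sum01 k t.
Qed.

Lemma measurable_evens : measurable_fun [set: Rm] evens.
Proof.
apply: (measurable_fun_cvg (h := digit_sum)).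
  exact: measurable_digit_sum.
by move=> t _; exact: digit_sum_cvg.
Qed.

Lemma measurable_odds : measurable_fun [set: Rm] odds.
Proof. exact: (measurableT_comp measurable_evens measurable_shift). Qed.

Lemma evens01 t : 0 <= evens t <= 1.
Proof.
apply/andP; split.
  apply: limr_ge; first exact: digit_sum_cvg.
  by apply: nearW => k; have /andP[] := digit_sum01 k t.
apply: limr_le; first exact: digit_sum_cvg.
by apply: nearW => k; have /andP[] := digit_sum01 k t.
Qed.

Lemma evensE t : evens t = (bit t + odds (shift t)) / 2.
Proof.
have := @digit_sum_cvg t; rewrite -cvg_shiftS => h.
apply: (cvg_unique _ h) => //=.
apply: cvgMl; apply: cvgD; first exact: cvg_cst.
exact: digit_sum_cvg.
Qed.

End binary_digits.

Section independence.
Context {R : realType}.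
Local Notation Rm := (measurableTypeR R).
Local Notation mu := (@lebesgue_measure R).

Lemma measurable_le (f : Rm -> Rm) x : measurable_fun [set: Rm] f ->
  measurable [set t | f t <= x].
Proof.
move=> mf; rewrite -[X in measurable X]setTI.
have -> : [set t | f t <= x] = f @^-1` `]-oo, x].
  by apply/seteqP; split => t /=; rewrite in_itv/=.
by apply: mf => //; exact: measurable_itv.
Qed.

Definition cdf1 (x : R) : R := Pr [set t : Rm | t <= x].
Definition cdf2 (x y : R) : R := Pr [set t : Rm | evens t <= x /\ odds t <= y].

Lemma measurable_cdf1 x : measurable [set t : Rm | t <= x].
Proof. exact: (@measurable_le id). Qed.

Lemma measurable_cdf2 x y : measurable [set t : Rm | evens t <= x /\ odds t <= y].
Proof.
apply: measurableI; apply: measurable_le.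
  exact: measurable_evens.
exact: measurable_odds.
Qed.

Lemma cdf1_rec x : cdf1 x = (cdf1 (2 * x) + cdf1 (2 * x - 1)) / 2.
Proof.
apply: Pr_bit => [|||t bt|t bt]; try exact: measurable_cdf1.
  by rewrite /= /shift bt; split => ?; lra.
by rewrite /= /shift bt; split => ?; lra.
Qed.

Lemma cdf2_rec x y : cdf2 x y = (cdf2 y (2 * x) + cdf2 y (2 * x - 1)) / 2.
Proof.
apply: Pr_bit => [|||t bt|t bt]; try exact: measurable_cdf2.
  by rewrite /= evensE /odds bt; split => -[? ?]; split; lra.
by rewrite /= evensE /odds bt; split => -[? ?]; split; lra.
Qed.

Lemma Pr_ge0 (A : set Rm) : 0 <= Pr A.
Proof. by apply: fine_ge0. Qed.

Lemma Pr_le (A B : set Rm) : measurable A -> measurable B -> A `<=` B ->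
  Pr A <= Pr B.
Proof.
by move=> mA mB AB; rewrite -lee_fin -!PrE//; apply: le_measure => //; rewrite inE.
Qed.

Lemma Pr0 : Pr (set0 : set Rm) = 0. Proof. by rewrite /Pr measure0. Qed.
Lemma Pr1 : Pr [set: Rm] = 1. Proof. by rewrite /Pr probability_setT. Qed.

Lemma cdf1_le x y : x <= y -> cdf1 y - cdf1 x <= y - x.
Proof.
move=> xy; rewrite lerBlDl.
have mxy : measurable (`]x, y] : set Rm) by exact: measurable_itv.
have -> : cdf1 y = cdf1 x + Pr (`]x, y] : set Rm).
  rewrite /cdf1.
  have -> : [set t : Rm | t <= y] = [set t : Rm | t <= x] `|` `]x, y].
    apply/seteqP; split => t /=; rewrite in_itv/=.
      by move=> ty; case: (leP t x) => tx; [left|right].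
    by move=> [tx|/andP[]//]; exact: le_trans xy.
  rewrite /Pr measureU//; first by rewrite fineD ?fin_num_measure//; exact: measurable_cdf1.
    exact: measurable_cdf1.
  by apply/seteqP; split => // t /=; rewrite in_itv/= => -[tx /andP[]]; rewrite ltNge tx.
rewrite lerD2l -lee_fin -PrE// unifE//.
apply: (@le_trans _ _ (mu `]x, y])); first exact: measureIl.
rewrite lebesgue_measure_itv/= lte_fin; case: ifPn => //.
by rewrite lee_fin subr_ge0.
Qed.

Lemma cdf1_nd x y : x <= y -> cdf1 x <= cdf1 y.
Proof.
move=> xy; apply: Pr_le; try exact: measurable_cdf1.
by move=> t /= /le_trans; exact.
Qed.

Lemma cdf2_nd x y x' y' : x <= x' -> y <= y' -> cdf2 x y <= cdf2 x' y'.
Proof.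
move=> xy xy'; apply: Pr_le; try exact: measurable_cdf2.
by move=> t /= [tx ty]; split; [exact: le_trans xy|exact: le_trans xy'].
Qed.

Lemma cdf1_lt0 x : x < 0 -> cdf1 x = 0.
Proof.
move=> x0; rewrite /cdf1 /Pr unifE; last exact: measurable_cdf1.
rewrite [X in mu X](_ : _ = set0) ?measure0//.
by apply/seteqP; split => // t /=; rewrite in_itv/= => -[? /andP[? ?]]; lra.
Qed.

Lemma cdf1_le0 x : x <= 0 -> cdf1 x = 0.
Proof.
rewrite le_eqVlt => /orP[/eqP->|]; last exact: cdf1_lt0.
have := cdf1_rec 0; rewrite mulr0 sub0r (@cdf1_lt0 (-1)) ?ltrN10//; lra.
Qed.

Lemma cdf1_ge1 x : 1 <= x -> cdf1 x = 1.
Proof.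
move=> x1; apply/eqP; rewrite eq_le; apply/andP; split.
  by rewrite -Pr1; apply: Pr_le => //; exact: measurable_cdf1.
rewrite -lee_fin -PrE; last exact: measurable_cdf1.
rewrite unifE; last exact: measurable_cdf1.
rewrite (_ : _ `&` _ = `[0, 1]%classic).
  by rewrite lebesgue_measure_itv/= lte_fin ltr01 oppr0 adde0.
by apply/seteqP; split => t /=; rewrite in_itv/=; [move=> []|move=> /andP[t0 t1]; split; [lra|rewrite t0]].
Qed.

Lemma cdf2_lt0 x y : x < 0 \/ y < 0 -> cdf2 x y = 0.
Proof.
move=> xy; rewrite /cdf2 (_ : [set _ | _] = set0) ?Pr0//.
apply/seteqP; split => // t /= [h1 h2].
have /andP[? ?] := evens01 t; have /andP[] := evens01 (shift t).
by rewrite -/(odds t) => ? ?; case: xy => ?; lra.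
Qed.

Lemma cdf2_ge1 x y : 1 <= x -> 1 <= y -> cdf2 x y = 1.
Proof.
move=> x1 y1; rewrite /cdf2 (_ : [set _ | _] = setT) ?Pr1//.
apply/seteqP; split => // t _ /=.
have /andP[? ?] := evens01 t; have /andP[] := evens01 (shift t).
by rewrite -/(odds t) => ? ?; split; lra.
Qed.

Lemma cdf2_x0 y : cdf2 0 y = 0.
Proof.
have h z : 1 <= z -> cdf2 0 z = 0.
  move=> z1; have e1 : cdf2 0 z = cdf2 z 0 / 2.
    by rewrite cdf2_rec mulr0 sub0r (@cdf2_lt0 z (-1)) ?addr0//; right; rewrite ltrN10.
  have : cdf2 z 0 <= cdf2 0 z.
    rewrite (cdf2_rec z 0).
    have h1 : cdf2 0 (2 * z) = cdf2 0 z.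
      rewrite /cdf2; congr Pr; apply/seteqP; split => t /= [? ?]; split => //.
        have /andP[] := evens01 (shift t); rewrite -/(odds t) => ? ?; lra.
      lra.
    have h2 : cdf2 0 (2 * z - 1) = cdf2 0 z.
      rewrite /cdf2; congr Pr; apply/seteqP; split => t /= [? ?]; split => //.
        have /andP[] := evens01 (shift t); rewrite -/(odds t) => ? ?; lra.
      lra.
    rewrite h1 h2; lra.
  have := Pr_ge0 [set t : Rm | evens t <= 0 /\ odds t <= z]; rewrite -/(cdf2 0 z).
  lra.
apply/eqP; rewrite eq_le Pr_ge0 andbT.
apply: le_trans (_ : cdf2 0 (Num.max 1 y) <= 0).
  by apply: cdf2_nd => //; rewrite le_max lexx orbT.
by rewrite h// le_max lexx.
Qed.

Lemma cdf2_0y x : cdf2 x 0 = 0.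
Proof.
have := cdf2_rec 0 x; rewrite mulr0 sub0r cdf2_x0 (@cdf2_lt0 x (-1)); last first.
  by right; rewrite ltrN10.
lra.
Qed.

Lemma cdf2_int (i j : int) : cdf2 i%:~R j%:~R = cdf1 i%:~R * cdf1 j%:~R.
Proof.
have [i0|i0] := leP i%:~R (0 : R).
  rewrite (cdf1_le0 i0) mul0r; move: i0; rewrite le_eqVlt => /orP[/eqP->|i0].
    exact: cdf2_x0.
  by apply: cdf2_lt0; left.
have [j0|j0] := leP j%:~R (0 : R).
  rewrite (cdf1_le0 j0) mulr0; move: j0; rewrite le_eqVlt => /orP[/eqP->|j0].
    exact: cdf2_0y.
  by apply: cdf2_lt0; right.
have i1 : 1 <= i%:~R :> R by rewrite ler1z; move: i0; rewrite ltr0z.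
have j1 : 1 <= j%:~R :> R by rewrite ler1z; move: j0; rewrite ltr0z.
by rewrite cdf2_ge1// !cdf1_ge1// mulr1.
Qed.

Lemma cdf2_dyadic k (i j : int) (x y : R) :
  x * 2 ^+ k = i%:~R -> y * 2 ^+ k = j%:~R -> cdf2 x y = cdf1 x * cdf1 y.
Proof.
elim: k i j x y => [|k ih] i j x y.
  by rewrite !mulr1 => -> ->; exact: cdf2_int.
move=> xi yj.
have E (c d : bool) : cdf2 (2 * x - c%:R) (2 * y - d%:R) =
    cdf1 (2 * x - c%:R) * cdf1 (2 * y - d%:R).
  apply: (ih (i - (c * 2 ^ k)%:Z) (j - (d * 2 ^ k)%:Z)).
    have -> : (2 * x - c%:R) * 2 ^+ k = x * 2 ^+ k.+1 - c%:R * 2 ^+ k.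
      by rewrite exprS; ring.
    by rewrite xi rmorphB/= -pmulrn natrM natrX.
  have -> : (2 * y - d%:R) * 2 ^+ k = y * 2 ^+ k.+1 - d%:R * 2 ^+ k.
    by rewrite exprS; ring.
  by rewrite yj rmorphB/= -pmulrn natrM natrX.
rewrite cdf2_rec (cdf2_rec y (2 * x)) (cdf2_rec y (2 * x - 1)).
rewrite (cdf1_rec x) (cdf1_rec y).
have := E false false; have := E false true; have := E true false.
have := E true true; rewrite !subr0 => -> -> -> ->.
by field.
Qed.

Lemma cdf2E x y : cdf2 x y = cdf1 x * cdf1 y.
Proof.
pose e (k : nat) : R := (2 ^+ k)^-1.
have e0 k : 0 < e k by rewrite invr_gt0 exprn_gt0.
pose f k (z : R) : R := (Num.floor (z * 2 ^+ k))%:~R * e k.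
have f1 k z : f k z <= z.
  by rewrite ler_pdivrMr ?exprn_gt0// floor_le.
have f2 k z : z <= f k z + e k.
  have -> : f k z + e k = ((Num.floor (z * 2 ^+ k))%:~R + 1) * e k.
    by rewrite mulrDl mul1r.
  rewrite ler_pdivlMr ?exprn_gt0//.
  by rewrite -(intrD _ _ 1) ltW// floorD1_gt.
have g01 z : 0 <= cdf1 z <= 1.
  by rewrite Pr_ge0/= -Pr1; apply: Pr_le => //; exact: measurable_cdf1.
have K k : cdf2 (f k x) (f k y) = cdf1 (f k x) * cdf1 (f k y).
  by apply: (@cdf2_dyadic k); rewrite mulfVK// gt_eqF// exprn_gt0.
have K' k : cdf2 (f k x + e k) (f k y + e k) = cdf1 (f k x + e k) * cdf1 (f k y + e k).
  apply: (@cdf2_dyadic k (Num.floor (x * 2 ^+ k) + 1) (Num.floor (y * 2 ^+ k) + 1)).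
    by rewrite mulrDl mulfVK ?gt_eqF ?exprn_gt0// mulVf ?gt_eqF ?exprn_gt0// intrD.
  by rewrite mulrDl mulfVK ?gt_eqF ?exprn_gt0// mulVf ?gt_eqF ?exprn_gt0// intrD.
have B k : `|cdf2 x y - cdf1 x * cdf1 y| <= 2 * e k.
  have l1 := cdf2_nd (f1 k x) (f1 k y); have l2 := cdf2_nd (f2 k x) (f2 k y).
  rewrite K in l1; rewrite K' in l2.
  have a1 := cdf1_nd (f1 k x); have a2 := cdf1_nd (f2 k x).
  have b1 := cdf1_nd (f1 k y); have b2 := cdf1_nd (f2 k y).
  have fe z : f k z <= f k z + e k by rewrite lerDl ltW.
  have c1 := cdf1_le (fe x); have c2 := cdf1_le (fe y).
  rewrite addrAC subrr add0r in c1; rewrite addrAC subrr add0r in c2.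
  have /andP[p1 p2] := g01 (f k x); have /andP[q1 q2] := g01 (f k y).
  have /andP[r1 r2] := g01 (f k x + e k); have /andP[s1 s2] := g01 (f k y + e k).
  have /andP[t1 t2] := g01 x; have /andP[u1 u2] := g01 y.
  have m1 : cdf1 (f k x) * cdf1 (f k y) <= cdf1 x * cdf1 y by rewrite ler_pM.
  have m2 : cdf1 x * cdf1 y <= cdf1 (f k x + e k) * cdf1 (f k y + e k) by rewrite ler_pM.
  have m3 : cdf1 (f k x + e k) * cdf1 (f k y + e k) - cdf1 (f k x) * cdf1 (f k y) <= 2 * e k.
    have -> : cdf1 (f k x + e k) * cdf1 (f k y + e k) - cdf1 (f k x) * cdf1 (f k y) =
      (cdf1 (f k x + e k) - cdf1 (f k x)) * cdf1 (f k y + e k) +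
      cdf1 (f k x) * (cdf1 (f k y + e k) - cdf1 (f k y)) by ring.
    have -> : 2 * e k = e k * 1 + 1 * e k by ring.
    by apply: lerD; apply: ler_pM; rewrite // subr_ge0 cdf1_nd.
  by rewrite ler_distl; apply/andP; split; lra.
apply/eqP; rewrite -subr_eq0 -normr_le0.
apply/ler_addgt0Pl => eps eps0; rewrite addr0.
have : (fun k => 2 * e k) @ \oo --> (2 * 0 : R).
  apply: cvgMr; have -> : e = (fun k => (2^-1 : R) ^+ k).
    by apply/funext => k; rewrite exprVn.
  by apply: cvg_expr; rewrite ger0_norm ?invr_ge0// invf_lt1// ltr1n.
rewrite mulr0 => /cvgr_lt/(_ _ eps0)[k _ /(_ k (leqnn k))/= ke].
exact: le_trans (B k) (ltW ke).
Qed.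

Lemma cdf_unique (m1 m2 : {measure set Rm -> \bar R}) :
  (m1 setT < +oo)%E ->
  (forall x, m1 [set t : Rm | t <= x] = m2 [set t : Rm | t <= x]) ->
  forall A, measurable A -> m1 A = m2 A.
Proof.
move=> m1oo m12.
have fin A : measurable A -> (m1 A < +oo)%E.
  by move=> mA; apply: le_lt_trans m1oo; apply: le_measure => //; rewrite inE.
apply: (@measure_unique _ R Rm (@ocitv R) (fun n => `]- n%:R, n%:R]%classic) _ _ _ _ m1 m2) => //.
- exact: ocitvI.
- by move=> n; exact: is_ocitv.
- apply/seteqP; split => // t _.
  exists (Num.truncn `|t|).+1 => //=; rewrite in_itv/=.
  by have := truncnS_gt `|t|; rewrite ltr_norml => /andP[-> /ltW].
- move=> A /ocitvP[->|[[x y]/= xy ->]]; first by rewrite !measure0.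
  have -> : `]x, y]%classic = [set t : Rm | t <= y] `\` [set t : Rm | t <= x].
    apply/seteqP; split => t /=; rewrite in_itv/=.
      by move=> /andP[h1 h2]; split => //; apply/negP; rewrite -ltNge.
    by move=> [-> /negP]; rewrite -ltNge => ->.
  have I : [set t : Rm | t <= y] `&` [set t : Rm | t <= x] = [set t : Rm | t <= x].
    by apply/setIidPr => t /= tx; exact: le_trans (ltW xy).
  have H1 : (m1 [set t : Rm | (t <= y)%R] < +oo)%E.
    by apply: fin; exact: measurable_cdf1.
  have H2 : (m2 [set t : Rm | (t <= y)%R] < +oo)%E by rewrite -m12.
  rewrite !measureD//; try exact: measurable_cdf1.
  by rewrite !I; congr (_ - _)%E; exact: m12.
- by move=> n; apply: fin; exact: measurable_itv.
Qed.

Lemma evens_odds (A B : set Rm) : measurable A -> measurable B ->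
  Pr (evens @^-1` A `&` odds @^-1` B) = Pr A * Pr B.
Proof.
have mD y : measurable [set t : Rm | odds t <= y].
  by apply: measurable_le; exact: measurable_odds.
have step1 y (C : set Rm) : measurable C ->
    Pr (evens @^-1` C `&` [set t | odds t <= y]) = Pr C * cdf1 y.
  move=> mC.
  pose p : {nonneg R} := NngNum (Pr_ge0 [set t : Rm | t <= y]).
  have mp : measurable (evens @^-1` C).
    exact: measurable_preimage (@measurable_evens R) mC.
  have : pushforward (mrestr unif (mD y)) evens C = mscale p unif C.
    have me := @measurable_evens R.
    apply: (@cdf_unique (pushforward (mrestr unif (mD y)) evens)) => //.
      change (unif (evens @^-1` setT `&` [set t : Rm | (odds t <= y)%R]) < +oo)%E.
      rewrite PrE ?ltry//.
      by apply: measurableI => //; exact: measurable_preimage me measurableT.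
    move=> x; change (unif [set t : Rm | (evens t <= x)%R /\ (odds t <= y)%R] =
      (p%:num)%:E * unif [set t : Rm | (t <= x)%R])%E.
    rewrite (PrE (measurable_cdf2 x y)) (PrE (measurable_cdf1 x)).
    by rewrite -/(cdf2 x y) cdf2E -EFinM mulrC.
  change (pushforward (mrestr unif (mD y)) evens C) with
    (unif (evens @^-1` C `&` [set t : Rm | (odds t <= y)%R])).
  rewrite /mscale/= !PrE//; last exact: measurableI.
  by rewrite -EFinM => -[->]; rewrite mulrC.
move=> mA mB.
have mU : measurable (evens @^-1` A).
  exact: measurable_preimage (@measurable_evens R) mA.
have mV : measurable (odds @^-1` B).
  exact: measurable_preimage (@measurable_odds R) mB.
pose p : {nonneg R} := NngNum (Pr_ge0 A).
have : pushforward (mrestr unif mU) odds B = mscale p unif B.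
  have me := @measurable_odds R.
  apply: (@cdf_unique (pushforward (mrestr unif mU) odds)) => //.
    change (unif (odds @^-1` setT `&` evens @^-1` A) < +oo)%E.
    rewrite PrE ?ltry//.
    by apply: measurableI => //; exact: measurable_preimage me measurableT.
  move=> x; change (unif ([set t : Rm | (odds t <= x)%R] `&` evens @^-1` A) =
    (p%:num)%:E * unif [set t : Rm | (t <= x)%R])%E.
  rewrite setIC.
  rewrite (PrE (measurable_cdf1 x)) PrE; last exact: measurableI.
  by rewrite step1// -EFinM.
change (pushforward (mrestr unif mU) odds B) with
  (unif (odds @^-1` B `&` evens @^-1` A)).
rewrite /mscale/= setIC !PrE//; last exact: measurableI.
by rewrite -EFinM => -[->].
Qed.

Definition unif_seq (j : nat) (t : Rm) : Rm := evens (iter j odds t).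

Lemma measurable_unif_seq j : measurable_fun [set: Rm] (unif_seq j).
Proof.
apply: (measurableT_comp (@measurable_evens R)).
elim: j => [|j ih]; first exact: measurable_id.
exact: (measurableT_comp (@measurable_odds R) ih).
Qed.

Lemma measurable_unif_cylinder n (A : nat -> set Rm) :
  (forall j, measurable (A j)) ->
  measurable [set t | forall j, (j < n)%N -> A j (unif_seq j t)].
Proof.
move=> mA.
have -> : [set t | forall j, (j < n)%N -> A j (unif_seq j t)] =
    \bigcap_(j in [set j | (j < n)%N]) (unif_seq j @^-1` A j) by [].
apply: bigcap_measurableType => j _.
exact: measurable_preimage (measurable_unif_seq j) (mA j).
Qed.

Lemma unif_seq_indep n (A : nat -> set Rm) : (forall j, measurable (A j)) ->
  Pr [set t | forall j, (j < n)%N -> A j (unif_seq j t)] =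
  \prod_(j < n) Pr (A j).
Proof.
elim: n A => [|n ih] A mA.
  by rewrite big_ord0 (_ : [set _ | _] = setT) ?Pr1//; apply/seteqP; split.
rewrite big_ord_recl -(ih (fun j => A j.+1))// -evens_odds//; last first.
  exact: (@measurable_unif_cylinder n (fun j => A j.+1)).
congr Pr; apply/seteqP; split => t /=.
  move=> h; split; first exact: (h 0%N).
  by move=> j jn; have := h j.+1 jn; rewrite /unif_seq iterSr.
move=> [h0 h] [|j]; first by [].
by rewrite ltnS => /h; rewrite /unif_seq iterSr.
Qed.

End independence.

Section product.
Context {R : realType}.
Local Notation Rm := (measurableTypeR R).

Definition unif_torus (t : Rm) : torus R := fun j => expi (unif_seq j t).

Lemma measurable_unif_torus : measurable_fun [set: Rm] unif_torus.
Proof.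
apply: (@measurability _ _ Rm (torus R) setT unif_torus (@torus_cylinders R)) => //.
move=> _ [_ [j _ [B mB <-]] <-]; rewrite !setTI.
apply: (measurable_preimage _ mB).
exact: (measurableT_comp (@measurable_expi R) (measurable_unif_seq j)).
Qed.

HB.instance Definition _ :=
  isMeasurableFun.Build _ _ _ _ unif_torus measurable_unif_torus.

Lemma existence : exists P : probability (torus R) R, is_product_measure P.
Proof.
exists (distribution (@unif R) unif_torus) => n A mA.
have mA' j : measurable (expi @^-1` A j).
  exact: measurable_preimage (@measurable_expi R) (mA j).
transitivity ((\prod_(j < n) Pr (expi @^-1` A j))%:E).
  rewrite -(unif_seq_indep n mA') -PrE//.
  exact: (@measurable_unif_cylinder R n (fun j => expi @^-1` A j)).
rewrite -prodEFin; apply: eq_bigr => j _.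
by rewrite -PrE.
Qed.

End product.
End ProductMeasure.

(* The measure m on T^oo; [torus_measureP] determines it uniquely, the finite
   cylinders being a pi-system that generates the sigma-algebra of [torus]. *)
Definition torus_measure (R : realType) : probability (torus R) R :=
  sval (cid (@ProductMeasure.existence R)).

Lemma torus_measureP (R : realType) : is_product_measure (torus_measure R).
Proof. exact: svalP (cid (@ProductMeasure.existence R)). Qed.

(* Z^(N); the coordinates of sequences are numbered from 0 *)
Definition multi_index : choiceType := {fsfun nat -> int with 0}.

Definition nonneg_indices : set multi_index :=
  [set a : multi_index | forall j, 0 <= a j].

Definition degree (a : multi_index) : int := \sum_(j <- finsupp a) a j.

Section hardy.
Context {R : realType}.

(* Integer exponents, so that it also makes sense for a in Z^(N) when z has no
   zero coordinate *)
Definition monomial (z : nat -> R[i]) (a : multi_index) : R[i] :=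
  \prod_(j <- finsupp a) z j ^ a j.

Definition Cintegral (f : torus R -> R[i]) : R[i] :=
  (\int[torus_measure R]_w complex.Re (f w))
  +i* (\int[torus_measure R]_w complex.Im (f w)).

Definition fourier_coeff (f : torus R -> R[i]) (a : multi_index) : R[i] :=
  Cintegral (fun w => f w * (monomial (fun j => sval (w j)) a)^-1).

Definition Lp_norm (p : \bar R) (f : torus R -> R[i]) : \bar R :=
  ('N[torus_measure R]_p[EFin \o (@cmod R \o f)])%E.

(* Functions rather than classes modulo a.e. equality: [Lp_norm] and
   [fourier_coeff] do not distinguish a.e. equal functions *)
Definition Lp (p : \bar R) : set (torus R -> R[i]) :=
  [set f | [/\ measurable_fun [set: torus R] (fun w => complex.Re (f w)),
               measurable_fun [set: torus R] (fun w => complex.Im (f w)) &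
               (Lp_norm p f < +oo)%E]].

Definition hardy (p : \bar R) : set (torus R -> R[i]) :=
  [set f | Lp p f /\
    forall a, ~ nonneg_indices a -> fourier_coeff f a = 0].

Definition hardy_hom (m : nat) (p : \bar R) : set (torus R -> R[i]) :=
  [set f | hardy p f /\ forall a, fourier_coeff f a != 0 -> degree a = m%:Z].

Definition linf_norm (z : nat -> R[i]) : \bar R :=
  ereal_sup (range (fun j => (cmod (z j))%:E)).

Definition l2_norm (z : nat -> R[i]) : \bar R :=
  ((\sum_(0 <= j <oo) (cmod (z j) ^+ 2)%:E) `^ 2^-1)%E.

(* z_n^*, for n >= 1 *)
Definition decr_rearr (z : nat -> R[i]) (n : nat) : \bar R :=
  ereal_inf
    [set ereal_sup [set (cmod (z j))%:E | j in [set j | j \notin J]] |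
       J in [set J : {fset nat} | (#|` J| < n)%N]].

(* The norm of l_{q,oo}, with the sup norm for q = +oo (junk value at -oo) *)
Definition weak_norm (q : \bar R) (z : nat -> R[i]) : \bar R :=
  if q is r%:E then
    ereal_sup [set (decr_rearr z n * (n%:R `^ r^-1)%:E)%E |
                 n in [set n | (0 < n)%N]]
  else linf_norm z.

Definition linf : set (nat -> R[i]) := [set z | (linf_norm z < +oo)%E].

Definition l2 : set (nat -> R[i]) := [set z | (l2_norm z < +oo)%E].

Definition weak_l (q : \bar R) : set (nat -> R[i]) :=
  [set z | linf z /\ (weak_norm q z < +oo)%E].

Definition polydisc : set (nat -> R[i]) := [set z | (linf_norm z < 1)%E].

Definition mon_hardy_hom (m : nat) (p : \bar R) : set (nat -> R[i]) :=
  [set z | polydisc z /\ forall f, hardy_hom m p f ->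
    (\esum_(a in nonneg_indices) (cmod (fourier_coeff f a * monomial z a))%:E
       < +oo)%E].

(* 2m/(m-1), read as +oo for m = 1 *)
Definition weak_exponent (m : nat) : \bar R :=
  if m == 1%N then +oo%E else ((2 * m)%:R / (m - 1)%:R)%:E.

Definition seq_norm (m : nat) (p : \bar R) (z : nat -> R[i]) : \bar R :=
  if p == +oo%E then weak_norm (weak_exponent m) z else l2_norm z.

End hardy.
Arguments l2 : clear implicits.
Arguments linf : clear implicits.
Arguments polydisc : clear implicits.
Arguments weak_exponent : clear implicits.

(* Main.v *)
(* Everything is reduced to m-homogeneous polynomials in finitely many variables.

   Upper bounds.  Convolving f with a Fejer kernel gives an m-homogeneous
   polynomial P with |fhat a| <= 2 |Phat a| and no larger norm.  For p < oo,
   ||P||_2 <= C^m ||P||_1 because ||P||_4^4 = ||P^2||_2^2 <= 4^m ||P||_2^4, and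
   Cauchy-Schwarz together with sum_(|a| = m) |z^a|^2 <= C^m ||z||_2^(2 m)
   concludes.  For p = oo, write |z^a| = |z_k| |z^b|, where k is the index in a
   that minimizes |z_k|, apply Cauchy-Schwarz for each k separately, and use
   sum_k ||d_k P||_2 <= C^m ||P||_oo, which follows from the L^1 comparison
   above and the maximum modulus principle.

   Necessity.  If z belongs to mon, the sums of |Phat a z^a| are bounded on the
   unit ball: otherwise a gliding hump gives signs e_i and polynomials P_i for
   which sum_i e_i 3^-i P_i is a Hardy function with divergent monomial series.
   This bound is tested for p < oo on w_(j0)^(m - 1) sum_(j < n) conj(z_j) w_j,
   and for p = oo on sum H(i_1, i_2) ... H(i_(m-1), i_m) w^1_(i_1) ... w^m_(i_m),
   with H a Hadamard matrix of order n and m disjoint blocks of n variables;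
   this polynomial is bounded by n^((m + 1) / 2) and its n^m coefficients are
   +1 or -1. *)

From HB Require Import structures.
Require Import Defs.
From mathcomp Require Import all_boot all_order all_algebra finmap.
From mathcomp Require Import complex.
From mathcomp Require mpoly.
Import -(notations) mpoly.
From mathcomp Require Import all_classical all_reals all_analysis.
From mathcomp Require Import ess_sup_inf measurable_realfun ring lra.

Set Implicit Arguments.
Unset Strict Implicit.
Unset Printing Implicit Defensive.
Import Order.TTheory GRing.Theory Num.Theory.
Import numFieldNormedType.Exports.

Local Open Scope classical_set_scope.
Local Open Scope ring_scope.
Local Open Scope complex_scope.

(** * The circle and the torus *)

(** The obstacle is uniformity in the number N of variables: an estimate for polynomials may cost a
    factor C^m, but nothing that grows with N. Homogeneity provides this. A Fejer box of side L = 2m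
    + 1 damps the coefficient at c by prod (1 - c_i / L) >= 1 - m / L >= 1/2, whatever N is. An
    exponent of degree 2m splits into a sum of two exponents in at most 2^(2m) ways. The generating
    functions of monomials are evaluated where their logarithm is at most of order m. The maximum
    principle is obtained from powers p^n, where a factor polynomial in n disappears as n grows. The
    gliding hump invokes no completeness of a space of functions: the limit is built pointwise under
    an integrable majorant. For p = oo the constant 1 is such a majorant. For p < oo the humps are
    normalized in L_2; repeated squaring bounds them in L_q for q = 2^(i + 1) >= p, and a common
    majorant exists at the price of a factor 2^k for the k-th hump. The weights 3^-k still leave a
    geometric series of ratio 2/3. *)

Section modulus.
Context {R : realType}.
Implicit Types z w : R[i].

Lemma cmodE z : cmod z = Num.sqrt (complex.Re z ^+ 2 + complex.Im z ^+ 2).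
Proof. by rewrite /cmod normc_def. Qed.

Lemma cmodC z : (cmod z)%:C = `|z|.
Proof. by rewrite cmodE normc_def. Qed.

Lemma cmod_ge0 z : 0 <= cmod z.
Proof. by rewrite cmodE sqrtr_ge0. Qed.

Lemma cmodM z w : cmod (z * w) = cmod z * cmod w.
Proof. by apply: complexI; rewrite rmorphM/= !cmodC normrM. Qed.

Lemma cmod1 : cmod (1 : R[i]) = 1.
Proof. by apply: complexI; rewrite cmodC normr1. Qed.

Lemma cmod0 : cmod (0 : R[i]) = 0.
Proof. by apply: complexI; rewrite cmodC normr0. Qed.

Lemma cmod_eq0 z : (cmod z == 0) = (z == 0).
Proof. by rewrite -(inj_eq (@complexI R)) cmodC normr_eq0. Qed.

Lemma cmodN z : cmod (- z) = cmod z.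
Proof. by apply: complexI; rewrite !cmodC normrN. Qed.

Lemma cmodV z : cmod z^-1 = (cmod z)^-1.
Proof. by apply: complexI; rewrite fmorphV/= !cmodC normfV. Qed.

Lemma cmodX z n : cmod (z ^+ n) = cmod z ^+ n.
Proof. by apply: complexI; rewrite rmorphXn/= !cmodC normrX. Qed.

Lemma cmod_conj z : cmod z^*%C = cmod z.
Proof. by apply: complexI; rewrite !cmodC normcJ. Qed.

Lemma cmod_prod (I : Type) (r : seq I) (P : pred I) (F : I -> R[i]) :
  cmod (\prod_(i <- r | P i) F i) = \prod_(i <- r | P i) cmod (F i).
Proof. by rewrite (big_morph _ cmodM cmod1). Qed.

Lemma cmod_realC (x : R) : cmod x%:C = `|x|.
Proof. by rewrite cmodE /= expr0n addr0 sqrtr_sqr. Qed.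

Lemma ler_cmodD z w : cmod (z + w) <= cmod z + cmod w.
Proof. by rewrite -lecR rmorphD/= !cmodC ler_normD. Qed.

Lemma ler_cmod_sum (I : Type) (r : seq I) (P : pred I) (F : I -> R[i]) :
  cmod (\sum_(i <- r | P i) F i) <= \sum_(i <- r | P i) cmod (F i).
Proof.
elim/big_ind2 : _ => [|z x w y zx wy|i _]; rewrite ?cmod0//.
by apply: le_trans (ler_cmodD _ _) _; exact: lerD.
Qed.

Lemma cmod_sqr z : cmod z ^+ 2 = complex.Re z ^+ 2 + complex.Im z ^+ 2.
Proof. by rewrite cmodE sqr_sqrtr// addr_ge0// sqr_ge0. Qed.

Lemma cmod_sqrC z : (cmod z ^+ 2)%:C = z * z^*%C.
Proof. by rewrite -sqr_normc rmorphXn/= cmodC. Qed.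

Lemma ler_Re_cmod z : `|complex.Re z| <= cmod z.
Proof. by rewrite -lecR cmodC normc_ge_Re. Qed.

Lemma ler_Im_cmod z : `|complex.Im z| <= cmod z.
Proof. by rewrite cmodE -sqrtr_sqr ler_wsqrtr// lerDr sqr_ge0. Qed.

Lemma ler_cmod_ReIm z : cmod z <= `|complex.Re z| + `|complex.Im z|.
Proof.
rewrite -(@ler_pXn2r _ 2%N)// ?nnegrE ?cmod_ge0 ?addr_ge0//.
by rewrite cmod_sqr sqrrD !real_normK ?num_real// lerD2r lerDl mulrn_wge0.
Qed.

Lemma cmod_natr n : cmod (n%:R : R[i]) = n%:R.
Proof.
have -> : (n%:R : R[i]) = (n%:R)%:C by rewrite rmorph_nat.
by rewrite cmod_realC ger0_norm.
Qed.

Lemma cmod_intexp z (k : int) : cmod (z ^ k) = cmod z ^ k.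
Proof. by case: k => n; rewrite ?NegzE -?exprnN -?exprnP ?cmodV cmodX. Qed.

Lemma ReD z w : complex.Re (z + w) = complex.Re z + complex.Re w.
Proof. by case: z w => ? ? []. Qed.

Lemma ImD z w : complex.Im (z + w) = complex.Im z + complex.Im w.
Proof. by case: z w => ? ? []. Qed.

Lemma ReM z w : complex.Re (z * w) =
  complex.Re z * complex.Re w - complex.Im z * complex.Im w.
Proof. by case: z w => ? ? []. Qed.

Lemma ImM z w : complex.Im (z * w) =
  complex.Re z * complex.Im w + complex.Im z * complex.Re w.
Proof. by case: z w => ? ? []. Qed.

Lemma complex_eq z w : complex.Re z = complex.Re w ->
  complex.Im z = complex.Im w -> z = w.
Proof. by case: z w => ? ? [? ?] /= -> ->. Qed.

End modulus.

Lemma lebesgue_translate {R : realType} (a : R) (A : set (measurableTypeR R)) :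
  measurable A ->
  lebesgue_measure ((fun t => t + a) @^-1` A) = lebesgue_measure A.
Proof.
move=> mA.
have mf : measurable_fun [set: measurableTypeR R]
    (fun t : measurableTypeR R => (t + a)%R : measurableTypeR R).
  exact: measurable_funD.
apply/esym/(@lebesgue_measure_unique R
  (pushforward lebesgue_measure (fun t : measurableTypeR R => (t + a)%R : measurableTypeR R))) => //.
move=> _ [[x y] _ <-]/=.
rewrite /pushforward/=.
have -> : (fun t : R => t + a) @^-1` `]x, y] = `](x - a), (y - a)]%classic.
  apply/seteqP; split => t /=; rewrite !in_itv/= => /andP[h1 h3]; apply/andP; split; lra.
rewrite !lebesgue_measure_itv/= !lte_fin ltrD2r.
case: ifPn => // _; rewrite -!EFinB; congr EFin; ring.
Qed.

(** * Rotation invariance of arc length *)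

Section rotation.
Context {R : realType}.
Local Notation Rm := (measurableTypeR R).
Local Notation mu := (@lebesgue_measure R).

Lemma circle_mul_subproof (c d : circle R) : `|sval c * sval d| == 1.
Proof. by rewrite normrM (eqP (svalP c)) (eqP (svalP d)) mulr1. Qed.

Definition circle_mul (c d : circle R) : circle R :=
  exist (fun z : R[i] => `|z| == 1) _ (circle_mul_subproof c d).

Lemma circle_inj (c d : circle R) : sval c = sval d -> c = d.
Proof. by move=> cd; apply: eq_sig_hprop => // z p q; exact: eq_irrelevance. Qed.

Lemma sval_expi (t : R) :
  sval (expi t) = (cos (2 * pi * t) +i* sin (2 * pi * t)).
Proof. by []. Qed.

Lemma expiD (s t : R) : circle_mul (expi s) (expi t) = expi (s + t).
Proof.
apply: circle_inj => /=; apply: complex_eq; rewrite ?ReM ?ImM/= (mulrDr (2 * pi) s t).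
  by rewrite cosD.
by rewrite sinD addrC; congr (_ + _); rewrite mulrC.
Qed.

Lemma expi1D (t : R) : expi (1 + t) = expi t.
Proof.
apply: circle_inj; rewrite !sval_expi mulrDr mulr1.
have -> : 2 * pi + 2 * pi * t = 2 * pi * t + pi *+ 2 by rewrite mulr2n; ring.
by rewrite cosD2pi sinD2pi.
Qed.

Lemma measurable_circle_coord : measurable_fun [set: circle R] (@circle_coord R).
Proof.
move=> _ B mB; rewrite setTI; exists B => //; by rewrite setTI.
Qed.

Lemma measurable_sval_Re : measurable_fun [set: circle R] (fun c => complex.Re (sval c)).
Proof. exact: (measurableT_comp (@measurable_fst _ _ R R) measurable_circle_coord). Qed.

Lemma measurable_sval_Im : measurable_fun [set: circle R] (fun c => complex.Im (sval c)).
Proof. exact: (measurableT_comp (@measurable_snd _ _ R R) measurable_circle_coord). Qed.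

Lemma measurable_circle_mul (c : circle R) :
  measurable_fun [set: circle R] (circle_mul c).
Proof.
move=> _ _ [B mB <-]; rewrite !setTI.
have mg : measurable_fun [set: circle R]
    (fun d => circle_coord (circle_mul c d)).
  apply: measurable_fun_pair => /=.
  - under eq_fun do rewrite ReM.
    by apply: measurable_funB; apply: measurable_funM => //;
      [exact: measurable_sval_Re|exact: measurable_sval_Im].
  - under eq_fun do rewrite ImM.
    by apply: measurable_funD; apply: measurable_funM => //;
      [exact: measurable_sval_Im|exact: measurable_sval_Re].
by rewrite -[X in measurable X]setTI; exact: mg.
Qed.

(** Dropping the null point 1 leaves a half-open fundamental domain, which a rotation cuts into two
    disjoint half-open pieces. *)
Lemma circle_measureE (A : set (circle R)) : measurable A ->
  circle_measure R A = mu (expi @^-1` A `&` `[0, 1[).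
Proof.
move=> mA.
have mE : measurable (expi @^-1` A : set Rm).
  exact: ProductMeasure.measurable_preimage (@measurable_expi R) mA.
rewrite -[LHS]/(ProductMeasure.unif (expi @^-1` A)) ProductMeasure.unifE//.
have -> : expi @^-1` A `&` `[0, 1] =
    (expi @^-1` A `&` `[0, 1[) `|` (expi @^-1` A `&` [set 1]).
  rewrite -setIUr; congr (_ `&` _).
  by rewrite setUitv1// bnd_simp.
rewrite measureU//=.
- rewrite [X in (_ + X)%E](_ : _ = 0%E) ?adde0//.
  apply: (@subset_measure0 _ _ _ mu _ [set 1]) => //.
    exact: measurableI.
  exact: lebesgue_measure_set1.
- exact: measurableI.
- exact: measurableI.
- apply/seteqP; split => // t /= [[_ ]]; rewrite in_itv/= => /andP[_ t1] [_ te].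
  by rewrite te ltxx in t1.
Qed.

(** The points t of [0, 1[ are split according to whether t + s stays below 1. Translation by s
    carries the first part into [s, 1[, translation by s - 1 carries the second into [0, s[, and
    Lebesgue measure is translation invariant. *)
Lemma circle_measure_rot (s : R) (A : set (circle R)) : 0 <= s <= 1 ->
  measurable A ->
  circle_measure R (circle_mul (expi s) @^-1` A) = circle_measure R A.
Proof.
move=> /andP[s0 s1] mA.
have mE : measurable (expi @^-1` A : set Rm).
  exact: ProductMeasure.measurable_preimage (@measurable_expi R) mA.
rewrite !circle_measureE//; last first.
  exact: ProductMeasure.measurable_preimage (measurable_circle_mul _) mA.
have -> : expi @^-1` (circle_mul (expi s) @^-1` A) `&` `[0, 1[ =
    ((fun t => t + s) @^-1` (expi @^-1` A `&` `[s, 1[)) `|`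
    ((fun t => t + (s - 1)) @^-1` (expi @^-1` A `&` `[0, s[)).
  apply/seteqP; split => t /=.
    rewrite !in_itv/= expiD => -[At /andP[t0 t1]].
    have [ts|ts] := ltP (t + s) 1; [left|right].
      by rewrite (addrC t s); split => //; lra.
    split; last by lra.
    by rewrite -expi1D; have -> : 1 + (t + (s - 1)) = s + t by ring.
  rewrite !in_itv/= expiD => -[[At /andP[t0 t1]]|[At /andP[t0 t1]]].
    by rewrite addrC; split => //; lra.
  split; last by lra.
  by rewrite -expi1D in At; have <- : 1 + (t + (s - 1)) = s + t by ring.
have mI (a b : R) : measurable (expi @^-1` A `&` `[a, b[ : set Rm).
  by apply: measurableI => //; exact: measurable_itv.
have mT (a : R) (B : set Rm) : measurable B ->
    measurable ((fun t => t + a) @^-1` B : set Rm).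
  apply: ProductMeasure.measurable_preimage.
  exact: measurable_funD.
rewrite measureU/=; [|by apply: mT; exact: mI|by apply: mT; exact: mI|].
  rewrite [X in (X + _)%E]lebesgue_translate// [X in (_ + X)%E]lebesgue_translate//.
  rewrite addeC -measureU//; last first.
    apply/seteqP; split => // t /=; rewrite !in_itv/= => -[[_ /andP[_ t1]] [_ /andP[t2 _]]].
    lra.
  rewrite -setIUr; congr (mu (_ `&` _)).
  apply/seteqP; split => t /=; rewrite !in_itv/=.
    by move=> [] /andP[? ?]; apply/andP; split; lra.
  move=> /andP[t0 t1]; have [ts|ts] := ltP t s; [left|right]; apply/andP; split; lra.
apply/seteqP; split => // t /=; rewrite !in_itv/= => -[[_ /andP[? ?]] [_ /andP[? ?]]].
lra.
Qed.

End rotation.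

(** * Invariance of the product measure under rotation of one coordinate *)

Section torus_rotation.
Context {R : realType}.
Local Notation P := (torus_measure R).

Lemma measurable_coord (j : nat) :
  measurable_fun [set: torus R] (fun w : torus R => w j : circle R).
Proof.
move=> _ B mB; apply: sub_sigma_algebra; exists j => //.
by exists B.
Qed.

Lemma measurable_to_torus d (T : measurableType d) (f : T -> torus R) :
  (forall j, measurable_fun [set: T] (fun t => f t j : circle R)) ->
  measurable_fun [set: T] f.
Proof.
move=> mf.
apply: (@measurability _ _ T (torus R) setT f (@torus_cylinders R)) => //.
move=> _ [_ [j _ [B mB <-]] <-]; rewrite !setTI.
exact: ProductMeasure.measurable_preimage (mf j) mB.
Qed.

Lemma torus_measure_unique (Q : probability (torus R) R) :
  is_product_measure Q -> forall A, measurable A -> P A = Q A.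
Proof.
move=> PQ.
pose G : set (set (torus R)) := [set A | exists n (B : nat -> set (circle R)),
  (forall j, measurable (B j)) /\ A = [set w | forall j, (j < n)%N -> B j (w j)]].
have GT : G setT by exists 0%N, (fun=> setT); split => //; apply/seteqP; split.
apply: (@measure_unique _ R (torus R) G (fun=> setT)) => //.
- apply/seteqP; split.
  + apply: smallest_sub; first exact: smallest_sigma_algebra.
    move=> _ [j _ [B mB <-]]; apply: sub_sigma_algebra.
    exists j.+1, (fun i => if i == j then B else setT); split.
      by move=> i; case: ifP.
    rewrite setTI; apply/seteqP; split => w /=.
      by move=> Bw i _; case: eqP => // ->.
    by move=> /(_ j (ltnSn j)); rewrite eqxx.
  + apply: smallest_sub; first exact: sigma_algebra_measurable.
    move=> _ [n [B [mB ->]]].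
    have -> : [set w : torus R | forall j, (j < n)%N -> B j (w j)] =
        \bigcap_(j in [set j | (j < n)%N]) ((fun w : torus R => w j) @^-1` B j) by [].
    apply: bigcap_measurableType => j _.
    exact: ProductMeasure.measurable_preimage (measurable_coord j) (mB j).
- move=> _ _ [n [B [mB ->]]] [k [D [mD ->]]].
  exists (maxn n k), (fun j => (if (j < n)%N then B j else setT) `&`
    (if (j < k)%N then D j else setT)); split.
    by move=> j; apply: measurableI; case: ifP.
  apply/seteqP; split => w /=.
    by move=> [h1 h2] j _; split; case: ifP => // jn; [exact: h1|exact: h2].
  by move=> h; split => j jn; have := h j; rewrite leq_max jn ?orbT => /(_ isT) [].
- by rewrite bigcup_const.
- by move=> _ [n [B [mB ->]]]; exact: etrans (torus_measureP n mB) (esym (PQ n B mB)).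
- by move=> _; rewrite -ge0_fin_numE// fin_num_measure.
Qed.

Definition torus_rot (j : nat) (s : R) (w : torus R) : torus R :=
  fun i => if i == j then circle_mul (expi s) (w i) else w i.

Lemma measurable_torus_rot j s : measurable_fun [set: torus R] (torus_rot j s).
Proof.
apply: measurable_to_torus => i; rewrite /torus_rot.
case: eqP => _; last exact: measurable_coord.
exact: (measurableT_comp (measurable_circle_mul _) (measurable_coord i)).
Qed.

HB.instance Definition _ j s :=
  isMeasurableFun.Build _ _ _ _ (torus_rot j s) (measurable_torus_rot j s).

(** The law of [torus_rot j s] is again a product measure, since only the j-th factor changes and
    arc length is invariant; uniqueness concludes. *)
Lemma torus_measure_rot j s (A : set (torus R)) : 0 <= s <= 1 ->
  measurable A -> P (torus_rot j s @^-1` A) = P A.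
Proof.
move=> s01 mA; apply/esym.
refine (etrans (@torus_measure_unique (distribution P (torus_rot j s)) _ A mA) _) => //.
move=> n B mB.
pose B' i := if i == j then circle_mul (expi s) @^-1` B i else B i.
have mB' i : measurable (B' i).
  rewrite /B'; case: ifP => _ //.
  exact: ProductMeasure.measurable_preimage (measurable_circle_mul _) (mB i).
transitivity (P [set w | forall i, (i < n)%N -> B' i (w i)]).
  congr (P _); apply/seteqP; split => w /= h i /h; rewrite /torus_rot /B';
  by case: ifP.
refine (etrans (torus_measureP n mB') _); apply: eq_bigr => i _.
rewrite /B'; case: ifP => // _; exact: circle_measure_rot.
Qed.

End torus_rotation.

(** * Complex-valued integrals over the torus *)

Section complex_integral.
Context {R : realType}.
Local Notation P := (torus_measure R).
Implicit Types (f g : torus R -> R[i]).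

Definition Cmeasurable f :=
  measurable_fun [set: torus R] (fun w => complex.Re (f w)) /\
  measurable_fun [set: torus R] (fun w => complex.Im (f w)).

Definition Cintegrable f :=
  P.-integrable setT (fun w => (complex.Re (f w))%:E) /\
  P.-integrable setT (fun w => (complex.Im (f w))%:E).

Definition Cbounded f :=
  Cmeasurable f /\ exists M, forall w, cmod (f w) <= M.

Lemma CmeasurableD f g : Cmeasurable f -> Cmeasurable g ->
  Cmeasurable (fun w => f w + g w).
Proof.
move=> [f1 f2] [g1 g2]; split.
  by under [X in measurable_fun _ X]eq_fun do rewrite ReD; exact: measurable_funD.
by under [X in measurable_fun _ X]eq_fun do rewrite ImD; exact: measurable_funD.
Qed.

Lemma CmeasurableM f g : Cmeasurable f -> Cmeasurable g ->
  Cmeasurable (fun w => f w * g w).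
Proof.
move=> [f1 f2] [g1 g2]; split.
  by under [X in measurable_fun _ X]eq_fun do rewrite ReM; apply: measurable_funB; exact: measurable_funM.
by under [X in measurable_fun _ X]eq_fun do rewrite ImM; apply: measurable_funD; exact: measurable_funM.
Qed.

Lemma Cmeasurable_cst c : Cmeasurable (fun=> c).
Proof. by split; exact: measurable_cst. Qed.

Lemma Cmeasurable_conj f : Cmeasurable f -> Cmeasurable (fun w => (f w)^*%C).
Proof.
have E1 (z : R[i]) : complex.Re z^*%C = complex.Re z by case: z.
have E2 (z : R[i]) : complex.Im z^*%C = - complex.Im z by case: z.
move=> [f1 f2]; split; first by under [X in measurable_fun _ X]eq_fun do rewrite E1.
by under [X in measurable_fun _ X]eq_fun do rewrite E2; exact: measurableT_comp.
Qed.

Lemma measurable_cmod f : Cmeasurable f ->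
  measurable_fun [set: torus R] (fun w => cmod (f w)).
Proof.
move=> [f1 f2]; under [X in measurable_fun _ X]eq_fun do rewrite cmodE.
apply: (measurableT_comp (f := @Num.sqrt R)).
  by apply: continuous_measurable_fun; exact: sqrt_continuous.
by apply: measurable_funD; exact: measurable_funX.
Qed.

Lemma CboundedD f g : Cbounded f -> Cbounded g -> Cbounded (fun w => f w + g w).
Proof.
move=> [mf [M fM]] [mg [N gN]]; split; first exact: CmeasurableD.
by exists (M + N) => w; apply: le_trans (ler_cmodD _ _) _; exact: lerD.
Qed.

Lemma CboundedM f g : Cbounded f -> Cbounded g -> Cbounded (fun w => f w * g w).
Proof.
move=> [mf [M fM]] [mg [N gN]]; split; first exact: CmeasurableM.
by exists (M * N) => w; rewrite cmodM ler_pM// cmod_ge0.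
Qed.

Lemma Cbounded_cst c : Cbounded (fun=> c).
Proof. by split; [exact: Cmeasurable_cst|exists (cmod c)]. Qed.

Lemma Cbounded_conj f : Cbounded f -> Cbounded (fun w => (f w)^*%C).
Proof.
move=> [mf [M fM]]; split; first exact: Cmeasurable_conj.
by exists M => w; rewrite cmod_conj.
Qed.

Lemma Cbounded_sum (I : Type) (r : seq I) (Q : pred I) (F : I -> torus R -> R[i]) :
  (forall i, Cbounded (F i)) -> Cbounded (fun w => \sum_(i <- r | Q i) F i w).
Proof.
move=> bF; elim: r => [|i r ih].
  rewrite (_ : (fun _ => _) = fun=> 0); first exact: Cbounded_cst.
  by apply/funext => w; rewrite big_nil.
rewrite (_ : (fun _ => _) = fun w =>
  if Q i then F i w + \sum_(j <- r | Q j) F j w else \sum_(j <- r | Q j) F j w).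
  by case: (Q i) => //; exact: CboundedD.
by apply/funext => w; rewrite big_cons.
Qed.

Lemma Cbounded_prod (I : Type) (r : seq I) (Q : pred I) (F : I -> torus R -> R[i]) :
  (forall i, Cbounded (F i)) -> Cbounded (fun w => \prod_(i <- r | Q i) F i w).
Proof.
move=> bF; elim: r => [|i r ih].
  rewrite (_ : (fun _ => _) = fun=> 1); first exact: Cbounded_cst.
  by apply/funext => w; rewrite big_nil.
rewrite (_ : (fun _ => _) = fun w =>
  if Q i then F i w * \prod_(j <- r | Q j) F j w else \prod_(j <- r | Q j) F j w).
  by case: (Q i) => //; exact: CboundedM.
by apply/funext => w; rewrite big_cons.
Qed.

Lemma CboundedX f n : Cbounded f -> Cbounded (fun w => f w ^+ n).
Proof.
move=> bf; elim: n => [|n ih].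
  exact: Cbounded_cst.
rewrite (_ : (fun _ => _) = fun w => f w * f w ^+ n); first exact: CboundedM.
by apply/funext => w; rewrite exprS.
Qed.

Lemma bounded_integrable (h : torus R -> R) (M : R) :
  measurable_fun [set: torus R] h -> (forall w, `|h w| <= M) ->
  P.-integrable setT (EFin \o h).
Proof.
move=> mh hM.
apply: (@measurable_bounded_integrable _ _ _ P _ setT) => //.
  by rewrite -ge0_fin_numE// fin_num_measure.
exists M; split; first exact: num_real.
by move=> N MN w _ /=; exact: le_trans (hM w) (ltW MN).
Qed.

Lemma Cbounded_integrable f : Cbounded f -> Cintegrable f.
Proof.
move=> [[m1 m2] [M fM]]; split.
  apply: (@bounded_integrable _ M) => // w.
  exact: le_trans (ler_Re_cmod _) (fM w).
apply: (@bounded_integrable _ M) => // w.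
exact: le_trans (ler_Im_cmod _) (fM w).
Qed.

Lemma Cintegrable_measurable f : Cintegrable f -> Cmeasurable f.
Proof.
by move=> [/measurable_int m1 /measurable_int m2]; split; exact/measurable_EFinP.
Qed.

Lemma integrable_cmod f : Cintegrable f ->
  P.-integrable setT (fun w => (cmod (f w))%:E).
Proof.
move=> If; have [f1 f2] := If.
have I2 := integrableD measurableT (integrable_abse f1) (integrable_abse f2).
apply: le_integrable I2 => //.
  by apply/measurable_EFinP; exact (measurable_cmod (Cintegrable_measurable If)).
move=> w _ /=; rewrite lee_fin ger0_norm ?cmod_ge0// ger0_norm ?addr_ge0//.
exact: ler_cmod_ReIm.
Qed.

Lemma cmod_integrable f : Cmeasurable f ->
  P.-integrable setT (fun w => (cmod (f w))%:E) -> Cintegrable f.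
Proof.
move=> [m1 m2] If; split.
  apply: le_integrable If => //; first exact/measurable_EFinP.
  by move=> w _ /=; rewrite lee_fin (le_trans (ler_Re_cmod _))// ler_norm.
apply: le_integrable If => //; first exact/measurable_EFinP.
by move=> w _ /=; rewrite lee_fin (le_trans (ler_Im_cmod _))// ler_norm.
Qed.

Lemma CintegrableM f g : Cintegrable f -> Cbounded g ->
  Cintegrable (fun w => f w * g w).
Proof.
move=> If [mg [M gM]].
have mf := Cintegrable_measurable If.
apply: cmod_integrable; first exact: CmeasurableM.
have Ic := integrableZr measurableT M (integrable_cmod If).
apply: le_integrable Ic => //.
  by apply/measurable_EFinP; apply: measurable_cmod; exact: CmeasurableM.
move=> w _ /=; rewrite lee_fin cmodM !ger0_norm ?mulr_ge0 ?cmod_ge0//.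
  by rewrite ler_wpM2l// cmod_ge0.
exact: le_trans (cmod_ge0 _) (gM w).
Qed.

Lemma CintegrableD f g : Cintegrable f -> Cintegrable g ->
  Cintegrable (fun w => f w + g w).
Proof.
move=> [f1 f2] [g1 g2]; split.
  rewrite (_ : (fun _ => _) = fun w => ((complex.Re (f w))%:E + (complex.Re (g w))%:E)%E).
    exact: integrableD.
  by apply/funext => w; rewrite ReD EFinD.
rewrite (_ : (fun _ => _) = fun w => ((complex.Im (f w))%:E + (complex.Im (g w))%:E)%E).
  exact: integrableD.
by apply/funext => w; rewrite ImD EFinD.
Qed.

Lemma CintegralD f g : Cintegrable f -> Cintegrable g ->
  Cintegral (fun w => f w + g w) = Cintegral f + Cintegral g.
Proof.
move=> [f1 f2] [g1 g2]; apply: complex_eq.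
  by rewrite ReD /=; under eq_Rintegral do rewrite ReD; rewrite RintegralD.
by rewrite ImD /=; under eq_Rintegral do rewrite ImD; rewrite RintegralD.
Qed.

Lemma CintegralZ c f : Cintegrable f ->
  Cintegral (fun w => c * f w) = c * Cintegral f.
Proof.
move=> [f1 f2].
have Z (r : R) (h : torus R -> R) : P.-integrable setT (EFin \o h) ->
    P.-integrable setT (EFin \o (fun w => r * h w)).
  by move=> Ih; exact: (integrableZl measurableT r Ih).
apply: complex_eq; rewrite ?ReM ?ImM /=.
  under eq_Rintegral do rewrite ReM.
  by rewrite RintegralB ?RintegralZl//; exact: Z.
under eq_Rintegral do rewrite ImM.
by rewrite RintegralD ?RintegralZl//; exact: Z.
Qed.

Lemma eq_Cintegral f g : f =1 g -> Cintegral f = Cintegral g.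
Proof. by move=> /funext ->. Qed.

Lemma Cintegral_cst (c : R[i]) : Cintegral (fun=> c) = c.
Proof.
have E (r : R) : \int[P]_w r = r.
  rewrite (@Rintegral_cst _ _ _ P setT measurableT).
  rewrite (_ : fine _ = 1) ?mulr1//.
  by apply: (congr1 fine (y := 1%E)); exact: probability_setT.
by apply: complex_eq; rewrite /= E.
Qed.

Lemma Cintegral_sum (I : Type) (r : seq I) (F : I -> torus R -> R[i]) :
  (forall i, Cintegrable (F i)) ->
  Cintegral (fun w => \sum_(i <- r) F i w) = \sum_(i <- r) Cintegral (F i) /\
  Cintegrable (fun w => \sum_(i <- r) F i w).
Proof.
move=> IF; have I0 : Cintegrable (fun=> 0) by apply: Cbounded_integrable; exact: Cbounded_cst.
elim: r => [|i r [ih1 ih2]].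
  split; last first.
    by rewrite (_ : (fun _ => _) = fun=> 0)//; apply/funext => w; rewrite big_nil.
  rewrite big_nil -[RHS]Cintegral_cst.
  by apply: eq_Cintegral => w; rewrite big_nil.
split.
  rewrite big_cons -ih1 -CintegralD//.
  by apply: eq_Cintegral => w; rewrite big_cons.
rewrite (_ : (fun _ => _) = fun w => F i w + \sum_(j <- r) F j w).
  exact: CintegrableD.
by apply/funext => w; rewrite big_cons.
Qed.

Lemma ler_cmod_Cintegral f : Cintegrable f ->
  cmod (Cintegral f) <= \int[P]_w cmod (f w).
Proof.
move=> If; set I := Cintegral f.
have [->|I0] := eqVneq I 0.
  by rewrite cmod0 Rintegral_ge0// => w _; exact: cmod_ge0.
(* multiply by the unimodular constant that makes the integral real *)
pose c : R[i] := (cmod I)%:C / I.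
have c1 : cmod c = 1.
  by rewrite /c cmodM cmodV cmod_realC ger0_norm ?cmod_ge0// divff// cmod_eq0.
have : Cintegral (fun w => c * f w) = (cmod I)%:C.
  by rewrite CintegralZ// /c divfK.
move=> /(congr1 (@complex.Re R)) /= <-.
have Icf : Cintegrable (fun w => c * f w).
  rewrite (_ : (fun _ => _) = fun w => f w * c); last first.
    by apply/funext => w; rewrite mulrC.
  by apply: CintegrableM => //; exact: Cbounded_cst.
apply: le_Rintegral => //.
- by case: Icf.
- exact: integrable_cmod.
- move=> w _; apply: le_trans (ler_norm _) _.
  by apply: le_trans (ler_Re_cmod _) _; rewrite cmodM c1 mul1r.
Qed.

Lemma Cintegral_rot j s f : 0 <= s <= 1 -> Cintegrable f ->
  Cintegral (fun w => f (torus_rot j s w)) = Cintegral f.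
Proof.
move=> s01 If; have [m1 m2] := Cintegrable_measurable If.
have K (h : torus R -> R) : measurable_fun setT h -> P.-integrable setT (EFin \o h) ->
    \int[P]_w h (torus_rot j s w) = \int[P]_w h w.
  move=> mh Ih; rewrite /Rintegral; congr fine.
  have mh' : measurable_fun setT (EFin \o h) by exact/measurable_EFinP.
  have PE A : measurable A -> A `<=` setT ->
      pushforward P (torus_rot j s) A = P A.
    by move=> mA _; exact: torus_measure_rot.
  have mr := measurable_torus_rot j s.
  rewrite -[RHS](eq_measure_integral _ PE) integral_pushforward//.
  apply/integrableP; split; first exact: measurableT_comp.
  rewrite -(@ge0_integral_pushforward _ _ _ _ _ _ mr P setT (fun w => `|(h w)%:E|)%E)//.
    by rewrite (eq_measure_integral _ PE); case/integrableP : Ih.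
  exact: measurableT_comp.
case: If => I1 I2.
by apply: complex_eq => /=; [exact: (K (fun w => complex.Re (f w)))|
  exact: (K (fun w => complex.Im (f w)))].
Qed.

End complex_integral.

Notation torus_coords w := (fun j : nat => sval (w j)).

(** * Monomials as an orthonormal system *)

Section monomials.
Context {R : realType}.
Local Notation P := (torus_measure R).

Lemma cmod_circle (c : circle R) : cmod (sval c) = 1.
Proof. by apply: complexI; rewrite cmodC (eqP (svalP c)). Qed.

Lemma unimodular_inv (z : R[i]) : cmod z = 1 -> z^-1 = z^*%C.
Proof. by move=> z1; rewrite invc_norm -cmodC z1 expr1n invr1 mul1r. Qed.

Lemma circle_neq0 (c : circle R) : sval c != 0 :> R[i].
Proof. by rewrite -cmod_eq0 cmod_circle oner_neq0. Qed.

Lemma Cbounded_coord j : Cbounded (fun w : torus R => sval (w j)).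
Proof.
split; last by exists 1 => w; rewrite cmod_circle.
split.
  exact: (measurableT_comp measurable_sval_Re (measurable_coord j)).
exact: (measurableT_comp measurable_sval_Im (measurable_coord j)).
Qed.

Lemma Cbounded_inv (f : torus R -> R[i]) : Cbounded f -> (forall w, cmod (f w) = 1) ->
  Cbounded (fun w => (f w)^-1).
Proof.
move=> bf f1; rewrite (_ : (fun _ => _) = fun w => (f w)^*%C); first exact: Cbounded_conj.
by apply/funext => w; rewrite unimodular_inv.
Qed.

Lemma Cbounded_monomial a : Cbounded (fun w : torus R => monomial (torus_coords w) a).
Proof.
apply: Cbounded_prod => j; case: (a j) => n; first exact: CboundedX (Cbounded_coord j).
apply: Cbounded_inv; first exact: CboundedX (Cbounded_coord j).
by move=> w; rewrite cmodX cmod_circle expr1n.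
Qed.

Lemma cmod_monomial z a : cmod (monomial z a : R[i]) = \prod_(j <- finsupp a) cmod (z j) ^ a j.
Proof. by rewrite cmod_prod; apply: eq_bigr => j _; rewrite cmod_intexp. Qed.

Lemma cmod_monomial_torus (w : torus R) a : cmod (monomial (torus_coords w) a) = 1.
Proof.
by rewrite cmod_monomial big1// => j _; rewrite cmod_circle exp1rz.
Qed.

Lemma monomialE N (a : multi_index) (z : nat -> R[i]) :
  (forall j, a j != 0 -> (j < N)%N) -> monomial z a = \prod_(j < N) z j ^ a j.
Proof.
move=> aN; rewrite /monomial -(big_mkord xpredT (fun j => z j ^ a j)).
rewrite [RHS](bigID (mem (finsupp a))) /= [X in _ * X]big1 ?mulr1; last first.
  by move=> j; rewrite mem_finsupp negbK => /eqP ->; rewrite expr0z.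
rewrite -[RHS]big_filter; apply: perm_big; apply: uniq_perm.
- exact: fset_uniq.
- by rewrite filter_uniq// iota_uniq.
- move=> j; rewrite mem_filter mem_index_iota /=.
  by case: (boolP (j \in finsupp a)) => //; rewrite mem_finsupp => /aN ->.
Qed.

Lemma monomial_rot j s (w : torus R) a :
  monomial (torus_coords (torus_rot j s w)) a =
  sval (expi s) ^ a j * monomial (torus_coords w) a.
Proof.
pose N := (j + \sum_(i <- finsupp a) i).+1.
have aN i : a i != 0 -> (i < N)%N.
  move=> ai; rewrite ltnS /N (big_rem i) /=; last by rewrite mem_finsupp.
  by rewrite addnCA leq_addr.
have jN : (j < N)%N by rewrite ltnS leq_addr.
rewrite !(@monomialE N)// (bigD1 (Ordinal jN)) //= [in RHS](bigD1 (Ordinal jN)) //=.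
rewrite {1}/torus_rot eqxx /= expfzMl mulrA; congr (_ * _).
apply: eq_bigr => i /eqP ij; rewrite /torus_rot; case: eqP => // iE.
by case: ij; exact: val_inj.
Qed.

(** Rotating w_j by this angle changes the sign of w_j ^ n, which makes the integrals in
    [torus_orthogonality] vanish. *)
Lemma expi_half_turn (n : nat) : (0 < n)%N ->
  sval (expi (2 * n%:R)^-1 : circle R) ^+ n = -1.
Proof.
move=> n0.
have E (t : R) k : sval (expi t) ^+ k = sval (expi (k%:R * t)) :> R[i].
  elim: k => [|k ih].
    rewrite mul0r; apply: complex_eq; rewrite /= mulr0 ?cos0 ?sin0//.
  have -> : k.+1%:R * t = t + k%:R * t by rewrite -natr1; ring.
  by rewrite exprS ih -expiD.
rewrite E.
have -> : n%:R * (2 * n%:R)^-1 = 2^-1 :> R.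
  by rewrite invfM mulrCA divff ?mulr1// pnatr_eq0 -lt0n.
apply: complex_eq; rewrite /= mulrAC divff// mul1r ?cospi ?sinpi//.
by rewrite oppr0.
Qed.

(** If a and b differ at j, some rotation of the j-th coordinate changes the sign of the integrand;
    by invariance the integral equals its own opposite. *)
Lemma torus_orthogonality a b :
  Cintegral (fun w : torus R =>
    monomial (torus_coords w) a * (monomial (torus_coords w) b)^-1) = (a == b)%:R.
Proof.
have [->|ab] := eqVneq a b.
  rewrite -[RHS]Cintegral_cst; apply: eq_Cintegral => w.
  by rewrite divff// -cmod_eq0 cmod_monomial_torus oner_neq0.
have [j abj] : exists j, a j != b j.
  apply: contrapT => /forallNP h; case/eqP: ab; apply/fsfunP => j; apply/eqP.
  by apply: contrapT => /negP; exact: h.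
set g := fun w : torus R => _; have bg : Cbounded g.
  apply: CboundedM; first exact: Cbounded_monomial.
  by apply: Cbounded_inv; [exact: Cbounded_monomial|move=> w; exact: cmod_monomial_torus].
(* A turn by 1 / (2 |k|) multiplies the integrand by -1 whatever the sign of k, because -1 is its
   own inverse. *)
pose k := a j - b j; pose s : R := (2 * (absz k)%:R)^-1.
have k0 : (0 < absz k)%N by rewrite absz_gt0 subr_eq0.
have s01 : 0 <= s <= 1.
  rewrite invr_ge0 mulr_ge0//= invf_le1 ?mulr_gt0 ?ltr0n//.
  by rewrite -natrM ler1n muln_gt0.
have gr w : g (torus_rot j s w) = (-1) * g w.
  rewrite /g !monomial_rot invfM mulrACA; congr (_ * _).
  rewrite invr_expz -expfzDr ?circle_neq0// -/k.
  have := expi_half_turn k0; rewrite -/s; move: (sval (expi s)) => u.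
  case: (k) => n /= E; first exact: E.
  by rewrite NegzE -exprnN E invrN invr1.
have I := Cbounded_integrable bg.
have : Cintegral g = -1 * Cintegral g.
  by rewrite -CintegralZ// -(Cintegral_rot j s01 I); apply: eq_Cintegral.
rewrite mulN1r => /eqP; rewrite -subr_eq0 opprK -mulr2n mulrn_eq0 /=.
by move/eqP.
Qed.

Lemma Cbounded_monomialV a :
  Cbounded (fun w : torus R => (monomial (torus_coords w) a)^-1).
Proof.
by apply: Cbounded_inv; [exact: Cbounded_monomial|move=> w; exact: cmod_monomial_torus].
Qed.

Lemma ler_fourier_coeff (f : torus R -> R[i]) a : Cintegrable f ->
  cmod (fourier_coeff f a) <= \int[P]_w cmod (f w).
Proof.
move=> If; apply: le_trans (ler_cmod_Cintegral (CintegrableM If (Cbounded_monomialV a))) _.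
rewrite le_eqVlt; apply/orP; left; apply/eqP; apply: eq_Rintegral => w _.
by rewrite cmodM cmodV cmod_monomial_torus invr1 mulr1.
Qed.

End monomials.

(** * Polynomials on the torus *)

Section torus_polynomials.
Context {R : realType}.
Local Notation P := (torus_measure R).

Definition mnm_index N (a : multinom N) : multi_index :=
  [fsfun j in seq_fset tt (iota 0 N) => (nth 0%N (multinom_val a) j)%:Z | 0].

Lemma mnm_index_ord N (a : multinom N) (i : 'I_N) : mnm_index a i = (a i)%:Z.
Proof.
rewrite /mnm_index fsfun_fun seq_fsetE mem_iota /= add0n ltn_ord.
by rewrite -(tnth_nth 0%N).
Qed.

Lemma mnm_index_ge N (a : multinom N) j : (N <= j)%N -> mnm_index a j = 0.
Proof.
by move=> Nj; rewrite /mnm_index fsfun_fun seq_fsetE mem_iota /= add0n ltnNge Nj.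
Qed.

Lemma mnm_index_inj N : injective (@mnm_index N).
Proof.
move=> a b ab; apply/mnmP => i; apply/eqP; rewrite -(eqr_nat int) !natz.
by rewrite -!mnm_index_ord ab.
Qed.

Lemma mnm_index_supp N (a : multinom N) j : mnm_index a j != 0 -> (j < N)%N.
Proof. by apply: contraNltn => /mnm_index_ge ->. Qed.

Lemma mnm_index_nonneg N (a : multinom N) : nonneg_indices (mnm_index a).
Proof.
move=> j; have [Nj|jN] := leqP N j; first by rewrite mnm_index_ge.
by rewrite (mnm_index_ord a (Ordinal jN)).
Qed.

Lemma monomial_mnm N (a : multinom N) (z : nat -> R[i]) :
  monomial z (mnm_index a) = \prod_(j < N) z j ^+ a j.
Proof.
rewrite (@monomialE _ N); last exact: mnm_index_supp.
by apply: eq_bigr => i _; rewrite mnm_index_ord.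
Qed.

Lemma degreeE N (a : multi_index) : (forall j, a j != 0 -> (j < N)%N) ->
  degree a = \sum_(j < N) a j.
Proof.
move=> aN; rewrite /degree -(big_mkord xpredT (fun j => a j)).
rewrite [RHS](bigID (mem (finsupp a))) /= [X in _ + X]big1 ?addr0; last first.
  by move=> j; rewrite mem_finsupp negbK => /eqP ->.
rewrite -[RHS]big_filter; apply: perm_big; apply: uniq_perm.
- exact: fset_uniq.
- by rewrite filter_uniq// iota_uniq.
- move=> j; rewrite mem_filter mem_index_iota /=.
  by case: (boolP (j \in finsupp a)) => //; rewrite mem_finsupp => /aN ->.
Qed.

Lemma degree_mnm N (a : multinom N) : degree (mnm_index a) = (mdeg a)%:Z.
Proof.
rewrite (@degreeE N); last exact: mnm_index_supp.
rewrite mdegE -natz natr_sum; apply: eq_bigr => i _.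
by rewrite mnm_index_ord natz.
Qed.

Lemma mnm_index_surj N (a : multi_index) : nonneg_indices a ->
  (forall j, a j != 0 -> (j < N)%N) -> exists b : multinom N, mnm_index b = a.
Proof.
move=> a0 aN; exists (Multinom [tuple absz (a i) | i < N]).
apply/fsfunP => j; have [Nj|jN] := leqP N j.
  rewrite mnm_index_ge//; apply/esym/eqP.
  by apply: contraTT Nj => /aN; rewrite ltnNge.
by rewrite (mnm_index_ord _ (Ordinal jN)) multinomE tnth_mktuple /= gez0_abs.
Qed.

Definition torus_eval N (p : mpoly N R[i]) (w : torus R) : R[i] :=
  meval (fun j : 'I_N => sval (w j)) p.

Lemma torus_evalE N (p : mpoly N R[i]) w : torus_eval p w =
  \sum_(a <- msupp p) mcoeff a p * monomial (torus_coords w) (mnm_index a).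
Proof.
rewrite /torus_eval mevalE; apply: eq_bigr => a _.
by rewrite monomial_mnm.
Qed.

Lemma Cbounded_torus_eval N (p : mpoly N R[i]) : Cbounded (torus_eval p).
Proof.
rewrite (_ : torus_eval p = fun w =>
    \sum_(a <- msupp p) mcoeff a p * monomial (torus_coords w) (mnm_index a)).
  apply: (@Cbounded_sum _ _ _ _ (fun a w =>
    mcoeff a p * monomial (torus_coords w) (mnm_index a))) => a.
  by apply: CboundedM; [exact: Cbounded_cst|exact: Cbounded_monomial].
by apply/funext => w; exact: torus_evalE.
Qed.

Lemma fourier_coeff_torus_eval N (p : mpoly N R[i]) b :
  fourier_coeff (torus_eval p) b =
  \sum_(a <- msupp p) mcoeff a p * (mnm_index a == b)%:R.
Proof.
have Ia a := Cbounded_integrable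
  (CboundedM (@Cbounded_monomial R (mnm_index a)) (@Cbounded_monomialV R b)).
rewrite /fourier_coeff.
rewrite (_ : (fun w => _) = fun w => \sum_(a <- msupp p) mcoeff a p *
  (monomial (torus_coords w) (mnm_index a) * (monomial (torus_coords w) b)^-1)); last first.
  apply/funext => w; rewrite torus_evalE mulr_suml.
  by apply: eq_bigr => a _; rewrite mulrA.
rewrite (proj1 (Cintegral_sum _ _)).
  by apply: eq_bigr => a _; rewrite CintegralZ// torus_orthogonality.
move=> a; apply: Cbounded_integrable; apply: CboundedM; first exact: Cbounded_cst.
by apply: CboundedM; [exact: Cbounded_monomial|exact: Cbounded_monomialV].
Qed.

Lemma fourier_coeff_mnm N (p : mpoly N R[i]) a :
  fourier_coeff (torus_eval p) (mnm_index a) = mcoeff a p.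
Proof.
rewrite fourier_coeff_torus_eval.
under eq_bigr do rewrite (inj_eq (@mnm_index_inj N)).
have [ap|ap] := boolP (a \in msupp p).
  rewrite (bigD1_seq a)//= eqxx mulr1 big1 ?addr0// => b /negbTE ->.
  by rewrite mulr0.
rewrite big_seq big1 ?(memN_msupp_eq0 ap)// => b bp.
by case: eqP => [ba|]; rewrite ?mulr0//; rewrite -ba bp in ap.
Qed.

Lemma fourier_coeff_torus_eval0 N (p : mpoly N R[i]) b :
  (forall a, a \in msupp p -> mnm_index a != b) ->
  fourier_coeff (torus_eval p) b = 0.
Proof.
move=> pb; rewrite fourier_coeff_torus_eval big_seq big1// => a /pb /negbTE ->.
by rewrite mulr0.
Qed.

(** By [Parseval], the squared L_2 norm of [torus_eval p], in the algebraic form that the counting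
    arguments need. *)
Definition coeff_sqnorm N (p : mpoly N R[i]) : R :=
  \sum_(a <- msupp p) cmod (mcoeff a p) ^+ 2.

Lemma coeff_sqnorm_ge0 N (p : mpoly N R[i]) : 0 <= coeff_sqnorm p.
Proof. by apply: sumr_ge0 => a _; rewrite exprn_ge0// cmod_ge0. Qed.

Lemma Parseval N (p : mpoly N R[i]) :
  \int[P]_w (cmod (torus_eval p w) ^+ 2) = coeff_sqnorm p.
Proof.
have bp := Cbounded_torus_eval p.
have : Cintegral (fun w => torus_eval p w * (torus_eval p w)^*%C) =
    (coeff_sqnorm p)%:C.
  (* Only the conjugate factor is expanded: each term then integrates to a Fourier coefficient of
     the other factor, and no double sum appears. *)
  rewrite (_ : (fun w => _) = fun w => \sum_(a <- msupp p) (mcoeff a p)^*%C *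
      (torus_eval p w * (monomial (torus_coords w) (mnm_index a))^-1)); last first.
    apply/funext => w; rewrite {2}torus_evalE rmorph_sum mulr_sumr.
    apply: eq_bigr => a _; rewrite rmorphM /= mulrCA; congr (_ * (_ * _)).
    by rewrite unimodular_inv// cmod_monomial_torus.
  have Ia a : Cintegrable (fun w =>
      torus_eval p w * (monomial (torus_coords w) (mnm_index a))^-1).
    by apply: Cbounded_integrable; apply: CboundedM => //; exact: Cbounded_monomialV.
  rewrite (proj1 (Cintegral_sum _ _)).
    rewrite /coeff_sqnorm rmorph_sum /=; apply: eq_bigr => a _.
    rewrite CintegralZ// -[Cintegral _]/(fourier_coeff (torus_eval p) (mnm_index a)).
    by rewrite fourier_coeff_mnm cmod_sqrC mulrC.
  move=> a; apply: Cbounded_integrable; apply: CboundedM; first exact: Cbounded_cst.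
  by apply: CboundedM => //; exact: Cbounded_monomialV.
move=> /(congr1 (@complex.Re R)) /= <-; apply: eq_Rintegral => w _.
by rewrite -cmod_sqrC.
Qed.

Lemma ler_mcoeff_sup N (p : mpoly N R[i]) (M : R) a :
  (forall w, cmod (torus_eval p w) <= M) -> cmod (mcoeff a p) <= M.
Proof.
move=> pM; rewrite -fourier_coeff_mnm.
have Ip := Cbounded_integrable (Cbounded_torus_eval p).
apply: le_trans (ler_fourier_coeff _ Ip) _.
have -> : M = complex.Re (Cintegral (fun=> M%:C)) by rewrite Cintegral_cst.
apply: le_Rintegral => //; first exact: integrable_cmod.
by apply: (@bounded_integrable _ _ `|M|).
Qed.

Lemma torus_evalM N (p q : mpoly N R[i]) w :
  torus_eval (p * q) w = torus_eval p w * torus_eval q w.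
Proof. exact: mevalM. Qed.

Lemma torus_evalX N (p : mpoly N R[i]) n w :
  torus_eval (p ^+ n) w = torus_eval p w ^+ n.
Proof. exact: rmorphXn. Qed.

End torus_polynomials.

(** * Inequalities for finite sums *)

Section finite_sums.
Context {R : realType}.

Lemma cauchy_schwarz_seq (I : Type) (s : seq I) (a b : I -> R) :
  (\sum_(i <- s) a i * b i) ^+ 2 <=
  (\sum_(i <- s) a i ^+ 2) * (\sum_(i <- s) b i ^+ 2).
Proof.
set A := \sum_(i <- s) a i ^+ 2; set B := \sum_(i <- s) b i ^+ 2.
set D := \sum_(i <- s) a i * b i.
have A0 : 0 <= A by apply: sumr_ge0 => i _; exact: sqr_ge0.
(* The sum of the squares (x a_i - y b_i)^2. At x = D, y = A it equals A (A B - D^2). If A = 0 and D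
   != 0, the values x = (B + 1) / (2 D), y = 1 would make it -1. *)
have E (x y : R) : 0 <= x ^+ 2 * A + y ^+ 2 * B - 2 * (x * y) * D.
  rewrite /A /B /D !mulr_sumr -big_split/= -sumrB; apply: sumr_ge0 => i _.
  have -> : x ^+ 2 * a i ^+ 2 + y ^+ 2 * b i ^+ 2 - 2 * (x * y) * (a i * b i) =
    (x * a i - y * b i) ^+ 2 by ring.
  exact: sqr_ge0.
have [A00|An0] := eqVneq A 0.
  have [D0|Dn0] := eqVneq D 0; first by rewrite D0 expr0n/= A00 mul0r.
  have := E ((B + 1) / (2 * D)) 1; rewrite A00 mulr0 add0r expr1n mul1r mulr1.
  have -> : B - 2 * ((B + 1) / (2 * D)) * D = -1 by field.
  by rewrite ler0N1.
have Ap : 0 < A by rewrite lt_def An0.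
have := E D A.
have -> : D ^+ 2 * A + A ^+ 2 * B - 2 * (D * A) * D = A * (A * B - D ^+ 2) by ring.
by rewrite pmulr_rge0// subr_ge0.
Qed.

Lemma ler_sum_uniq_sub (I : eqType) (s t : seq I) (F : I -> R) : uniq s ->
  (forall i, 0 <= F i) -> (forall i, i \in s -> F i != 0 -> i \in t) ->
  \sum_(i <- s) F i <= \sum_(i <- undup t) F i.
Proof.
move=> us F0 st; rewrite (bigID (fun i => i \in t)) /= [X in _ + X]big_seq_cond.
rewrite [X in _ + X]big1 ?addr0; last first.
  move=> i /andP[si]; apply: contraNeq => Fi; exact: st.
rewrite -big_filter; set u := seq.filter _ s.
have -> : \sum_(i <- u) F i = \sum_(i <- undup t | i \in u) F i.
  rewrite -[RHS]big_filter; apply: perm_big; apply: uniq_perm.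
  - exact: filter_uniq.
  - by rewrite filter_uniq// undup_uniq.
  - move=> i; rewrite !mem_filter mem_undup.
    by case: (i \in t); rewrite ?andbT ?andbF.
rewrite [leRHS](bigID (mem u)) /= lerDl.
by apply: sumr_ge0.
Qed.

(** Expanding the product gives one nonnegative term for each function from the variables to [0, K],
    and distinct exponents in s give distinct functions. All counting and generating function bounds
    below rest on it. *)
Lemma ler_sum_mnm N K (s : seq (multinom N)) (F : 'I_N -> nat -> R) : uniq s ->
  (forall i k, 0 <= F i k) -> (forall a, a \in s -> forall i, (a i <= K)%N) ->
  \sum_(a <- s) \prod_(i < N) F i (a i) <= \prod_(i < N) \sum_(k < K.+1) F i k.
Proof.
move=> us F0 sK; rewrite bigA_distr_bigA /=.
pose phi (a : multinom N) : {ffun 'I_N -> 'I_K.+1} := [ffun i => inord (a i)].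
pose G (f : {ffun 'I_N -> 'I_K.+1}) := \prod_(i < N) F i (f i).
have -> : \sum_(a <- s) \prod_(i < N) F i (a i) = \sum_(f <- map phi s) G f.
  rewrite big_map; apply: eq_big_seq => a /sK aK.
  by apply: eq_bigr => i _; rewrite ffunE inordK// ltnS.
have G0 f : 0 <= G f by apply: prodr_ge0.
have um : uniq (map phi s).
  rewrite map_inj_in_uniq// => a b /sK aK /sK bK /ffunP ab; apply/mnmP => i.
  by have := ab i; rewrite !ffunE => /(congr1 val) /=; rewrite !inordK// ltnS.
rewrite (big_uniq _ um) /= [leRHS](bigID (mem (map phi s))) /= lerDl.
by apply: sumr_ge0 => f _; exact: G0.
Qed.

End finite_sums.

(** * Comparison of L_p norms of homogeneous polynomials *)

Section hypercontractivity.
Context {R : realType}.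
Local Notation P := (torus_measure R).

Definition homogeneous N m (p : mpoly N R[i]) :=
  forall a, a \in msupp p -> mdeg a = m.

Lemma homogeneousM N m n (p q : mpoly N R[i]) :
  homogeneous m p -> homogeneous n q -> homogeneous (m + n) (p * q).
Proof.
move=> hp hq a /msuppM_le /allpairsP[[b c] /= [/hp bm /hq cn ->]].
by rewrite mdegD bm cn.
Qed.

Lemma homogeneousX N m n (p : mpoly N R[i]) :
  homogeneous m p -> homogeneous (m * n) (p ^+ n).
Proof.
move=> hp; elim: n => [|n ih].
  by rewrite muln0 expr0 => a; rewrite msupp1 inE => /eqP ->; rewrite mdeg0.
by rewrite exprS mulnS; exact: homogeneousM.
Qed.

Lemma ler_coeff_sqnorm N (p : mpoly N R[i]) (s : seq (multinom N)) : uniq s ->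
  \sum_(a <- s) cmod (mcoeff a p) ^+ 2 <= coeff_sqnorm p.
Proof.
move=> us; rewrite /coeff_sqnorm -[X in _ <= \sum_(a <- X) _](undup_id (msupp_uniq p)).
apply: ler_sum_uniq_sub => // [a|a _]; first by rewrite exprn_ge0// cmod_ge0.
by rewrite expf_eq0 /= cmod_eq0 mcoeff_eq0 negbK.
Qed.

Lemma mcoeffM_msupp N (p q : mpoly N R[i]) (c : multinom N) :
  mcoeff c (p * q) = \sum_(a <- msupp p | mpoly.lem a c) mcoeff a p * mcoeff (mnm_sub c a) q.
Proof.
rewrite {1}(mpolyE p) mulr_suml raddf_sum /= [RHS]big_mkcond.
apply: eq_bigr => a _; rewrite -scalerAl mcoeffZ (mulrC _ q).
case: ifPn => ac; first by rewrite -{1}(submK ac) addmC mcoeffMX.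
rewrite (@memN_msupp_eq0 _ _ (q * _)) ?mulr0//; apply/negP.
rewrite (perm_mem (msuppMX _ _)) => /mapP[b _ E]; case/negP: ac.
by rewrite E; exact: lem_addr.
Qed.

(** By Cauchy-Schwarz, the squared coefficient of p * p at g is at most the number of splittings g =
    a + b with a in the support, times the sum of the |p_a p_b|^2 over them. *)
Lemma coeff_sqnormM N m (p : mpoly N R[i]) : homogeneous m p ->
  coeff_sqnorm (p * p) <= 4 ^+ m * coeff_sqnorm p ^+ 2.
Proof.
move=> hp; pose c a := cmod (mcoeff a p).
have c0 a : 0 <= c a by exact: cmod_ge0.
(* Each 1 is at most a product of binomials 'C(g_i, a_i), and these products sum to 2^|g| over all
   a, where |g| = 2 m. *)
have count (g : multinom N) : g \in msupp (p * p) ->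
    \sum_(a <- msupp p | mpoly.lem a g) (1 : R) <= 4 ^+ m.
  move=> /(homogeneousM hp hp) gm.
  apply: (@le_trans _ _ (\sum_(a <- msupp p | mpoly.lem a g)
      \prod_(i < N) ('C(g i, a i))%:R)).
    apply: ler_sum => a /mnm_lepP ag.
    by rewrite -natr_prod ler1n prodn_gt0// => i; rewrite bin_gt0.
  rewrite -big_filter; apply: le_trans.
    apply: (@ler_sum_mnm R N (m + m)%N _ (fun i k => ('C(g i, k))%:R)).
    - by rewrite filter_uniq// msupp_uniq.
    - by move=> i k; exact: ler0n.
    - move=> a; rewrite mem_filter => /andP[/mnm_lepP ag _] i.
      apply: leq_trans (ag i) _; rewrite -gm mdegE (bigD1 i)//=; exact: leq_addr.
  apply: (@le_trans _ _ (\prod_(i < N) (2 ^ g i)%:R)).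
    apply: ler_prod => i _; rewrite sumr_ge0//= -natr_sum ler_nat.
    have gi : (g i <= m + m)%N by rewrite -gm mdegE (bigD1 i)//=; exact: leq_addr.
    rewrite -(add1n 1) expnDn -(big_mkord xpredT (fun k => 'C(g i, k))).
    rewrite (@big_cat_nat _ _ _ (g i).+1)//= [X in (_ + X <= _)%N]big_nat_cond
      [X in (_ + X <= _)%N]big1.
      rewrite addn0 big_mkord; apply: leq_sum => k _.
      by rewrite !exp1n !muln1.
    by move=> k /andP[/andP[gk _] _]; rewrite bin_small.
  rewrite -natr_prod -expn_sum -mdegE gm addnn -mul2n expnM natrX.
  by rewrite lexx.
apply: (@le_trans _ _ (\sum_(g <- msupp (p * p)) 4 ^+ m *
    \sum_(a <- msupp p | mpoly.lem a g) (c a * c (mnm_sub g a)) ^+ 2)).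
  rewrite /coeff_sqnorm big_seq [leRHS]big_seq; apply: ler_sum => g gp.
  set s := [seq a <- msupp p | mpoly.lem a g].
  have -> : mcoeff g (p * p) = \sum_(a <- s) mcoeff a p * mcoeff (mnm_sub g a) p.
    by rewrite big_filter; exact: mcoeffM_msupp.
  have -> : \sum_(a <- msupp p | mpoly.lem a g) (c a * c (mnm_sub g a)) ^+ 2 =
      \sum_(a <- s) (c a * c (mnm_sub g a)) ^+ 2 by rewrite big_filter.
  apply: (@le_trans _ _ ((\sum_(a <- s) 1 * (c a * c (mnm_sub g a))) ^+ 2)).
    rewrite ler_pXn2r// ?nnegrE ?cmod_ge0 ?sumr_ge0//; last first.
      by move=> a _; rewrite mul1r mulr_ge0.
    apply: le_trans (ler_cmod_sum _ _ _) _; apply: ler_sum => a _.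
    by rewrite cmodM mul1r.
  apply: le_trans (cauchy_schwarz_seq _ _ _) _.
  apply: ler_wpM2r; first by apply: sumr_ge0 => a _; exact: sqr_ge0.
  under eq_bigr do rewrite expr1n.
  by rewrite big_filter; exact: count.
rewrite -mulr_sumr ler_wpM2l ?exprn_ge0//.
under eq_bigr do rewrite big_mkcond.
(* For fixed a the map g -> g - a is injective on the g above a, so each inner sum is at most
   [coeff_sqnorm p]. *)
rewrite exchange_big /= expr2 {2}/coeff_sqnorm mulr_suml.
apply: ler_sum => a _; rewrite -big_mkcond /=.
under eq_bigr do rewrite exprMn.
rewrite -mulr_sumr; apply: ler_wpM2l; first exact: sqr_ge0.
have -> : \sum_(g <- msupp (p * p) | mpoly.lem a g) c (mnm_sub g a) ^+ 2 =
    \sum_(b <- [seq mnm_sub g a | g <- msupp (p * p) & mpoly.lem a g]) c b ^+ 2.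
  by rewrite -[LHS]big_filter [RHS]big_map.
apply: ler_coeff_sqnorm; rewrite map_inj_in_uniq ?filter_uniq ?msupp_uniq//.
move=> g h; rewrite !mem_filter => /andP[ag _] /andP[ah _] E.
by rewrite -(submK ag) E submK.
Qed.

Lemma integrable_cmod_torus_eval N (p : mpoly N R[i]) n :
  P.-integrable setT (fun w => (cmod (torus_eval p w) ^+ n)%:E).
Proof.
have I := integrable_cmod (Cbounded_integrable (CboundedX n (Cbounded_torus_eval p))).
by apply: eq_integrable I => // w _ /=; rewrite cmodX.
Qed.

Lemma Rintegral_cmodX4 N m (p : mpoly N R[i]) : homogeneous m p ->
  \int[P]_w (cmod (torus_eval p w) ^+ 4) <= 4 ^+ m * coeff_sqnorm p ^+ 2.
Proof.
move=> hp; apply: le_trans (coeff_sqnormM hp); rewrite -Parseval.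
rewrite le_eqVlt; apply/orP; left; apply/eqP; apply: eq_Rintegral => w _.
by rewrite torus_evalM cmodM -expr2 -exprM.
Qed.

Lemma coeff_sqnorm_le_L1 N m (p : mpoly N R[i]) : homogeneous m p ->
  coeff_sqnorm p <= 8 * 4 ^+ m * (\int[P]_w cmod (torus_eval p w)) ^+ 2.
Proof.
move=> hp; set E := coeff_sqnorm p; set A := \int[P]_w _.
have E0 : 0 <= E := coeff_sqnorm_ge0 p.
have A0 : 0 <= A by apply: Rintegral_ge0 => w _; exact: cmod_ge0.
have [->|En0] := eqVneq E 0; first by rewrite mulr_ge0 ?sqr_ge0// mulr_ge0 ?exprn_ge0.
have Ep : 0 < E by rewrite lt_def En0.
(* x ^ 2 <= s x + x ^ 4 / s ^ 2, integrated, replaces Hoelder's inequality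
   between the exponents 1, 2 and 4 *)
have key (s : R) : 0 < s -> E <= s * A + 4 ^+ m * E ^+ 2 / s ^+ 2.
  move=> s0; rewrite {1}/E -Parseval.
  have I1 := integrable_cmod_torus_eval p 1; have I2 := integrable_cmod_torus_eval p 2.
  have I4 := integrable_cmod_torus_eval p 4.
  have J1 : P.-integrable setT (EFin \o (fun w => s * cmod (torus_eval p w) ^+ 1)).
    exact: (integrableZl measurableT s I1).
  have J4 : P.-integrable setT
      (EFin \o (fun w => (s ^+ 2)^-1 * cmod (torus_eval p w) ^+ 4)).
    exact: (integrableZl measurableT (s ^+ 2)^-1 I4).
  apply: (@le_trans _ _ (\int[P]_w (s * cmod (torus_eval p w) ^+ 1 +
      (s ^+ 2)^-1 * cmod (torus_eval p w) ^+ 4))).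
    apply: le_Rintegral => //.
      exact: (integrableD measurableT J1 J4).
    move=> w _; set x := cmod _; have x0 : 0 <= x by exact: cmod_ge0.
    rewrite expr1; have [xs|sx] := leP x s.
      apply: (@le_trans _ _ (s * x)); first by rewrite expr2 ler_wpM2r.
      by rewrite lerDl mulr_ge0 ?invr_ge0 ?exprn_ge0// ltW.
    apply: (@le_trans _ _ ((s ^+ 2)^-1 * x ^+ 4)); last by rewrite lerDr mulr_ge0// ltW.
    rewrite mulrC ler_pdivlMr ?exprn_gt0// (exprD x 2 2) ler_wpM2l ?sqr_ge0//.
    by rewrite ler_pXn2r// ?nnegrE// ltW.
  rewrite RintegralD//  !RintegralZl//; apply: lerD.
    by rewrite ler_wpM2l// ltW.
  rewrite [leRHS]mulrC ler_wpM2l ?invr_ge0 ?sqr_ge0//.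
  exact: Rintegral_cmodX4.
(* This s makes the fourth-power term equal to E / 2, which the left-hand side absorbs. What remains
   is E <= 2 s A, and squaring it gives the constant 8. *)
pose s := Num.sqrt (2 * 4 ^+ m * E).
have sE : s ^+ 2 = 2 * 4 ^+ m * E.
  by rewrite sqr_sqrtr// !mulr_ge0// exprn_ge0.
have s0 : 0 < s by rewrite sqrtr_gt0 !mulr_gt0// exprn_gt0.
have M0 : (4 ^+ m : R) != 0 by rewrite expf_neq0.
have := key s s0; rewrite sE.
have -> : 4 ^+ m * E ^+ 2 / (2 * 4 ^+ m * E) = E / 2 by field; rewrite M0 En0.
move=> h; have h1 : E <= 2 * (s * A) by lra.
have : E ^+ 2 <= (2 * (s * A)) ^+ 2.
  by rewrite ler_pXn2r// nnegrE ?mulr_ge0// ltW.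
have -> : (2 * (s * A)) ^+ 2 = 4 * s ^+ 2 * A ^+ 2 by ring.
rewrite sE expr2.
have -> : 4 * (2 * 4 ^+ m * E) * A ^+ 2 = E * (8 * 4 ^+ m * A ^+ 2) by ring.
by rewrite ler_pM2l.
Qed.

(** Repeated squaring with [coeff_sqnormM]. Through [Parseval] this bounds the L_q norm, q = 2^(i +
    1), by the L_2 norm with a constant that does not depend on N, and such q exceed every finite
    p. *)
Lemma coeff_sqnorm_power_le m i : exists2 C : R, 0 <= C &
  forall N (p : mpoly N R[i]), homogeneous m p ->
  coeff_sqnorm (p ^+ (2 ^ i)) <= C * coeff_sqnorm p ^+ (2 ^ i).
Proof.
elim: i => [|i [C C0 ih]]; first by exists 1 => // N p _; rewrite !expr1 mul1r.
exists (4 ^+ (m * 2 ^ i) * C ^+ 2); first by rewrite mulr_ge0 ?exprn_ge0.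
move=> N p hp; have -> : p ^+ (2 ^ i.+1) = p ^+ (2 ^ i) * p ^+ (2 ^ i).
  by rewrite -exprD addnn -mul2n -expnS.
have h := coeff_sqnormM (@homogeneousX _ _ (2 ^ i)%N _ hp).
apply: le_trans h _.
rewrite -mulrA ler_wpM2l ?exprn_ge0// expnS mulnC exprM -exprMn.
rewrite ler_pXn2r// ?nnegrE ?coeff_sqnorm_ge0//; first exact: ih.
by rewrite mulr_ge0 ?exprn_ge0 ?coeff_sqnorm_ge0.
Qed.

End hypercontractivity.

(** For n = (N + 1) k, Bernoulli's inequality gives y^n >= (k d)^(N + 1) with d = y - 1, one power
    of k more than (c n + 1)^N <= (C k)^N. *)
Lemma geometric_beats_polynomial {R : realType} (y c : R) N : 1 < y -> 0 <= c ->
  exists n : nat, (c * n%:R + 1) ^+ N < y ^+ n.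
Proof.
move=> y1 c0; pose d := y - 1; have d0 : 0 < d by rewrite subr_gt0.
have yE : y = 1 + d by rewrite /d; ring.
have bern k : 1 + k%:R * d <= y ^+ k.
  elim: k => [|k ih]; first by rewrite mul0r addr0.
  rewrite exprS; apply: (@le_trans _ _ (y * (1 + k%:R * d))); last first.
    by rewrite ler_pM2l// (lt_trans ltr01).
  rewrite yE -natr1 -subr_ge0.
  have -> : (1 + d) * (1 + k%:R * d) - (1 + (k%:R + 1) * d) = k%:R * d ^+ 2 by ring.
  by rewrite mulr_ge0// sqr_ge0.
pose C := c * N.+1%:R + 1.
have C0 : 0 <= C by rewrite addr_ge0// mulr_ge0.
pose k := (Num.truncn (C ^+ N / d ^+ N.+1)).+1.
have kP : C ^+ N < k%:R * d ^+ N.+1.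
  by rewrite -ltr_pdivrMr ?exprn_gt0// truncnS_gt.
exists (N.+1 * k)%N.
have k1 : 1 <= k%:R :> R by rewrite ler1n.
apply: (@le_lt_trans _ _ ((C * k%:R) ^+ N)).
  have c1 : 0 <= c * (N.+1 * k)%:R + 1 by rewrite addr_ge0// mulr_ge0.
  apply: lerXn2r; rewrite ?nnegrE ?mulr_ge0//.
  by rewrite /C mulrDl mul1r natrM mulrA lerD2l.
apply: (@lt_le_trans _ _ ((k%:R * d) ^+ N.+1)).
  have -> : (k%:R * d) ^+ N.+1 = k%:R * d ^+ N.+1 * k%:R ^+ N.
    by rewrite exprMn [k%:R ^+ N.+1]exprS; ring.
  by rewrite exprMn ltr_pM2r// exprn_gt0// ltr0n.
rewrite mulnC exprM ler_pXn2r// ?nnegrE.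
- by apply: le_trans (bern k); rewrite lerDr.
- by rewrite mulr_ge0// ltW.
- by rewrite exprn_ge0// (le_trans ler01)// ltW.
Qed.

(** * The maximum modulus principle and sums of partial derivatives *)

Section maximum_modulus.
Context {R : realType}.
Local Notation P := (torus_measure R).

Lemma Rintegral_prob_cst (r : R) : \int[P]_w r = r.
Proof.
have := @Cintegral_cst R (r%:C).
by rewrite /Cintegral => /(congr1 (@complex.Re R)).
Qed.

Lemma Rintegral_sum (I : Type) (r : seq I) (h : I -> torus R -> R) :
  (forall i, P.-integrable setT (EFin \o h i)) ->
  P.-integrable setT (EFin \o (fun w => \sum_(i <- r) h i w)) /\
  \int[P]_w (\sum_(i <- r) h i w) = \sum_(i <- r) \int[P]_w h i w.
Proof.
move=> Ih; elim: r => [|i r [ih1 ih2]].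
  rewrite (_ : (fun _ => _) = fun=> 0); last by apply/funext => w; rewrite big_nil.
  split.
    apply: (@bounded_integrable _ _ 0); first exact: measurable_cst.
    by move=> w; rewrite normr0.
  rewrite big_nil /Rintegral integral0_eq//.
rewrite (_ : (fun _ => _) = fun w => h i w + \sum_(j <- r) h j w); last first.
  by apply/funext => w; rewrite big_cons.
split; first exact: (integrableD measurableT (Ih i) ih1).
by rewrite RintegralD// big_cons ih2.
Qed.

Lemma ler_cmod_meval N (p : mpoly N R[i]) (v : 'I_N -> R[i]) :
  cmod (meval v p) <=
  \sum_(a <- msupp p) cmod (mcoeff a p) * \prod_(i < N) cmod (v i) ^+ a i.
Proof.
rewrite mevalE; apply: le_trans (ler_cmod_sum _ _ _) _.
apply: ler_sum => a _; rewrite cmodM cmod_prod ler_wpM2l ?cmod_ge0//.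
by apply: ler_prod => i _; rewrite cmod_ge0 cmodX lexx.
Qed.

Lemma size_msupp_homogeneous N m (p : mpoly N R[i]) : homogeneous m p ->
  (size (msupp p))%:R <= (m%:R + 1) ^+ N :> R.
Proof.
move=> hp.
have := @ler_sum_mnm R N m (msupp p) (fun _ _ => 1) (msupp_uniq p).
have -> : \prod_(i < N) \sum_(k < m.+1) (1 : R) = (m%:R + 1) ^+ N.
  rewrite prodr_const card_ord; congr (_ ^+ _).
  by rewrite sumr_const card_ord natr1.
under eq_bigr do rewrite big1//.
rewrite big_const_seq count_predT iter_addr_0; apply => //.
by move=> a /hp <- i; rewrite mdegE (bigD1 i)//=; exact: leq_addr.
Qed.

(* The coefficients of p ^ n are at most M ^ n, and there are only polynomially
   many of them: taking n-th roots gives the bound. *)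
Lemma maximum_modulus N m (p : mpoly N R[i]) (M : R) (v : 'I_N -> R[i]) :
  homogeneous m p -> (forall w, cmod (torus_eval p w) <= M) ->
  (forall i, cmod (v i) <= 1) -> cmod (meval v p) <= M.
Proof.
move=> hp pM v1.
have M0 : 0 <= M by apply: le_trans (pM point); exact: cmod_ge0.
have bound n : cmod (meval v p) ^+ n <= (m%:R * n%:R + 1) ^+ N * M ^+ n.
  rewrite -cmodX -rmorphXn; apply: le_trans (ler_cmod_meval _ _) _.
  have hpn := @homogeneousX R N m n p hp.
  apply: (@le_trans _ _ (\sum_(a <- msupp (p ^+ n)) M ^+ n)).
    apply: ler_sum => a _; rewrite -[leRHS]mulr1; apply: ler_pM.
    - exact: cmod_ge0.
    - by apply: prodr_ge0 => i _; rewrite exprn_ge0// cmod_ge0.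
    - apply: ler_mcoeff_sup => w; rewrite torus_evalX cmodX.
      by rewrite lerXn2r// nnegrE// cmod_ge0.
    - by apply: prodr_ile1 => i _; rewrite exprn_ge0 ?cmod_ge0//= exprn_ile1// cmod_ge0.
  rewrite big_const_seq count_predT iter_addr_0 -[_ *+ size _]mulr_natl.
  by rewrite ler_wpM2r ?exprn_ge0// -natrM; exact: size_msupp_homogeneous.
rewrite leNgt; apply/negP => Mx.
have [M00|Mn0] := eqVneq M 0.
  by have := bound 1%N; rewrite !expr1 M00 mulr0 leNgt -M00 Mx.
have Mp : 0 < M by rewrite lt_def Mn0.
have y1 : 1 < cmod (meval v p) / M by rewrite ltr_pdivlMr// mul1r.
have [n] := geometric_beats_polynomial N y1 (ler0n R m).
by rewrite expr_div_n ltr_pdivlMr ?exprn_gt0// ltNge bound.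
Qed.

Lemma meval_scale N m (p : mpoly N R[i]) (c : R[i]) (v : 'I_N -> R[i]) :
  homogeneous m p -> meval (fun i => c * v i) p = c ^+ m * meval v p.
Proof.
move=> hp; rewrite !mevalE mulr_sumr; apply: eq_big_seq => a /hp am.
under eq_bigr do rewrite exprMn.
by rewrite big_split/= -expr_sum -mdegE am mulrCA.
Qed.

(** The restriction of p to the complex line v + z t. Its linear coefficient is a directional
    derivative of p, and as a coefficient it is bounded by the supremum over the circle. *)
Definition line_subst N (v z : 'I_N -> R[i]) (p : mpoly N R[i]) : mpoly 1 R[i] :=
  mmap (@mpolyC 1 R[i]) (fun k => mpolyC 1 (v k) + z k *: mpolyX R[i] (mnm1 ord0)) p.

Lemma torus_eval_line N (v z : 'I_N -> R[i]) (p : mpoly N R[i]) w :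
  torus_eval (line_subst v z p) w = meval (fun k => v k + z k * sval (w 0%N)) p.
Proof.
rewrite /torus_eval /line_subst /mmap raddf_sum /= mevalE.
apply: eq_bigr => a _; rewrite mevalM mevalC; congr (_ * _).
rewrite /mmap1 rmorph_prod /=; apply: eq_bigr => k _.
by rewrite rmorphXn/= mevalD mevalC mevalZ mevalXU.
Qed.

Lemma mcoeff1M (f g : mpoly 1 R[i]) : mcoeff (mnm1 ord0) (f * g) =
  mcoeff (mnm1 ord0) f * mcoeff (@mnm0 1) g + mcoeff (@mnm0 1) f * mcoeff (mnm1 ord0) g.
Proof.
have E (h : mpoly 1 R[i]) : mcoeff (mnm1 ord0) h = mcoeff (@mnm0 1) (mderiv ord0 h).
  by rewrite mcoeff_deriv mnm0E mulr1n add0m.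
by rewrite !E mderivM mcoeffD !rmorphM.
Qed.

Lemma mcoeff0_line N (v z : 'I_N -> R[i]) (p : mpoly N R[i]) :
  mcoeff (@mnm0 1) (line_subst v z p) = meval v p.
Proof.
rewrite /line_subst /mmap raddf_sum /= mevalE; apply: eq_bigr => a _.
rewrite rmorphM /= mpolyCK; congr (_ * _); rewrite /mmap1 rmorph_prod /=.
apply: eq_bigr => i _; rewrite rmorphXn/=; congr (_ ^+ _).
by rewrite mcoeffD mcoeffC eqxx mulr1 mcoeffZ mcoeffX mnm1_eq0 mulr0 addr0.
Qed.

Lemma mcoeff1_line N (v z : 'I_N -> R[i]) (p : mpoly N R[i]) :
  mcoeff (mnm1 ord0) (line_subst v z p) = \sum_(k < N) z k * meval v (mderiv k p).
Proof.
(* Both sides are additive and obey the product rule at v, so the identity has to be checked only on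
   constants and variables. *)
pose Q q := mcoeff (mnm1 ord0) (line_subst v z q) =
  \sum_(k < N) z k * meval v (mderiv k q).
have lM (q r : mpoly N R[i]) :
    line_subst v z (q * r) = line_subst v z q * line_subst v z r.
  by rewrite /line_subst rmorphM.
have lD (q r : mpoly N R[i]) :
    line_subst v z (q + r) = line_subst v z q + line_subst v z r.
  by rewrite /line_subst raddfD.
have QM q r : Q q -> Q r -> Q (q * r).
  move=> hq hr; rewrite /Q lM.
  apply: (etrans (mcoeff1M (line_subst v z q) (line_subst v z r))).
  pose f (x y s t : R[i]) := x * s + t * y.
  apply: (etrans (f_equal2 (fun x y => f x y _ _) hq hr)).
  apply: (etrans (f_equal2 (f _ _) (mcoeff0_line v z r) (mcoeff0_line v z q))).
  rewrite /f mulr_suml mulr_sumr -big_split/=.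
  apply: eq_bigr => k _; rewrite mderivM mevalD !mevalM.
  move: (meval v q) (meval v r) (meval v (mderiv k q)) (meval v (mderiv k r)).
  move=> x y dx dy; ring.
have QD q r : Q q -> Q r -> Q (q + r).
  move=> hq hr; rewrite /Q lD.
  apply: (etrans (mcoeffD _ (line_subst v z q) (line_subst v z r))).
  apply: (etrans (f_equal2 (fun x y : R[i] => x + y) hq hr)).
  rewrite -big_split/=.
  by apply: eq_bigr => k _; rewrite mderivD mevalD mulrDr.
have QC c : Q (mpolyC N c).
  rewrite /Q /line_subst mmapC mcoeffC mnm1_eq0 mulr0 big1// => k _.
  by rewrite mderivC meval0 mulr0.
have QU i : Q (mpolyX _ (mnm1 i)).
  rewrite /Q /line_subst mmapX mmap1U mcoeffD mcoeffC mnm1_eq0 mulr0 add0r.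
  rewrite mcoeffZ mcoeffX eqxx mulr1 (bigD1 i)//= big1 ?addr0 => [|k ki].
    have sub0 : mnm_sub (mnm1 i) (mnm1 i) = @mnm0 N.
      by apply/mnmP => j; rewrite mnmBE mnm0E subnn.
    by rewrite mderivX mnm1E eqxx sub0 mpolyX0 scale1r meval1 mulr1.
  by rewrite mderivX mnm1E eq_sym (negbTE ki) scale0r meval0 mulr0.
have QX a : Q (mpolyX _ a).
  rewrite mpolyXE_id; elim/big_ind : _ => //; first exact: (QC 1).
  move=> i _; elim: (a i) => [|n ih]; first exact: (QC 1).
  by rewrite exprS; exact: QM.
rewrite -/(Q p) (mpolyE p); elim/big_ind : _ => //.
  by rewrite -(mpolyC0 N); exact: QC.
by move=> a _; rewrite -mul_mpolyC; exact: QM.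
Qed.

(** Unimodular z_k that rotate each derivative at w to its modulus turn the sum into the linear
    coefficient of p (w + z t). As |w_k + z_k t| <= 2, homogeneity and the maximum principle bound
    this polynomial by 2^m M. *)
Lemma sum_mderiv_le N m (p : mpoly N R[i]) (M : R) w :
  homogeneous m p -> (forall w, cmod (torus_eval p w) <= M) ->
  \sum_(k < N) cmod (torus_eval (mderiv k p) w) <= 2 ^+ m * M.
Proof.
move=> hp pM; pose v (k : 'I_N) : R[i] := sval (w k).
pose D k := meval v (mderiv k p).
pose z k : R[i] := if D k == 0 then 1 else (cmod (D k))%:C / D k.
have z1 k : cmod (z k) = 1.
  rewrite /z; case: eqP => [_|/eqP Dk]; first exact: cmod1.
  by rewrite cmodM cmodV cmod_realC ger0_norm ?cmod_ge0// divff// cmod_eq0.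
have zD k : z k * D k = (cmod (D k))%:C.
  rewrite /z; case: eqP => [->|/eqP Dk]; first by rewrite cmod0 mulr0.
  by rewrite divfK.
have E : mcoeff (mnm1 ord0) (line_subst v z p) = (\sum_(k < N) cmod (D k))%:C.
  rewrite mcoeff1_line rmorph_sum /=; apply: eq_bigr => k _; exact: zD.
have -> : \sum_(k < N) cmod (torus_eval (mderiv k p) w) =
    cmod (mcoeff (mnm1 ord0) (line_subst v z p)).
  rewrite E cmod_realC ger0_norm// sumr_ge0// => k _; exact: cmod_ge0.
apply: ler_mcoeff_sup => u; rewrite torus_eval_line.
have -> : meval (fun k => v k + z k * sval (u 0%N)) p =
    2 ^+ m * meval (fun k => 2^-1 * (v k + z k * sval (u 0%N))) p.
  by rewrite (meval_scale _ _ hp) mulrA -exprMn divff ?pnatr_eq0// expr1n mul1r.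
rewrite cmodM cmodX (cmod_natr 2) ler_wpM2l ?exprn_ge0//.
apply: (maximum_modulus hp pM) => k.
rewrite cmodM cmodV (cmod_natr 2) mulrC ler_pdivrMr// mul1r.
apply: le_trans (ler_cmodD _ _) _.
by rewrite cmodM z1 /v !cmod_circle mul1r.
Qed.

Lemma homogeneous_mderiv N m (p : mpoly N R[i]) k :
  homogeneous m p -> homogeneous m.-1 (mderiv k p).
Proof.
move=> hp a; rewrite mcoeff_msupp mcoeff_deriv mulrn_eq0 negb_or => /andP[_].
by rewrite -mcoeff_msupp => /hp <-; rewrite mdegD mdeg1 addn1.
Qed.

Lemma sum_coeff_sqnorm_mderiv N m (p : mpoly N R[i]) (M : R) :
  homogeneous m p -> (forall w, cmod (torus_eval p w) <= M) ->
  \sum_(k < N) Num.sqrt (coeff_sqnorm (mderiv k p)) <= 3 * 4 ^+ m * M.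
Proof.
move=> hp pM.
have M0 : 0 <= M by apply: le_trans (pM point); exact: cmod_ge0.
have I1 k := integrable_cmod (Cbounded_integrable (Cbounded_torus_eval (mderiv k p))).
(* The square root of [coeff_sqnorm_le_L1] in degree m - 1; the 3 comes from 8 <= 3^2. *)
have step k : Num.sqrt (coeff_sqnorm (mderiv k p)) <=
    3 * 2 ^+ m * \int[P]_w cmod (torus_eval (mderiv k p) w).
  set A := \int[P]_w _.
  have A0 : 0 <= A by apply: Rintegral_ge0 => w _; exact: cmod_ge0.
  rewrite -(@ger0_norm _ (3 * 2 ^+ m * A)) ?mulr_ge0 ?exprn_ge0//.
  rewrite -sqrtr_sqr ler_wsqrtr//.
  apply: le_trans (coeff_sqnorm_le_L1 (homogeneous_mderiv (k := k) hp)) _.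
  rewrite !exprMn -/A ler_wpM2r ?sqr_ge0// exprAC.
  apply: ler_pM => //; rewrite ?exprn_ge0//.
    by rewrite -natrX ler_nat.
  by rewrite -!natrX ler_nat leq_pexp2l// leq_pred.
apply: le_trans (ler_sum _ (fun k _ => step k)) _.
rewrite -mulr_sumr.
have -> : 3 * 4 ^+ m * M = 3 * 2 ^+ m * (2 ^+ m * M).
  have -> : (4 : R) ^+ m = 2 ^+ m * 2 ^+ m by rewrite -exprMn -natrM.
  ring.
rewrite ler_wpM2l ?mulr_ge0 ?exprn_ge0//.
have [IS <-] := Rintegral_sum (index_enum 'I_N) I1.
rewrite -[leRHS]Rintegral_prob_cst.
apply: le_Rintegral => //.
  by apply: (@bounded_integrable _ _ `|2 ^+ m * M|).
by move=> w _; exact: sum_mderiv_le.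
Qed.

End maximum_modulus.

(** * Polynomials with prescribed coefficients *)

Section sums_of_monomials.
Context {R : realType}.
Variables (N : nat) (I : finType) (g : I -> multinom N) (c : I -> R[i]).
Hypothesis g_inj : injective g.
Local Notation q := (\sum_(i : I) c i *: mpolyX R[i] (g i)).

Lemma mcoeff_sumX i : mcoeff (g i) q = c i.
Proof.
rewrite raddf_sum /= (bigD1 i)//= mcoeffZ mcoeffX eqxx mulr1 big1 ?addr0// => j ji.
by rewrite mcoeffZ mcoeffX (inj_eq g_inj) (negbTE ji) mulr0.
Qed.

Lemma msupp_sumX_sub a : a \in msupp q -> exists i, a = g i.
Proof.
rewrite mcoeff_msupp => qa; apply: contrapT => h; case/eqP: qa.
rewrite raddf_sum /= big1// => i _; rewrite mcoeffZ mcoeffX.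
by case: eqP => [E|_]; [case: h; exists i|rewrite mulr0].
Qed.

Lemma coeff_sqnorm_sumX : coeff_sqnorm q = \sum_(i : I) cmod (c i) ^+ 2.
Proof.
pose s := [seq g i | i <- index_enum I].
have us : uniq s by rewrite map_inj_uniq// index_enum_uniq.
transitivity (\sum_(a <- s) cmod (mcoeff a q) ^+ 2); last first.
  by rewrite big_map; apply: eq_bigr => i _; rewrite mcoeff_sumX.
apply/eqP; rewrite eq_le ler_coeff_sqnorm// andbT.
rewrite -[X in _ <= \sum_(a <- X) _](undup_id us).
apply: ler_sum_uniq_sub => [|a|a /msupp_sumX_sub[i ->] _].
- exact: msupp_uniq.
- by rewrite exprn_ge0// cmod_ge0.
- by apply: map_f; rewrite mem_index_enum.
Qed.

Lemma torus_eval_sumX w : torus_eval q w =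
  \sum_(i : I) c i * monomial (torus_coords w) (mnm_index (g i)).
Proof.
rewrite /torus_eval raddf_sum /=; apply: eq_bigr => i _.
by rewrite mevalZ mevalX monomial_mnm.
Qed.

End sums_of_monomials.

(** * Fejer kernels in N variables *)

Section fejer_kernel.
Context {R : realType}.
Variables (N L : nat).
Hypothesis L0 : (0 < L)%N.
Local Notation P := (torus_measure R).
Local Notation box := {ffun 'I_N -> 'I_L}.

Definition box_mnm (b : box) : multinom N := Multinom [tuple (b i : nat) | i < N].

Lemma box_mnmE b i : box_mnm b i = b i.
Proof. exact: mnmE. Qed.

Lemma box_mnm_inj : injective box_mnm.
Proof.
move=> b b' /mnmP bb; apply/ffunP => i; apply: val_inj.
by have := bb i; rewrite !box_mnmE.
Qed.

Definition box_char (b : box) (w : torus R) : R[i] :=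
  monomial (torus_coords w) (mnm_index (box_mnm b)).

(** The product over the N variables of the Fejer kernels of order L, at w / u. As a squared modulus
    it is visibly nonnegative, and [Parseval] gives its mean 1. *)
Definition fejer_kernel (w u : torus R) : R :=
  cmod (\sum_(b : box) box_char b w * (box_char b u)^-1) ^+ 2 / (#|{: box}|)%:R.

Lemma card_box_gt0 : (0 : R) < (#|{: box}|)%:R.
Proof. by rewrite ltr0n card_ffun card_ord expn_gt0 L0. Qed.

Lemma fejer_kernel_ge0 w u : 0 <= fejer_kernel w u.
Proof. by rewrite mulr_ge0 ?sqr_ge0// invr_ge0 ltW// card_box_gt0. Qed.

Lemma fejer_kernelC w u : fejer_kernel w u = fejer_kernel u w.
Proof.
rewrite /fejer_kernel -cmod_conj rmorph_sum; congr (cmod _ ^+ 2 / _).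
apply: eq_bigr => b _; rewrite rmorphM /= -!unimodular_inv ?invrK 1?mulrC//.
  by rewrite cmodV cmod_monomial_torus invr1.
exact: cmod_monomial_torus.
Qed.

Lemma fejer_kernel_poly u w : \sum_(b : box) box_char b w * (box_char b u)^-1 =
  torus_eval (\sum_(b : box) (box_char b u)^-1 *: mpolyX R[i] (box_mnm b)) w.
Proof. by rewrite torus_eval_sumX; apply: eq_bigr => b _; rewrite mulrC. Qed.

Lemma integrable_fejer_kernel u :
  P.-integrable setT (EFin \o (fun w => fejer_kernel w u)).
Proof.
have I2 := integrable_cmod_torus_eval
  (\sum_(b : box) (box_char b u)^-1 *: mpolyX R[i] (box_mnm b)) 2.
have := integrableZr measurableT (#|{: box}|%:R)^-1 I2.
apply: eq_integrable => // w _ /=; rewrite -EFinM /fejer_kernel.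
by rewrite -fejer_kernel_poly.
Qed.

Lemma Rintegral_fejer_kernel u : \int[P]_w fejer_kernel w u = 1.
Proof.
set p := \sum_(b : box) (box_char b u)^-1 *: mpolyX R[i] (box_mnm b).
have I2 := integrable_cmod_torus_eval p 2.
have -> : \int[P]_w fejer_kernel w u =
    \int[P]_w (cmod (torus_eval p w) ^+ 2 * (#|{: box}|%:R)^-1).
  by apply: eq_Rintegral => w _; rewrite /fejer_kernel fejer_kernel_poly.
rewrite RintegralZr// Parseval coeff_sqnorm_sumX; last exact: box_mnm_inj.
rewrite (eq_bigr (fun=> 1)); last first.
  by move=> b _; rewrite cmodV cmod_monomial_torus invr1 expr1n.
by rewrite sumr_const divff// gt_eqF// card_box_gt0.
Qed.

(** The exponent of w^a w^-b, whose entries may be negative, in contrast to the truncated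
    [mnm_sub]. *)
Definition diff_index (a b : multinom N) : multi_index :=
  [fsfun j in seq_fset tt (iota 0 N) =>
    (nth 0%N (multinom_val a) j)%:Z - (nth 0%N (multinom_val b) j)%:Z | 0].

Lemma diff_index_ord a b (i : 'I_N) : diff_index a b i = (a i)%:Z - (b i)%:Z.
Proof.
rewrite /diff_index fsfun_fun seq_fsetE mem_iota /= add0n ltn_ord.
by rewrite -!(tnth_nth 0%N).
Qed.

Lemma diff_index_ge a b j : (N <= j)%N -> diff_index a b j = 0.
Proof.
by move=> Nj; rewrite /diff_index fsfun_fun seq_fsetE mem_iota /= add0n ltnNge Nj.
Qed.

Lemma monomial_diff (a b : multinom N) (w : torus R) :
  monomial (torus_coords w) (diff_index a b) =
  monomial (torus_coords w) (mnm_index a) * (monomial (torus_coords w) (mnm_index b))^-1.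
Proof.
rewrite (@monomialE R N); last first.
  by move=> j; apply: contraNltn => /diff_index_ge ->.
rewrite !monomial_mnm -prodfV -big_split /=; apply: eq_bigr => i _.
by rewrite diff_index_ord expfzDr ?circle_neq0// -exprnN.
Qed.

Lemma diff_index_mnm (a b : multinom N) : nonneg_indices (diff_index a b) ->
  mpoly.lem b a /\ diff_index a b = mnm_index (mnm_sub a b).
Proof.
move=> ab; have ba : mpoly.lem b a.
  apply/mnm_lepP => i; have := ab i; rewrite diff_index_ord subr_ge0.
  by rewrite lez_nat.
split=> //; apply/fsfunP => j; have [Nj|jN] := leqP N j.
  by rewrite diff_index_ge// mnm_index_ge.
rewrite (diff_index_ord a b (Ordinal jN)) (mnm_index_ord _ (Ordinal jN)) mnmBE.
by rewrite subzn//; exact: (mnm_lepP ba).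
Qed.

(** Expanding the squared modulus over pairs of box points turns the convolution into a
    trigonometric polynomial whose frequencies are the differences of these pairs. *)
Lemma fejer_convolution_expand (f : torus R -> R[i]) w : Cintegrable f ->
  Cintegral (fun u => f u * (fejer_kernel w u)%:C) =
  \sum_(x : box * box) (#|{: box}|%:R)^-1 *
    (box_char x.1 w * (box_char x.2 w)^-1) *
    fourier_coeff f (diff_index (box_mnm x.1) (box_mnm x.2)).
Proof.
move=> If; set k : R[i] := (#|{: box}|%:R)^-1.
have -> : (fun u => f u * (fejer_kernel w u)%:C) = fun u =>
    \sum_(x : box * box) k * (box_char x.1 w * (box_char x.2 w)^-1) *
      (f u * (monomial (torus_coords u) (diff_index (box_mnm x.1) (box_mnm x.2)))^-1).
  apply/funext => u; rewrite /fejer_kernel rmorphM fmorphV rmorph_nat /= cmod_sqrC.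
  rewrite rmorph_sum mulr_suml.
  rewrite -(pair_bigA _ (fun b b' => k * (box_char b w * (box_char b' w)^-1) *
      (f u * (monomial (torus_coords u) (diff_index (box_mnm b) (box_mnm b')))^-1))) /=.
  rewrite mulr_suml mulr_sumr; apply: eq_bigr => b _.
  rewrite mulr_sumr mulr_suml mulr_sumr; apply: eq_bigr => b' _.
  rewrite monomial_diff -!/(box_char _ _) rmorphM /=.
  rewrite -!unimodular_inv ?cmodV ?cmod_monomial_torus ?invr1// invrK invfM invrK -/k.
  by move: (box_char b w) (box_char b u)^-1 (box_char b' w)^-1 (box_char b' u) => *; ring.
rewrite (proj1 (Cintegral_sum _ _)).
  apply: eq_bigr => x _; rewrite CintegralZ//.
  by apply: CintegrableM => //; exact: Cbounded_monomialV.
move=> x; have J := CintegrableM If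
  (@Cbounded_monomialV R (diff_index (box_mnm x.1) (box_mnm x.2))).
rewrite (_ : (fun _ => _) = fun u => (f u * (monomial (torus_coords u)
    (diff_index (box_mnm x.1) (box_mnm x.2)))^-1) *
    (k * (box_char x.1 w * (box_char x.2 w)^-1))).
  by apply: CintegrableM => //; exact: Cbounded_cst.
by apply/funext => u; rewrite mulrC.
Qed.

End fejer_kernel.

(** * The Fejer polynomial of a homogeneous Hardy function *)

Section fejer_polynomial.
Context {R : realType}.
Variables (N m : nat) (f : torus R -> R[i]).
Hypothesis If : Cintegrable f.
Hypothesis f_nonneg : forall a, ~ nonneg_indices a -> fourier_coeff f a = 0.
Hypothesis f_hom : forall a, fourier_coeff f a != 0 -> degree a = m%:Z.
Local Notation L := m.*2.+1.
Local Notation box := {ffun 'I_N -> 'I_L}.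
Local Notation cardb := (#|{: box}|%:R : R[i]).

Definition fejer_pair (x : box * box) :=
  mpoly.lem (box_mnm x.2) (box_mnm x.1) &&
  (mdeg (mnm_sub (box_mnm x.1) (box_mnm x.2)) == m).

Definition fejer_poly : mpoly N R[i] := \sum_(x : box * box | fejer_pair x)
  (cardb^-1 * fourier_coeff f (mnm_index (mnm_sub (box_mnm x.1) (box_mnm x.2)))) *:
  mpolyX R[i] (mnm_sub (box_mnm x.1) (box_mnm x.2)).

(** The pairs left out of [fejer_poly] have a difference with a negative entry or of degree other
    than m, and there the coefficient of f vanishes. *)
Lemma torus_eval_fejer_poly w : torus_eval fejer_poly w =
  Cintegral (fun u => f u * (@fejer_kernel R N L w u)%:C).
Proof.
rewrite (fejer_convolution_expand N L w If) /torus_eval raddf_sum /=.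
rewrite [LHS]big_mkcond; apply: eq_bigr => -[b b'] _ /=.
have C : box_char b w * (box_char b' w)^-1 =
  monomial (torus_coords w) (diff_index (box_mnm b) (box_mnm b')).
  by rewrite monomial_diff.
rewrite C; case: ifPn => [/andP[/= lb mb]|nb].
  have nn : nonneg_indices (diff_index (box_mnm b) (box_mnm b')).
    move=> j; have [Nj|jN] := leqP N j; first by rewrite diff_index_ge.
    rewrite (diff_index_ord _ _ (Ordinal jN)) subr_ge0 lez_nat.
    exact: (mnm_lepP lb).
  have [_ ->] := diff_index_mnm nn.
  by rewrite mevalZ mevalX monomial_mnm mulrAC.
have [->|fn0] := eqVneq (fourier_coeff f (diff_index (box_mnm b) (box_mnm b'))) 0.
  by rewrite mulr0.
have [nn|/f_nonneg /eqP] := pselect (nonneg_indices (diff_index (box_mnm b) (box_mnm b')));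
  last by rewrite (negbTE fn0).
have [lb E] := diff_index_mnm nn.
have := f_hom fn0; rewrite E degree_mnm => -[/eqP mb].
by rewrite /fejer_pair /= lb mb in nb.
Qed.

Lemma homogeneous_fejer_poly : homogeneous m fejer_poly.
Proof.
move=> a; rewrite mcoeff_msupp => qa; apply/eqP; apply: contraNT qa => am.
rewrite raddf_sum /= big1// => x /andP[_ xm]; rewrite mcoeffZ mcoeffX.
by case: eqP => [E|_]; [rewrite -E xm in am|rewrite mulr0].
Qed.

(** The coefficient of f at c is multiplied by #|A| / L^N, where A is the set of pairs of box points
    with difference c. This ratio is at least prod (1 - c_i / L) >= 1 - m / L >= 1/2, which is why L
    = 2 m + 1. *)
Lemma mcoeff_fejer_poly_ge (c : multinom N) : mdeg c = m ->
  cmod (fourier_coeff f (mnm_index c)) <= 2 * cmod (mcoeff c fejer_poly).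
Proof.
move=> cm.
pose A := [set x : box * box | fejer_pair x &&
  (mnm_sub (box_mnm x.1) (box_mnm x.2) == c)]%SET.
have -> : mcoeff c fejer_poly = cardb^-1 * fourier_coeff f (mnm_index c) * #|A|%:R.
  have -> : #|A|%:R = \sum_(x in A) 1 :> R[i] by rewrite -sum1_card natr_sum.
  rewrite raddf_sum /= mulr_sumr.
  rewrite [LHS]big_mkcond [RHS]big_mkcond /=; apply: eq_bigr => x _.
  rewrite inE; case: (fejer_pair x) => //=; rewrite mcoeffZ mcoeffX.
  by case: eqP => [->|_]; rewrite ?mulr1 ?mulr0.
rewrite !cmodM cmodV !cmod_natr.
suff H : #|{: box}|%:R <= 2 * #|A|%:R :> R.
  have c0 : (0 : R) < #|{: box}|%:R by exact: card_box_gt0.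
  rewrite -[leLHS]mul1r.
  have -> : 2 * (#|{: box}|%:R^-1 * cmod (fourier_coeff f (mnm_index c)) * #|A|%:R) =
    (2 * #|A|%:R / #|{: box}|%:R) * cmod (fourier_coeff f (mnm_index c)) by ring.
  by rewrite ler_wpM2r ?cmod_ge0// ler_pdivlMr// mul1r.
(* b with b + c outside the box has some b_j among the top c_j values *)
pose B := [set b : box | [forall i, (b i + c i < L)%N]]%SET.
have AB : (#|B| <= #|A|)%N.
  pose up (b : box) : box := [ffun i => inord (b i + c i)].
  rewrite -(@card_in_imset _ _ (fun b => (up b, b)) B); last by move=> b b' _ _ [].
  apply: subset_leq_card; apply/fintype.subsetP => _ /finset.imsetP[b bB ->].
  have upE i : up b i = (b i + c i)%N :> nat.
    by rewrite ffunE inordK//; move: bB; rewrite inE => /forallP.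
  have E : mnm_sub (box_mnm (up b)) (box_mnm b) = c.
    by apply/mnmP => i; rewrite mnmBE !box_mnmE upE addKn.
  rewrite inE /fejer_pair /= E cm !eqxx !andbT.
  by apply/mnm_lepP => i; rewrite !box_mnmE upE leq_addr.
have BE : #|B|%:R = \prod_(i < N) (L - c i)%:R :> R.
  rewrite -sum1_card natr_sum big_mkcond /=.
  transitivity (\prod_(i < N) \sum_(k < L) (k + c i < L)%:R : R); last first.
    apply: eq_bigr => i _; rewrite -natr_sum; congr (_%:R).
    rewrite -big_mkcond /=.
    rewrite (eq_bigl (fun k : 'I_L => (k < L - c i)%N)) => [|k]; last by rewrite ltn_subRL addnC.
    by rewrite -(big_ord_widen L (fun=> 1%N)) ?leq_subr// sum_nat_const card_ord muln1.
  rewrite bigA_distr_bigA /=; apply: eq_bigr => b _; rewrite inE.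
  case: forallP => h; first by rewrite big1// => i _; rewrite h.
  have /existsP[i bi] : [exists i, ~~ (b i + c i < L)%N].
    by rewrite -negb_forall; apply/negP => /forallP.
  by rewrite (bigD1 i)//= (negbTE bi) mul0r.
have cL i : (c i <= L)%N.
  apply: (@leq_trans m); first by rewrite -cm mdegE (bigD1 i)//=; exact: leq_addr.
  by rewrite -addnn -addnS leq_addr.
pose x i : R := (c i)%:R / L%:R.
have x01 i : 0 <= x i <= 1.
  apply/andP; split; first by rewrite divr_ge0.
  by rewrite ler_pdivrMr ?ltr0n// mul1r ler_nat.
(* Weierstrass' product inequality; the induction has to carry 0 <= product <= 1 along. *)
have union : 1 - \sum_(i < N) x i <= \prod_(i < N) (1 - x i).
  suff [] : [/\ 1 - \sum_(i < N) x i <= \prod_(i < N) (1 - x i),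
    0 <= \prod_(i < N) (1 - x i) & \prod_(i < N) (1 - x i) <= 1] by [].
  elim/big_ind2 : _ => [|s p t q [h1 h2 h3] [h4 h5 h6]|i _].
  - by rewrite subr0 lexx ler01.
  - split; last 2 first.
    + exact: mulr_ge0.
    + exact: mulr_ile1.
    nra.
  - by have /andP[? ?] := x01 i; split; lra.
have LE : \prod_(i < N) (1 - x i) = #|B|%:R / #|{: box}|%:R :> R.
  rewrite BE card_ffun !card_ord natrX -[X in _ / _ ^+ X](card_ord N).
  rewrite -prodr_const -prodf_div; apply: eq_bigr => i _.
  by rewrite /x natrB// mulrBl divff// pnatr_eq0.
have half : 2^-1 <= 1 - \sum_(i < N) x i.
  have -> : \sum_(i < N) x i = m%:R / L%:R by rewrite /x -mulr_suml -natr_sum -mdegE cm.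
  have y2 : (m%:R / L%:R : R) <= 2^-1.
    rewrite ler_pdivrMr ?ltr0n// mulrC ler_pdivlMr// -natrM ler_nat muln2.
    exact: leqnSn.
  by move: (m%:R / L%:R : R) y2 => y y2; lra.
have c0 : (0 : R) < #|{: box}|%:R by exact: card_box_gt0.
have : 2^-1 <= #|B|%:R / #|{: box}|%:R :> R by rewrite -LE (le_trans half).
rewrite ler_pdivlMr// mulrC ler_pdivrMr// mulrC => h; apply: le_trans h _.
by rewrite ler_pM2l// ler_nat.
Qed.

End fejer_polynomial.

(** * Fejer convolution does not increase norms *)

Section fejer_bounds.
Context {R : realType}.
Local Notation P := (torus_measure R).

Lemma EFin_Rintegral (h : torus R -> R) : P.-integrable setT (EFin \o h) ->
  (\int[P]_w h w)%:E = (\int[P]_w (h w)%:E)%E.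
Proof. by move=> Ih; rewrite /Rintegral fineK//; exact: integrable_fin_num. Qed.

(** Joint measurability is what Tonelli's theorem asks for; real and imaginary parts are expanded
    into products of a function of w and a function of u. *)
Lemma measurable_fejer_kernel N L :
  measurable_fun [set: torus R * torus R]
    (fun x : torus R * torus R => @fejer_kernel R N L x.1 x.2).
Proof.
pose ch b := (fun w : torus R => complex.Re (@box_char R N L b w)).
pose sh b := (fun w : torus R => complex.Im (@box_char R N L b w)).
have bm b : Cmeasurable (@box_char R N L b) := (Cbounded_monomial _).1.
have m1 (h : torus R -> R) : measurable_fun setT h ->
    measurable_fun [set: torus R * torus R] (fun x : torus R * torus R => h x.1).
  by move=> mh; exact: (measurableT_comp mh measurable_fst).
have m2 (h : torus R -> R) : measurable_fun setT h ->
    measurable_fun [set: torus R * torus R] (fun x : torus R * torus R => h x.2).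
  by move=> mh; exact: (measurableT_comp mh measurable_snd).
have ReS (I : Type) (r : seq I) (F : I -> R[i]) :
    complex.Re (\sum_(i <- r) F i) = \sum_(i <- r) complex.Re (F i).
  by elim/big_rec2 : _ => //= i x y _ <-; rewrite ReD.
have ImS (I : Type) (r : seq I) (F : I -> R[i]) :
    complex.Im (\sum_(i <- r) F i) = \sum_(i <- r) complex.Im (F i).
  by elim/big_rec2 : _ => // i x y _ <-; rewrite ImD.
have E : (fun x : torus R * torus R => @fejer_kernel R N L x.1 x.2) = fun x =>
    ((\sum_(b : {ffun 'I_N -> 'I_L}) (ch b x.1 * ch b x.2 + sh b x.1 * sh b x.2)) ^+ 2 +
     (\sum_(b : {ffun 'I_N -> 'I_L}) (sh b x.1 * ch b x.2 - ch b x.1 * sh b x.2)) ^+ 2) *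
    (#|{: {ffun 'I_N -> 'I_L}}|%:R)^-1.
  apply/funext => x; rewrite /fejer_kernel cmod_sqr ReS ImS.
  congr ((_ ^+ 2 + _ ^+ 2) / _); apply: eq_bigr => b _.
    rewrite unimodular_inv ?cmod_monomial_torus// ReM /ch /sh.
    by case: (box_char b x.2) => ? ? /=; ring.
  rewrite unimodular_inv ?cmod_monomial_torus// ImM /ch /sh.
  by case: (box_char b x.2) => ? ? /=; ring.
rewrite E; apply: measurable_funM; last exact: measurable_cst.
have mch b := (bm b).1; have msh b := (bm b).2.
apply: measurable_funD; apply: measurable_funX; apply: measurable_sum => b.
- apply: measurable_funD; apply: measurable_funM;
    [exact: (m1 _ (mch b))|exact: (m2 _ (mch b))|
     exact: (m1 _ (msh b))|exact: (m2 _ (msh b))].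
- apply: measurable_funB; apply: measurable_funM;
    [exact: (m1 _ (msh b))|exact: (m2 _ (mch b))|
     exact: (m1 _ (mch b))|exact: (m2 _ (msh b))].
Qed.

Variables (N m : nat) (f : torus R -> R[i]).
Hypothesis If : Cintegrable f.
Hypothesis f_nonneg : forall a, ~ nonneg_indices a -> fourier_coeff f a = 0.
Hypothesis f_hom : forall a, fourier_coeff f a != 0 -> degree a = m%:Z.
Local Notation L := m.*2.+1.
Local Notation K := (@fejer_kernel R N L).

Lemma measurable_fejer_product : measurable_fun [set: torus R * torus R]
  (fun x : torus R * torus R => (cmod (f x.2) * K x.1 x.2)%:E).
Proof.
apply/measurable_EFinP; apply: measurable_funM; last exact: measurable_fejer_kernel.
exact: (measurableT_comp (measurable_cmod (Cintegrable_measurable If)) measurable_snd).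
Qed.

Lemma Cbounded_fejer_kernel w : Cbounded (fun u => (K w u)%:C).
Proof.
split; first split => /=.
- have /measurable_EFinP := measurable_int _ (@integrable_fejer_kernel R N L w).
  have E : (fun u => K u w) = fun u => K w u.
    by apply/funext => u; exact (@fejer_kernelC R N L u w).
  by move=> mK; rewrite -E; exact: mK.
- exact: measurable_cst.
exists ((\sum_(b : {ffun 'I_N -> 'I_L}) 1) ^+ 2 / (#|{: {ffun 'I_N -> 'I_L}}|)%:R) => u.
rewrite cmod_realC ger0_norm ?fejer_kernel_ge0// ler_wpM2r ?invr_ge0//.
rewrite lerXn2r// ?nnegrE ?cmod_ge0 ?sumr_ge0//.
apply: le_trans (ler_cmod_sum _ _ _) _; apply: ler_sum => b _.
by rewrite cmodM cmodV !cmod_monomial_torus invr1 mulr1.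
Qed.

Lemma integrable_fejer_product w : 
  P.-integrable setT (EFin \o (fun u => cmod (f u) * K w u)).
Proof.
have := integrable_cmod (CintegrableM If (Cbounded_fejer_kernel w)).
apply: eq_integrable => // u _ /=.
by rewrite cmodM cmod_realC ger0_norm// fejer_kernel_ge0.
Qed.

Lemma cmod_fejer_poly w : cmod (torus_eval (fejer_poly N m f) w) <=
  \int[P]_u (cmod (f u) * K w u).
Proof.
rewrite torus_eval_fejer_poly//.
apply: le_trans (ler_cmod_Cintegral (CintegrableM If (Cbounded_fejer_kernel w))) _.
rewrite le_eqVlt; apply/orP; left; apply/eqP; apply: eq_Rintegral => u _.
by rewrite cmodM cmod_realC ger0_norm// fejer_kernel_ge0.
Qed.

(** Tonelli: the kernel is nonnegative and its integral in w is 1 for every u. *)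
Lemma fejer_poly_L1 : \int[P]_w cmod (torus_eval (fejer_poly N m f) w) <=
  \int[P]_w cmod (f w).
Proof.
have H0 (x : torus R * torus R) : (0 <= (cmod (f x.2) * K x.1 x.2)%:E)%E.
  by rewrite lee_fin mulr_ge0 ?cmod_ge0 ?fejer_kernel_ge0.
have mH := measurable_fejer_product.
have Ip := integrable_cmod (Cbounded_integrable (Cbounded_torus_eval (fejer_poly N m f))).
rewrite -lee_fin !EFin_Rintegral//; last exact: integrable_cmod.
apply: (@le_trans _ _ (\int[P]_w \int[P]_u (cmod (f u) * K w u)%:E)%E).
  apply: ge0_le_integral => //.
  - by move=> w _; rewrite lee_fin cmod_ge0.
  - exact: measurable_int _ Ip.
  - exact: (@measurable_fun_fubini_tonelli_F _ _ _ _ _ P _ mH H0).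
  - move=> w _; rewrite -EFin_Rintegral; last exact: integrable_fejer_product.
    by rewrite lee_fin; exact: cmod_fejer_poly.
rewrite (@fubini_tonelli _ _ _ _ _ P P _ mH H0) /=.
rewrite le_eqVlt; apply/orP; left; apply/eqP; apply: eq_integral => u _.
under [LHS]eq_integral do rewrite EFinM.
rewrite ge0_integralZl//.
- rewrite -[X in (_ * X)%E](@EFin_Rintegral (fun w => K w u)).
    by rewrite Rintegral_fejer_kernel// mule1.
  exact: integrable_fejer_kernel.
- exact: measurable_int _ (@integrable_fejer_kernel R N L u).
- by move=> w _; rewrite lee_fin fejer_kernel_ge0.
- by rewrite lee_fin cmod_ge0.
Qed.

Lemma fejer_poly_sup (B : R) w : 0 <= B -> {ae P, forall u, cmod (f u) <= B} ->
  cmod (torus_eval (fejer_poly N m f) w) <= B.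
Proof.
move=> B0 fB; apply: le_trans (cmod_fejer_poly w) _.
have IK : P.-integrable setT (EFin \o (fun u => K w u)).
  have -> : EFin \o (fun u => K w u) = EFin \o (fun u => K u w).
    by apply/funext => u; exact (f_equal EFin (@fejer_kernelC R N L w u)).
  exact: integrable_fejer_kernel.
have IBK : P.-integrable setT (EFin \o (fun u => B * K w u)).
  exact: (integrableZl measurableT B IK).
apply: (@le_trans _ _ (\int[P]_u (B * K w u))).
  rewrite -lee_fin !EFin_Rintegral//; last exact: integrable_fejer_product.
  apply: ae_ge0_le_integral => //.
  - by move=> u _; rewrite lee_fin mulr_ge0 ?cmod_ge0 ?fejer_kernel_ge0.
  - exact: measurable_int _ (integrable_fejer_product w).
  - by move=> u _; rewrite lee_fin mulr_ge0 ?fejer_kernel_ge0.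
  - exact: measurable_int _ IBK.
  - apply: filterS fB => u fuB _; rewrite lee_fin ler_wpM2r// fejer_kernel_ge0//.
rewrite RintegralZl//.
have -> : \int[P]_u K w u = \int[P]_u K u w.
  by apply: eq_Rintegral => u _; exact (@fejer_kernelC R N L w u).
by rewrite Rintegral_fejer_kernel// mulr1.
Qed.

End fejer_bounds.

(** * Coefficient sums of Hardy functions *)

Section monomial_sums.
Context {R : realType}.

Lemma sum_geometric_le (y : R) n : 0 <= y <= 2^-1 -> \sum_(k < n) y ^+ k <= 1 + 2 * y.
Proof.
move=> /andP[y0 y1]; elim: n => [|n ih]; first by rewrite big_ord0; lra.
rewrite big_ord_recl expr0.
under eq_bigr do rewrite exprS.
rewrite -mulr_sumr lerD2l.
apply: (@le_trans _ _ (y * (1 + 2 * y))); first by rewrite ler_wpM2l.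
by rewrite (mulrC 2) ler_wpM2l//; lra.
Qed.

(* The left-hand side is a coefficient of the generating function
   \prod_i (1 - lam x_i)^-1. *)
Lemma sum_monomials_le N d (s : seq (multinom N)) (x : 'I_N -> R) (lam : R) :
  uniq s -> (forall a, a \in s -> mdeg a = d) -> (forall i, 0 <= x i) -> 0 < lam ->
  (forall i, lam * x i <= 2^-1) ->
  \sum_(a <- s) \prod_(i < N) x i ^+ a i <=
  lam ^- d * expR (2 * lam * \sum_(i < N) x i).
Proof.
move=> us sd x0 l0 lx.
have E : \sum_(a <- s) \prod_(i < N) x i ^+ a i =
    lam ^- d * \sum_(a <- s) \prod_(i < N) (lam * x i) ^+ a i.
  rewrite mulr_sumr; apply: eq_big_seq => a /sd ad.
  under [in RHS]eq_bigr do rewrite exprMn.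
  by rewrite big_split /= -expr_sum -mdegE ad mulKf// expf_neq0// gt_eqF.
rewrite E ler_wpM2l ?invr_ge0 ?exprn_ge0 ?(ltW l0)//.
have lx0 i : 0 <= lam * x i by rewrite mulr_ge0// ltW.
apply: le_trans (@ler_sum_mnm R N d s (fun i k => (lam * x i) ^+ k) us _ _) _.
- by move=> i k; rewrite exprn_ge0.
- by move=> a /sd <- i; rewrite mdegE (bigD1 i)//=; exact: leq_addr.
rewrite mulr_sumr expR_sum.
apply: ler_prod => i _; rewrite sumr_ge0/=; last by move=> k _; rewrite exprn_ge0.
apply: (@le_trans _ _ (1 + 2 * (lam * x i))).
  by apply: sum_geometric_le; rewrite lx0 lx.
by rewrite -mulrA; exact: expR_ge1Dx.
Qed.

Lemma nth_root_natr (m n : nat) : (0 < m)%N ->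
  exists2 a : R, 0 <= a & a ^+ m = n%:R.
Proof.
move=> m0; exists (n%:R `^ (m%:R)^-1); first exact: powR_ge0.
by rewrite -powR_mulrn ?powR_ge0// -powRrM mulVf ?powRr1// pnatr_eq0 -lt0n.
Qed.

Lemma subXn_le (a c : R) m : 0 <= c -> c <= a ->
  a ^+ m - c ^+ m <= m%:R * a ^+ m.-1 * (a - c).
Proof.
move=> c0 ca; rewrite subrXX mulrC ler_wpM2r ?subr_ge0//.
apply: (@le_trans _ _ (\sum_(i < m) a ^+ m.-1)); last first.
  by rewrite sumr_const card_ord mulr_natl.
apply: ler_sum => i _; have im : (i <= m.-1)%N by rewrite -ltnS prednK// (leq_ltn_trans _ (ltn_ord i)).
rewrite -[in leRHS](subnK im) exprD ler_wpM2l ?exprn_ge0 ?(le_trans c0)//.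
by apply: lerXn2r => //; rewrite nnegrE//; exact: le_trans ca.
Qed.

Variables (N m : nat) (x : 'I_N -> R) (b : R).
Hypotheses (m0 : (0 < m)%N) (b0 : 0 < b) (x0 : forall i, 0 <= x i).
(** With x_i = |z_i|^2 this is the weak-space bound without roots: the smallest x_i on a set of r
    indices is at most b r^(-(m - 1) / m). *)
Hypothesis weak : forall S : {set 'I_N}, S != finset.set0 ->
  exists2 i, i \in S & x i ^+ m * #|S|%:R ^+ m.-1 <= b ^+ m.

Lemma weak_le i : x i <= b.
Proof.
have [|j] := weak (S := [set i]%SET); first by apply/set0Pn; exists i; rewrite inE.
rewrite inE => /eqP ->; rewrite cards1 expr1n mulr1.
by rewrite ler_pXn2r// nnegrE// ltW.
Qed.

(** Remove the index provided by [weak] and induct. With c^m = a^m - 1 the removed term is at most b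
    a^(1 - m), hence at most b m (a - c), because 1 = a^m - c^m <= m a^(m - 1) (a - c); these bounds
    telescope. *)
Lemma weak_sum_le (A : {set 'I_N}) (a : R) : 0 <= a -> a ^+ m = #|A|%:R ->
  \sum_(i in A) x i <= b * m%:R * a.
Proof.
move: {2}#|A| (erefl #|A|) => n An; elim: n => [|n ih] in A An a *.
  by move=> a0 _; rewrite (cards0_eq An) big_set0 !mulr_ge0// ltW.
move=> a0 aA; have Ane : A != finset.set0 by rewrite -card_gt0 An.
have [i iA xi] := weak Ane.
have [c c0 cn] := nth_root_natr n m0.
have Ai : #|A :\ i|%SET = n by move: An; rewrite (cardsD1 i) iA add1n => -[].
rewrite (big_setD1 i)//=; have := ih _ Ai c c0; rewrite Ai => /(_ cn) h.
rewrite An in xi aA.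
have ap : 0 < a.
  by rewrite lt_def a0 andbT; apply/eqP => aE; move: aA; rewrite aE expr0n
    (gtn_eqF m0) => /eqP; rewrite eq_sym pnatr_eq0.
have ca : c <= a.
  by rewrite -(ler_pXn2r m0) ?nnegrE// cn aA ler_nat.
have x_le : x i * a ^+ m.-1 <= b.
  rewrite -(ler_pXn2r m0) ?nnegrE ?mulr_ge0 ?exprn_ge0// ?(ltW b0)//.
  by rewrite exprMn exprAC aA.
have key := subXn_le m c0 ca.
have step : x i <= b * m%:R * (a - c).
  have am0 : 0 < a ^+ m.-1 by rewrite exprn_gt0.
  have one : 1 <= m%:R * a ^+ m.-1 * (a - c).
    by apply: le_trans key; rewrite aA cn -natr1 addrAC subrr add0r.
  rewrite -(ler_pM2r am0); apply: le_trans x_le _.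
  have -> : b * m%:R * (a - c) * a ^+ m.-1 = b * (m%:R * a ^+ m.-1 * (a - c)) by ring.
  by rewrite -[leLHS]mulr1 ler_pM2l.
apply: le_trans (lerD step h) _.
by rewrite -mulrDr subrK.
Qed.

(** Only variables in A, where x_i >= x_k, occur. If #|A| = a^m then x_k <= b a^(1 - m), while the
    generating function bounds the sum of the monomials by (2 a b)^(m - 1) e^m; the powers of a
    cancel. *)
Lemma weak_monomials_le (k : 'I_N) (s : seq (multinom N)) : uniq s ->
  (forall a, a \in s -> mdeg a = m.-1) ->
  (forall a i, a \in s -> a i != 0%N -> x k <= x i) ->
  x k * \sum_(a <- s) \prod_(i < N) x i ^+ a i <= b ^+ m * (2 * expR 1) ^+ m.
Proof.
move=> us sd sk; pose A := [set i | x k <= x i]%SET.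
pose y i := if i \in A then x i else 0.
have y0 i : 0 <= y i by rewrite /y; case: ifP.
have Ane : A != finset.set0 by apply/set0Pn; exists k; rewrite inE.
have [a a0 aA] := nth_root_natr #|A| m0.
have A1 : (1 : R) <= #|A|%:R by rewrite ler1n card_gt0.
have a1 : 1 <= a by rewrite -(ler_pXn2r m0) ?nnegrE// expr1n aA.
have ap : 0 < a by exact: lt_le_trans a1.
have xk : x k * a ^+ m.-1 <= b.
  have [i iA xi] := weak Ane.
  rewrite -(ler_pXn2r m0) ?nnegrE ?mulr_ge0 ?exprn_ge0// ?(ltW b0)//.
  rewrite exprMn exprAC aA; apply: le_trans xi.
  rewrite ler_wpM2r ?exprn_ge0//; move: iA; rewrite inE => ki.
  by rewrite ler_pXn2r// nnegrE.
have Ey : \sum_(c <- s) \prod_(i < N) x i ^+ c i = \sum_(c <- s) \prod_(i < N) y i ^+ c i.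
  apply: eq_big_seq => c cs; apply: eq_bigr => i _; rewrite /y inE.
  by have [->|ci] := eqVneq (c i) 0%N; [rewrite !expr0|rewrite (sk c i)].
(* Then lam y_i <= 1/2, because y_i <= b and a >= 1, and [weak_sum_le] bounds the exponent 2 lam sum
   y_i by m. *)
pose lam := (2 * a * b)^-1.
have l0 : 0 < lam by rewrite invr_gt0 !mulr_gt0.
have ly i : lam * y i <= 2^-1.
  apply: (@le_trans _ _ (lam * b)).
    by rewrite ler_pM2l// /y; case: ifP => _; [exact: weak_le|exact: ltW].
  rewrite /lam invfM -mulrA mulVf ?gt_eqF// mulr1 invfM ler_piMr ?invr_ge0//.
  by rewrite invf_le1.
have h := sum_monomials_le us sd y0 l0 ly.
have Sy : \sum_(i < N) y i <= b * m%:R * a.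
  rewrite /y -big_mkcond /=; exact: weak_sum_le.
have ee : expR (2 * lam * \sum_(i < N) y i) <= expR 1 ^+ m.
  rewrite -expRM_natl mulr1 ler_expR.
  apply: (@le_trans _ _ (2 * lam * (b * m%:R * a))).
    by rewrite ler_wpM2l// mulr_ge0// ltW.
  rewrite /lam le_eqVlt; apply/orP; left; apply/eqP.
  by field; rewrite !gt_eqF.
rewrite Ey; apply: (@le_trans _ _ (x k * (lam ^- m.-1 * expR 1 ^+ m))).
  rewrite ler_wpM2l//; apply: le_trans h _.
  by rewrite ler_wpM2l// invr_ge0 exprn_ge0// ltW.
have -> : x k * (lam ^- m.-1 * expR 1 ^+ m) =
    (x k * a ^+ m.-1) * ((2 * b) ^+ m.-1 * expR 1 ^+ m).
  by rewrite -exprVn /lam invrK !exprMn; ring.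
apply: (@le_trans _ _ (b * ((2 * b) ^+ m.-1 * expR 1 ^+ m))).
  by rewrite ler_wpM2r// !mulr_ge0 ?exprn_ge0 ?expR_ge0 ?mulr_ge0// ltW.
have -> : b ^+ m * (2 * expR 1) ^+ m = 2 * (b * ((2 * b) ^+ m.-1 * expR 1 ^+ m)).
  have Em (t : R) : t ^+ m = t * t ^+ m.-1 by rewrite -exprS prednK.
  by rewrite !exprMn (Em b) (Em 2); ring.
by rewrite ler_peMl ?ler1n// !mulr_ge0 ?exprn_ge0 ?expR_ge0 ?mulr_ge0// ltW.
Qed.

End monomial_sums.

(** * Coefficient sums over finitely many monomials *)

Section coefficient_sums.
Context {R : realType}.
Local Notation P := (torus_measure R).

Lemma mnm_index_surj_seq (X : seq multi_index) : uniq X ->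
  (forall a, a \in X -> nonneg_indices a) ->
  exists N (s : seq (multinom N)), uniq s /\ X = [seq mnm_index b | b <- s].
Proof.
move=> uX X0.
have [N aN] : exists N, forall a, a \in X -> forall j, a j != 0 -> (j < N)%N.
  exists (\sum_(a <- X) \sum_(j <- finsupp a) j).+1 => a aX j aj.
  rewrite ltnS (big_rem a)//= (big_rem j) /=; last by rewrite mem_finsupp.
  by rewrite -addnA leq_addr.
have surj a : a \in X -> exists b : multinom N, mnm_index b = a.
  by move=> aX; apply: mnm_index_surj; [exact: X0|exact: aN].
exists N; elim: X uX X0 {aN} surj => [|a X ih] /=; first by move=> *; exists [::].
move=> /andP[aX uX] X0 surj.
have [b ba] := surj a (mem_head _ _).
have [|c cX|s [us Xs]] := ih uX.
- by move=> c cX; apply: X0; rewrite inE cX orbT.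
- by apply: surj; rewrite inE cX orbT.
exists (b :: s); split; last by rewrite /= ba Xs.
rewrite /= us andbT; apply: contra aX => bs.
by rewrite Xs -ba map_f.
Qed.

(** The sum is the supremum of its finite partial sums, each of which involves finitely many
    variables; B must therefore be uniform in N. *)
Lemma esum_multi_index_le (I : set multi_index) (F : multi_index -> R) (B : R) m :
  I `<=` nonneg_indices -> (forall a, 0 <= F a) ->
  (forall a, F a != 0 -> degree a = m%:Z) ->
  (forall N (s : seq (multinom N)), uniq s -> (forall a, a \in s -> mdeg a = m) ->
    \sum_(a <- s) F (mnm_index a) <= B) ->
  (\esum_(a in I) (F a)%:E <= B%:E)%E.
Proof.
move=> I0 F0 Fm FB; apply: ub_ereal_sup => _ [A [finA AI] <-].
rewrite fsbig_finite// sumEFin lee_fin.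
set X : seq multi_index := fset_set A.
have uX : uniq X by exact: fset_uniq.
have X0 a : a \in X -> nonneg_indices a.
  by rewrite /X in_fset_set// inE => /AI /I0.
have [N [s [us ->]]] := mnm_index_surj_seq uX X0.
rewrite big_map (bigID (fun a => mdeg a == m)) /= [X in _ + X]big1 ?addr0.
  rewrite -big_filter; apply: FB; first exact: filter_uniq.
  by move=> a; rewrite mem_filter => /andP[/eqP].
move=> a am; apply/eqP; apply: contraNT am => /Fm.
by rewrite degree_mnm => -[->].
Qed.

Lemma ler_sum_sqrt (I : Type) (s : seq I) (a b : I -> R) (A B : R) :
  \sum_(i <- s) a i ^+ 2 <= A -> \sum_(i <- s) b i ^+ 2 <= B ->
  \sum_(i <- s) a i * b i <= Num.sqrt A * Num.sqrt B.
Proof.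
move=> hA hB; have A0 : 0 <= A.
  by apply: le_trans hA; apply: sumr_ge0 => i _; exact: sqr_ge0.
rewrite -sqrtrM//; apply: le_trans (ler_norm _) _; rewrite -sqrtr_sqr ler_wsqrtr//.
apply: le_trans (cauchy_schwarz_seq _ _ _) _.
by apply: ler_pM => //; apply: sumr_ge0 => i _; exact: sqr_ge0.
Qed.

Lemma cmod_monomial_mnm N (a : multinom N) (z : nat -> R[i]) :
  cmod (monomial z (mnm_index a)) ^+ 2 = \prod_(i < N) (cmod (z i) ^+ 2) ^+ a i.
Proof.
rewrite monomial_mnm cmod_prod -prodrXl; apply: eq_bigr => i _.
by rewrite cmodX exprAC.
Qed.

Variables (m : nat) (f : torus R -> R[i]).
Hypothesis m0 : (0 < m)%N.
Hypothesis If : Cintegrable f.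
Hypothesis f_nonneg : forall a, ~ nonneg_indices a -> fourier_coeff f a = 0.
Hypothesis f_hom : forall a, fourier_coeff f a != 0 -> degree a = m%:Z.

(** One constant for both estimates. The weak one ends with 6 (8 e)^m, and 256 e = 32 * 8 e absorbs
    the 6; the l_2 one only needs C >= 32 e and C >= 8. *)
Let C : R := 256 * expR 1.

Lemma sum_fourier_coeff_fejer N (s : seq (multinom N)) (z : nat -> R[i]) :
  (forall a, a \in s -> mdeg a = m) ->
  \sum_(a <- s) cmod (fourier_coeff f (mnm_index a) * monomial z (mnm_index a)) <=
  2 * \sum_(a <- s) cmod (mcoeff a (fejer_poly N m f)) * cmod (monomial z (mnm_index a)).
Proof.
move=> sm; rewrite mulr_sumr big_seq [leRHS]big_seq; apply: ler_sum => a /sm am.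
by rewrite cmodM mulrA ler_wpM2r ?cmod_ge0//; exact: mcoeff_fejer_poly_ge.
Qed.

Lemma expR1_ge2 : 2 <= expR 1 :> R.
Proof. by have := @expR_ge1Dx R 1. Qed.

Lemma sum_fourier_coeff_l2 N (s : seq (multinom N)) (z : nat -> R[i]) (B : R) :
  uniq s -> (forall a, a \in s -> mdeg a = m) -> 0 <= B ->
  \sum_(j < N) cmod (z j) ^+ 2 <= B ^+ 2 ->
  \sum_(a <- s) cmod (fourier_coeff f (mnm_index a) * monomial z (mnm_index a)) <=
  C ^+ m * B ^+ m * \int[P]_w cmod (f w).
Proof.
move=> us sm B0 zB; set F := \int[P]_w _.
have F0 : 0 <= F by apply: Rintegral_ge0 => w _; exact: cmod_ge0.
apply: le_trans (sum_fourier_coeff_fejer _ sm) _.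
set p := fejer_poly N m f.
(* For B = 0 all terms vanish, since m > 0; it is treated apart because lam below is 1 / (2 B^2). *)
have [B00|Bn0] := eqVneq B 0.
  rewrite big_seq big1 ?mulr0; last first.
    move=> a /sm am; apply/eqP; rewrite mulf_eq0; apply/orP; right.
    rewrite -sqrf_eq0 cmod_monomial_mnm.
    have /existsP[i ai] : [exists i, a i != 0%N].
      apply: contraT; rewrite negb_exists => /forallP h; move: m0; rewrite -am mdegE.
      by rewrite big1// => i _; apply/eqP; have := h i; rewrite negbK.
    have zi : cmod (z i) ^+ 2 = 0.
      apply/eqP; rewrite eq_le sqr_ge0 andbT; apply: le_trans (_ : B ^+ 2 <= 0).
        by apply: le_trans zB; rewrite (bigD1 i)//= lerDl sumr_ge0// => j _; exact: sqr_ge0.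
      by rewrite B00 expr0n.
    by rewrite (bigD1 i)//= zi expr0n (negbTE ai) mul0r.
  by rewrite !mulr_ge0 ?exprn_ge0// /C mulr_ge0// expR_ge0.
have Bp : 0 < B by rewrite lt_def Bn0.
have hp : coeff_sqnorm p <= 8 * 4 ^+ m * F ^+ 2.
  have hom := @homogeneous_fejer_poly R N m f.
  apply: le_trans (coeff_sqnorm_le_L1 hom) _.
  rewrite ler_wpM2l ?mulr_ge0 ?exprn_ge0// lerXn2r// ?nnegrE//.
    by apply: Rintegral_ge0 => w _; exact: cmod_ge0.
  exact: fejer_poly_L1.
have hz : \sum_(a <- s) cmod (monomial z (mnm_index a)) ^+ 2 <=
    (2 * B ^+ 2) ^+ m * expR 1.
  under eq_bigr do rewrite cmod_monomial_mnm.
  (* Chosen so that lam |z_i|^2 <= 1/2 and the exponent in [sum_monomials_le] is at most 1. *)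
  pose lam := (2 * B ^+ 2)^-1.
  have l0 : 0 < lam by rewrite invr_gt0 mulr_gt0// exprn_gt0.
  have B2 : B ^+ 2 != 0 by rewrite expf_neq0.
  apply: le_trans (@sum_monomials_le R N m s _ lam us sm _ l0 _) _.
  - by move=> i; exact: sqr_ge0.
  - move=> i; apply: (@le_trans _ _ (lam * B ^+ 2)).
      rewrite ler_pM2l//; apply: le_trans zB.
      by rewrite (bigD1 i)//= lerDl sumr_ge0// => j _; exact: sqr_ge0.
    by rewrite /lam le_eqVlt; apply/orP; left; apply/eqP; field; exact: Bn0.
  rewrite -exprVn invrK ler_wpM2l ?exprn_ge0 ?mulr_ge0 ?sqr_ge0//.
  rewrite ler_expR; apply: (@le_trans _ _ (2 * lam * B ^+ 2)).
    by rewrite ler_wpM2l// mulr_ge0// ltW.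
  by rewrite /lam le_eqVlt; apply/orP; left; apply/eqP; field; exact: Bn0.
have h := ler_sum_sqrt (le_trans (ler_coeff_sqnorm p us) hp) hz.
have e2 := expR1_ge2.
have T0 : 0 <= C ^+ m / 2 * B ^+ m * F.
  by rewrite !mulr_ge0 ?exprn_ge0 ?expR_ge0 ?mulr_ge0 ?expR_ge0.
apply: le_trans (ler_wpM2l _ h) _ => //.
suff : Num.sqrt (8 * 4 ^+ m * F ^+ 2) * Num.sqrt ((2 * B ^+ 2) ^+ m * expR 1) <=
    C ^+ m / 2 * B ^+ m * F.
  move=> /(ler_wpM2l (ler0n R 2)) /le_trans; apply.
  by rewrite le_eqVlt; apply/orP; left; apply/eqP; field.
rewrite -sqrtrM ?mulr_ge0 ?exprn_ge0 ?sqr_ge0//.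
rewrite -[leRHS](ger0_norm T0) -sqrtr_sqr ler_wsqrtr//.
have C1 : 1 <= C by rewrite /C; lra.
have CC : C <= C ^+ m by rewrite -[leLHS]expr1 ler_weXn2l.
have C8 : 8 ^+ m <= C ^+ m by apply: lerXn2r; rewrite ?nnegrE /C; lra.
have -> : 8 * 4 ^+ m * F ^+ 2 * ((2 * B ^+ 2) ^+ m * expR 1) =
    (8 * expR 1 * 8 ^+ m) * (B ^+ m * F) ^+ 2.
  have -> : 8 ^+ m = 2 ^+ m * 4 ^+ m :> R by rewrite -exprMn -natrM.
  rewrite (exprMn m 2 (B ^+ 2)) (exprAC B 2 m) (exprMn 2 (B ^+ m) F).
  by move: (2 ^+ m : R) (4 ^+ m : R) (B ^+ m) (expR 1 : R) => *; ring.
have -> : (C ^+ m / 2 * B ^+ m * F) ^+ 2 = (C ^+ m * C ^+ m / 4) * (B ^+ m * F) ^+ 2.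
  by field.
rewrite ler_wpM2r ?sqr_ge0// ler_pdivlMr//.
have -> : 8 * expR 1 * 8 ^+ m * 4 = (32 * expR 1) * 8 ^+ m :> R by ring.
apply: ler_pM => //; rewrite ?exprn_ge0 ?mulr_ge0 ?expR_ge0//.
by apply: le_trans CC; rewrite /C; lra.
Qed.

Lemma sum_fourier_coeff_weak N (s : seq (multinom N)) (z : nat -> R[i]) (B M : R) :
  uniq s -> (forall a, a \in s -> mdeg a = m) -> 0 < B ->
  (forall S : {set 'I_N}, S != finset.set0 -> exists2 i, i \in S &
    (cmod (z i) ^+ 2) ^+ m * #|S|%:R ^+ m.-1 <= (B ^+ 2) ^+ m) ->
  0 <= M -> {ae P, forall u, cmod (f u) <= M} ->
  \sum_(a <- s) cmod (fourier_coeff f (mnm_index a) * monomial z (mnm_index a)) <=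
  C ^+ m * B ^+ m * M.
Proof.
move=> us sm B0 zB M0 fM.
apply: le_trans (sum_fourier_coeff_fejer _ sm) _.
set p := fejer_poly N m f.
have hom : homogeneous m p := @homogeneous_fejer_poly R N m f.
have pM w : cmod (torus_eval p w) <= M by exact: fejer_poly_sup.
have supp a : a \in s -> exists i, a i != 0%N.
  move=> /sm am; apply: contrapT => /forallNP h; move: m0; rewrite -am mdegE.
  by rewrite big1// => i _; apply/eqP; have /negP := h i; rewrite negbK.
pose x (i : 'I_N) := cmod (z i) ^+ 2.
(* A coordinate of a at which |z_k| is minimal; [option] supplies a value for a outside s even when
   N = 0. *)
have kappa a : exists o : option 'I_N, a \in s -> exists2 k, o = Some k &
    a k != 0%N /\ forall i, a i != 0%N -> x k <= x i.
  have [as_|] := boolP (a \in s); last by exists None.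
  have [i ai] := supp a as_.
  have [k ak kmin] := @arg_minP _ _ _ i (fun i => a i != 0%N) x ai.
  by exists (Some k) => _; exists k.
have [K KP] := choice kappa.
(* Cauchy-Schwarz over the a assigned to k. The coefficient of [mderiv k p] at a - e_k is a_k >= 1
   times that of p at a, and x^a = x_k x^(a - e_k), where every variable in a - e_k has x_i >= x_k,
   as [weak_monomials_le] requires. *)
have step (k : 'I_N) : \sum_(a <- s | K a == Some k)
    cmod (mcoeff a p) * cmod (monomial z (mnm_index a)) <=
    Num.sqrt (coeff_sqnorm (mderiv k p)) * Num.sqrt ((B ^+ 2) ^+ m * (2 * expR 1) ^+ m).
  rewrite -big_filter; set t := seq.filter _ s.
  have tP a : a \in t -> [/\ a \in s, a k != 0%N & forall i, a i != 0%N -> x k <= x i].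
    rewrite mem_filter => /andP[/eqP Ka as_].
    by have [k' + [? ?]] := KP a as_; rewrite Ka => -[->].
  pose sub (a : multinom N) := mnm_sub a (mnm1 k).
  have subK' a : a \in t -> mnm_add (sub a) (mnm1 k) = a.
    by move=> /tP[_ ak _]; rewrite /sub submK// lep1mP.
  have ut : uniq t by exact: filter_uniq.
  have us' : uniq [seq sub a | a <- t].
    rewrite map_inj_in_uniq// => a a' at_ a't E.
    by rewrite -(subK' a at_) E subK'.
  apply: ler_sum_sqrt.
    apply: le_trans (ler_coeff_sqnorm (mderiv k p) us').
    rewrite big_map big_seq [leRHS]big_seq; apply: ler_sum => a at_.
    rewrite mcoeff_deriv -/(sub a) subK'// -mulr_natl cmodM cmod_natr exprMn.
    by rewrite ler_peMl ?sqr_ge0// -natrX ler1n expn_gt0.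
  under eq_bigr do rewrite cmod_monomial_mnm.
  apply: le_trans (@weak_monomials_le R N m x (B ^+ 2) m0 _ _ zB k _ us' _ _).
  - rewrite big_map mulr_sumr le_eqVlt; apply/orP; left; apply/eqP.
    apply: eq_big_seq => a at_; have [_ ak _] := tP a at_.
    rewrite (bigD1 k)//= [in RHS](bigD1 k)//= mulrA; congr (_ * _).
      rewrite -exprS; congr (_ ^+ _).
      by rewrite mnmBE mnm1E eqxx subn1 prednK// lt0n.
    by apply: eq_bigr => i ik; rewrite mnmBE mnm1E eq_sym (negbTE ik) subn0.
  - by rewrite exprn_gt0.
  - by move=> i; exact: sqr_ge0.
  - move=> _ /mapP[a at_ ->]; have [as_ _ _] := tP a at_.
    by have := sm a as_; rewrite -{1}(subK' a at_) mdegD mdeg1 addn1 => <-.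
  - move=> _ i /mapP[a at_ ->]; rewrite mnmBE => ai; have [_ _ h] := tP a at_.
    by apply: h; apply: contraNneq ai => ->; rewrite sub0n.
have -> : \sum_(a <- s) cmod (mcoeff a p) * cmod (monomial z (mnm_index a)) =
    \sum_(k < N) \sum_(a <- s | K a == Some k)
    cmod (mcoeff a p) * cmod (monomial z (mnm_index a)).
  under [RHS]eq_bigr do rewrite big_mkcond.
  rewrite exchange_big /=; apply: eq_big_seq => a as_.
  have [k Ka _] := KP a as_; rewrite (bigD1 k)//= Ka eqxx big1 ?addr0// => i ik.
  by rewrite (inj_eq (@Some_inj _)) eq_sym (negbTE ik).
apply: le_trans (ler_wpM2l _ (ler_sum _ (fun k _ => step k))) _ => //.
rewrite -mulr_suml.
have := sum_coeff_sqnorm_mderiv hom pM.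
set D := \sum_(k < N) _ => hD.
have -> : Num.sqrt ((B ^+ 2) ^+ m * (2 * expR 1) ^+ m) = B ^+ m * Num.sqrt ((2 * expR 1) ^+ m).
  rewrite sqrtrM; last by rewrite exprn_ge0// sqr_ge0.
  by rewrite -exprM mulnC exprM sqrtr_sqr ger0_norm// exprn_ge0// ltW.
have e2 := expR1_ge2.
have D0 : 0 <= D by apply: sumr_ge0 => k _; exact: sqrtr_ge0.
have e1 : 1 <= (2 * expR 1) ^+ m :> R by rewrite exprn_ege1//; lra.
have es : Num.sqrt ((2 * expR 1) ^+ m) <= (2 * expR 1) ^+ m :> R.
  have E0 : (0 : R) <= (2 * expR 1) ^+ m by rewrite (le_trans ler01).
  rewrite -[leRHS](ger0_norm E0) -sqrtr_sqr ler_wsqrtr// expr2.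
  by rewrite ler_peMr.
have BM0 : 0 <= B ^+ m by rewrite exprn_ge0// ltW.
apply: (@le_trans _ _ (2 * ((3 * 4 ^+ m * M) * (B ^+ m * (2 * expR 1) ^+ m)))).
  rewrite ler_wpM2l//; apply: ler_pM => //; first by rewrite mulr_ge0 ?sqrtr_ge0.
  by rewrite ler_wpM2l.
have -> : 2 * (3 * 4 ^+ m * M * (B ^+ m * (2 * expR 1) ^+ m)) =
    6 * (8 * expR 1) ^+ m * (B ^+ m * M).
  rewrite [(2 * _) ^+ m]exprMn [(8 * _) ^+ m]exprMn.
  have -> : 8 ^+ m = 4 ^+ m * 2 ^+ m :> R by rewrite -exprMn -natrM.
  by move: (2 ^+ m : R) (4 ^+ m : R) (B ^+ m) (expR 1 ^+ m : R) => *; ring.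
rewrite -[leRHS]mulrA; apply: ler_wpM2r; first exact: mulr_ge0.
have -> : C = 32 * (8 * expR 1) by rewrite /C mulrA -natrM.
rewrite [leRHS]exprMn ler_wpM2r ?exprn_ge0 ?mulr_ge0 ?expR_ge0//.
apply: (@le_trans _ _ (32 ^+ 1)); first by rewrite expr1 ler_nat.
by rewrite ler_weXn2l// ler1n.
Qed.

End coefficient_sums.

(** * Norms of functions and of sequences *)

Section hardy_norms.
Context {R : realType}.
Local Notation P := (torus_measure R).

Lemma Lp_Cmeasurable (p : \bar R) (f : torus R -> R[i]) : Lp p f -> Cmeasurable f.
Proof. by move=> []. Qed.

Lemma torus_measure_setT : (P [set: torus R] = 1)%E.
Proof. exact: probability_setT. Qed.

Lemma Lp_norm_ae (f : torus R -> R[i]) : (Lp_norm +oo f < +oo)%E ->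
  {ae P, forall u, cmod (f u) <= fine (Lp_norm +oo f)}.
Proof.
have P0 : (0 < P [set: torus R])%E by rewrite torus_measure_setT.
rewrite /Lp_norm unlock /Lnorm ifT// => fin.
have := ess_sup_ge P (abse \o (EFin \o (@cmod R \o f))).
set s := ess_sup _ _ in fin *.
apply: filterS => u /=; rewrite ger0_norm ?cmod_ge0// => h.
rewrite -lee_fin fineK// ge0_fin_numE//.
by apply: le_trans h; rewrite lee_fin cmod_ge0.
Qed.

Lemma L1_le_Lp (p : \bar R) (f : torus R -> R[i]) : Cmeasurable f -> (1 <= p)%E ->
  (\int[P]_w (cmod (f w))%:E <= Lp_norm p f)%E.
Proof.
move=> mf; have mc := measurable_cmod mf.
have N1 : (\int[P]_w (cmod (f w))%:E = 'N[P]_1[EFin \o (@cmod R \o f)])%E.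
  by rewrite Lnorm1; apply: eq_integral => w _ /=; rewrite ger0_norm ?cmod_ge0.
case: p => [r| |//].
- rewrite lee_fin le_eqVlt => /predU1P[<-|r1]; first by rewrite N1.
  have r0 : 0 < r by exact: lt_trans r1.
  (* Hoelder against the constant 1 on a probability space; r = 1 has been set apart because its
     conjugate exponent is infinite. *)
  pose q := (1 - r^-1)^-1.
  have q0 : 0 < q by rewrite invr_gt0 subr_gt0 invf_lt1.
  have := @hoelder _ _ _ P (@cmod R \o f) (cst 1) r q mc (measurable_cst _) r0 q0.
  rewrite /q invrK subrKC => /(_ erefl).
  have -> : ('N[P]_q%:E[cst 1] = 1)%E.
    apply: (etrans (Lnorm_cst1 P q)).
    apply: (etrans (f_equal (fun t => poweR t q^-1) torus_measure_setT)).
    by rewrite poweR_EFin powR1.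
  rewrite mule1; apply: le_trans.
  rewrite N1 le_eqVlt; apply/orP; left; apply/eqP; apply: eq_Lnorm => w /=.
  by rewrite mulr1.
- move=> _; have [->|] := eqVneq (Lp_norm +oo f) +oo%E; first exact: leey.
  rewrite -ltey => fin; have := Lp_norm_ae fin.
  have L0 : (0 <= Lp_norm +oo f)%E by exact: Lnorm_ge0.
  rewrite -[leRHS]fineK ?ge0_fin_numE//; set M := fine _ => fM.
  have -> : (M%:E = \int[P]_w M%:E)%E.
    rewrite -(@EFin_Rintegral R (fun=> M)) ?Rintegral_prob_cst//.
    by apply: (@bounded_integrable _ _ `|M|) => //; exact: measurable_cst.
  apply: ae_ge0_le_integral => //.
  + by move=> w _; rewrite lee_fin cmod_ge0.
  + exact/measurable_EFinP.
  + by move=> w _; rewrite lee_fin fine_ge0.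
  + by apply: filterS fM => w fw _; rewrite lee_fin.
Qed.

Lemma Lp_Cintegrable (p : \bar R) (f : torus R -> R[i]) : (1 <= p)%E -> Lp p f ->
  Cintegrable f.
Proof.
move=> p1 [m1 m2 fin]; apply: cmod_integrable => //; apply/integrableP; split.
  by apply/measurable_EFinP; exact: measurable_cmod.
apply: le_lt_trans fin; apply: le_trans (L1_le_Lp (conj m1 m2) p1).
rewrite le_eqVlt; apply/orP; left; apply/eqP; apply: eq_integral => w _ /=.
by rewrite ger0_norm ?cmod_ge0.
Qed.

Lemma Lp_norm_ge0 (p : \bar R) (f : torus R -> R[i]) : (0 <= Lp_norm p f)%E.
Proof. exact: Lnorm_ge0. Qed.

Lemma Rintegral_le_Lp (p : \bar R) (f : torus R -> R[i]) : (1 <= p)%E -> Lp p f ->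
  \int[P]_w cmod (f w) <= fine (Lp_norm p f).
Proof.
move=> p1 Lf; have [_ _ fin] := Lf; have If := Lp_Cintegrable p1 Lf.
rewrite -lee_fin EFin_Rintegral; last exact: integrable_cmod.
rewrite fineK; first exact: (L1_le_Lp (Lp_Cmeasurable Lf) p1).
by rewrite ge0_fin_numE// Lp_norm_ge0.
Qed.

Lemma l2_norm_partial (z : nat -> R[i]) N : (l2_norm z < +oo)%E ->
  \sum_(j < N) cmod (z j) ^+ 2 <= fine (l2_norm z) ^+ 2.
Proof.
rewrite /l2_norm; set S := (\sum_(0 <= j <oo) _)%E => fin.
have S0 : (0 <= S)%E by apply: nneseries_ge0 => j _ _; rewrite lee_fin sqr_ge0.
have Sfin : (S < +oo)%E by apply: lty_poweRy fin; rewrite invr_neq0.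
have Sf : S = (fine S)%:E by rewrite fineK// ge0_fin_numE.
rewrite {1}Sf poweR_EFin /= powR12_sqrt ?fine_ge0// sqr_sqrtr ?fine_ge0//.
rewrite -lee_fin -Sf -sumEFin -(big_mkord xpredT (fun j => (cmod (z j) ^+ 2)%:E)).
by apply: nneseries_lim_ge => j _ _; rewrite lee_fin sqr_ge0.
Qed.

Lemma l2_norm_fin (z : nat -> R[i]) (B : R) : 0 <= B ->
  (forall N, \sum_(j < N) cmod (z j) ^+ 2 <= B) -> (l2_norm z < +oo)%E.
Proof.
move=> B0 zB; apply: poweR_lty; apply: le_lt_trans (ltry B).
apply: lime_le; first by apply: is_cvg_nneseries => j _ _; rewrite lee_fin sqr_ge0.
by apply: nearW => N; rewrite big_mkord sumEFin lee_fin.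
Qed.

(** A set J with fewer than n elements cannot cover S, so the supremum outside J still sees a point
    of S. *)
Lemma decr_rearr_ge (z : nat -> R[i]) (S : {fset nat}) (c : R) n : (n <= #|` S|)%N ->
  (forall j, j \in S -> c <= cmod (z j)) -> (c%:E <= decr_rearr z n)%E.
Proof.
move=> nS cS; apply: le_ereal_inf_tmp => _ [J Jn <-].
have [j jS jJ] : exists2 j, j \in S & j \notin J.
  apply: contrapT => h; move: Jn => /=; rewrite ltnNge => /negP; apply.
  apply: leq_trans nS _; apply: fsubset_leq_card; apply/fsubsetP => j jS.
  by apply: contrapT => jJ; apply: h; exists j => //; exact/negP.
apply: le_trans (_ : (cmod (z j))%:E <= _)%E; first by rewrite lee_fin cS.
by apply: ereal_sup_ubound; exists j.
Qed.

(* Raised to the power 2 m, the bound z_r^* r^((m - 1) / (2 m)) <= B becomes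
   polynomial, which also covers m = 1. *)
Lemma weak_norm_bound m (z : nat -> R[i]) (B : R) N (S : {set 'I_N}) : (0 < m)%N ->
  (weak_norm (weak_exponent R m) z <= B%:E)%E -> S != finset.set0 ->
  exists2 i, i \in S & (cmod (z i) ^+ 2) ^+ m * #|S|%:R ^+ m.-1 <= (B ^+ 2) ^+ m.
Proof.
move=> m0 wB /set0Pn[i0 i0S].
have [i iS imin] := @arg_minP _ _ _ i0 (fun i => i \in S) (fun i : 'I_N => cmod (z i)) i0S.
exists i => //; rewrite -!exprM.
have [m1|m1] := eqVneq m 1%N.
  move: wB; rewrite m1 /weak_exponent eqxx /= expr0 mulr1 muln1 => wB.
  rewrite lerXn2r ?nnegrE ?cmod_ge0//.
    by apply: le_trans (cmod_ge0 (z i)) _; rewrite -lee_fin; apply: le_trans wB;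
      apply: ereal_sup_ubound; exists i.
  by rewrite -lee_fin; apply: le_trans wB; apply: ereal_sup_ubound; exists i.
move: wB; rewrite /weak_exponent (negbTE m1) /= => wB.
set r := #|S|; have r0 : (0 < r)%N by apply/card_gt0P; exists i.
pose T : {fset nat} := seq_fset tt [seq val j | j <- enum S].
have Tr : #|` T| = r.
  rewrite size_seq_fset undup_id; last first.
    by rewrite map_inj_uniq ?enum_uniq//; exact: ord_inj.
  by rewrite size_map -cardE.
have ir : ((cmod (z i))%:E <= decr_rearr z r)%E.
  apply: (@decr_rearr_ge z T); first by rewrite Tr.
  move=> j; rewrite seq_fsetE => /mapP[k]; rewrite mem_enum => kS ->; exact: imin.
have q0 : (0 : R) <= r%:R `^ ((2 * m)%:R / (m - 1)%:R)^-1 by exact: powR_ge0.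
have : ((cmod (z i))%:E * (r%:R `^ ((2 * m)%:R / (m - 1)%:R)^-1)%:E <= B%:E)%E.
  apply: le_trans wB; apply: le_trans (_ : decr_rearr z r * _ <= _)%E.
    by apply: lee_wpmul2r ir; rewrite lee_fin.
  by apply: ereal_sup_ubound; exists r.
rewrite -EFinM lee_fin => h.
have c0 : 0 <= cmod (z i) * r%:R `^ ((2 * m)%:R / (m - 1)%:R)^-1.
  by rewrite mulr_ge0 ?cmod_ge0.
have B0 : 0 <= B by exact: le_trans h.
have m10 : (m - 1)%:R != 0 :> R by rewrite pnatr_eq0 subn_eq0 -ltnNge ltn_neqAle eq_sym m1.
have E : (r%:R `^ ((2 * m)%:R / (m - 1)%:R)^-1) ^+ (2 * m) = r%:R ^+ m.-1 :> R.
  rewrite -powR_mulrn ?powR_ge0// -powRrM invf_div divfK.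
    by rewrite subn1 powR_mulrn.
  by rewrite pnatr_eq0 muln_eq0 -lt0n m0.
by have := lerXn2r (2 * m)%N c0 B0 h; rewrite exprMn E.
Qed.

End hardy_norms.

(** * Upper bounds for the full coefficient sums *)

Section upper_bounds.
Context {R : realType}.
Local Notation P := (torus_measure R).

Definition coeff_const : R := 256 * expR 1.

Lemma coeff_const_gt0 : 0 < coeff_const.
Proof. by rewrite mulr_gt0// expR_gt0. Qed.

Lemma hardy_hom_coeff0 m (p : \bar R) (f : torus R -> R[i]) z a : hardy_hom m p f ->
  cmod (fourier_coeff f a * monomial z a) != 0 -> degree a = m%:Z.
Proof.
move=> [_ fm]; rewrite cmodM mulf_eq0 negb_or cmod_eq0 => /andP[fa _].
exact: fm.
Qed.

Lemma esum_coeff_le_l2 m (p : \bar R) (f : torus R -> R[i]) (z : nat -> R[i])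
    (I : set multi_index) : (0 < m)%N -> (1 <= p)%E -> hardy_hom m p f ->
  (l2_norm z < +oo)%E -> I `<=` nonneg_indices ->
  (\esum_(a in I) (cmod (fourier_coeff f a * monomial z a))%:E <=
   (coeff_const ^+ m)%:E * l2_norm z ^+ m * Lp_norm p f)%E.
Proof.
move=> m0 p1 fm zfin I0; have [[Lf f0] fh] := fm.
have [_ _ ffin] := Lf.
have z0 : (0 <= l2_norm z)%E by exact: poweR_ge0.
have zE : l2_norm z = (fine (l2_norm z))%:E by rewrite fineK// ge0_fin_numE.
have fE : Lp_norm p f = (fine (Lp_norm p f))%:E.
  by rewrite fineK// ge0_fin_numE// Lp_norm_ge0.
rewrite zE fE -EFin_expe -!EFinM.
apply: (@esum_multi_index_le _ _ _ _ m) => //.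
- by move=> a; exact: cmod_ge0.
- by move=> a; exact: hardy_hom_coeff0 fm.
- move=> N s us sm.
  apply: le_trans (sum_fourier_coeff_l2 m0 (Lp_Cintegrable p1 Lf) f0 fh us sm
    (fine_ge0 z0) (l2_norm_partial N zfin)) _.
  rewrite ler_wpM2l ?mulr_ge0 ?exprn_ge0 ?fine_ge0 ?expR_ge0 ?(ltW coeff_const_gt0)//.
  exact: Rintegral_le_Lp.
Qed.

Lemma weak_norm_ge0 (q : \bar R) (z : nat -> R[i]) : (0 <= weak_norm q z)%E.
Proof.
have Z (J : set nat) : J !=set0 ->
    (0 <= ereal_sup [set (cmod (z j))%:E | j in J])%E.
  move=> [j Jj]; apply: le_trans (_ : (cmod (z j))%:E <= _)%E.
    by rewrite lee_fin cmod_ge0.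
  by apply: ereal_sup_ubound; exists j.
case: q => [r| |]; last 2 first.
- by apply: Z; exists 0%N.
- by apply: Z; exists 0%N.
rewrite /=; apply: le_trans (_ : decr_rearr z 1 * (1%:R `^ r^-1)%:E <= _)%E.
  apply: mule_ge0; last by rewrite lee_fin powR_ge0.
  by apply: (@decr_rearr_ge _ z [fset 0%N]%fset) => [|j _]; rewrite ?cardfs1// cmod_ge0.
by apply: ereal_sup_ubound; exists 1%N.
Qed.

Lemma esum_coeff_le_weak m (f : torus R -> R[i]) (z : nat -> R[i])
    (I : set multi_index) : (0 < m)%N -> hardy_hom m +oo%E f ->
  (weak_norm (weak_exponent R m) z < +oo)%E -> I `<=` nonneg_indices ->
  (\esum_(a in I) (cmod (fourier_coeff f a * monomial z a))%:E <=
   (coeff_const ^+ m)%:E * weak_norm (weak_exponent R m) z ^+ m * Lp_norm +oo f)%E.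
Proof.
move=> m0 fm zfin I0; have [[Lf f0] fh] := fm.
have [_ _ ffin] := Lf; have p1 : (1 <= +oo :> \bar R)%E by exact: leey.
have z0 := weak_norm_ge0 (weak_exponent R m) z.
have zE : weak_norm (weak_exponent R m) z = (fine (weak_norm (weak_exponent R m) z))%:E.
  by rewrite fineK// ge0_fin_numE.
have fE : Lp_norm +oo f = (fine (Lp_norm +oo f))%:E.
  by rewrite fineK// ge0_fin_numE// Lp_norm_ge0.
rewrite zE fE -EFin_expe -!EFinM.
set W := fine (weak_norm _ _); set M := fine (Lp_norm _ _).
have M0 : 0 <= M by rewrite fine_ge0// Lp_norm_ge0.
have W0 : 0 <= W by rewrite fine_ge0.
apply: (@esum_multi_index_le _ _ _ _ m) => //.
- by move=> a; exact: cmod_ge0.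
- by move=> a; exact: hardy_hom_coeff0 fm.
- move=> N s us sm; set S := \sum_(a <- s) _.
  have bound B : 0 < B -> W <= B -> S <= coeff_const ^+ m * B ^+ m * M.
    move=> B0 WB.
    apply: (sum_fourier_coeff_weak m0 (Lp_Cintegrable p1 Lf) f0 fh us sm B0) => //.
      move=> T Tne; apply: weak_norm_bound => //.
      by rewrite zE lee_fin.
    exact: Lp_norm_ae.
  (* [bound] needs B > 0. For W = 0 and S > 0, a small B = e gives S <= K e^m <= K e < S. *)
  have [W00|Wn0] := eqVneq W 0; last by apply: bound => //; rewrite lt_def Wn0.
  rewrite W00 expr0n (gtn_eqF m0) mulr0 mul0r leNgt; apply/negP => S0.
  pose K := coeff_const ^+ m * M.
  have K0 : 0 <= K by rewrite mulr_ge0// exprn_ge0// ltW// coeff_const_gt0.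
  pose e := Num.min 1 (S / (2 * (K + 1))).
  have K1 : 0 < 2 * (K + 1) by rewrite mulr_gt0// ltr_wpDl.
  have e0 : 0 < e by rewrite lt_min ltr01 divr_gt0.
  have e1 : e <= 1 by rewrite ge_min lexx.
  have eS : e * (2 * (K + 1)) <= S by rewrite -ler_pdivlMr// ge_min lexx orbT.
  have em : e ^+ m <= e by rewrite -[leRHS]expr1 ler_wiXn2l// ltW.
  have := bound e e0; rewrite W00 => /(_ (ltW e0)).
  have -> : coeff_const ^+ m * e ^+ m * M = K * e ^+ m by rewrite /K mulrAC.
  have : K * e ^+ m <= K * e by rewrite ler_wpM2l.
  by nra.
Qed.

End upper_bounds.

(** * Uniform boundedness on mon *)

Section gliding_hump.
Context {R : realType}.
Variables (I : eqType) (T : Type) (h0 : T) (Q : I -> Prop) (v : T -> I -> R[i]).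
Hypothesis v1 : forall h a, Q a -> cmod (v h a) <= 1.

Fixpoint hump_sum (h : nat -> T) (e : nat -> bool) (k : nat) (a : I) : R[i] :=
  if k is k'.+1 then hump_sum h e k' a + ((-1) ^+ e k' * 3 ^- k') * v (h k') a else 0.

(** This is where membership in mon enters: a signed series of humps with weights 3^-k has a limit
    whose coefficients are absolutely summable. *)
Hypothesis complete : forall h e, exists x : I -> R[i],
  (forall a, Q a -> forall eps : R, 0 < eps -> exists k0, forall k, (k0 <= k)%N ->
    cmod (x a - hump_sum h e k a) <= eps) /\
  exists K : R, forall s : seq I, uniq s -> (forall a, a \in s -> Q a) ->
    \sum_(a <- s) cmod (x a) <= K.

Let q (s : seq I) (y : I -> R[i]) : R := \sum_(a <- s) cmod (y a).

Let qD s y y' : q s (fun a => y a + y' a) <= q s y + q s y'.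
Proof. by rewrite /q -big_split /=; apply: ler_sum => a _; exact: ler_cmodD. Qed.

Let qZ s (c : R[i]) y : q s (fun a => c * y a) = cmod c * q s y.
Proof. by rewrite /q mulr_sumr; apply: eq_bigr => a _; rewrite cmodM. Qed.

Let eventually_close (s : seq I) h e x (eps : R) : 0 < eps ->
  (forall a, a \in s -> Q a) ->
  (forall a, Q a -> forall eps : R, 0 < eps -> exists k0, forall k, (k0 <= k)%N ->
    cmod (x a - hump_sum h e k a) <= eps) ->
  exists k0, forall k, (k0 <= k)%N -> forall a, a \in s ->
    cmod (x a - hump_sum h e k a) <= eps.
Proof.
move=> eps0 sQ cx; elim: s sQ => [|b s ih] sQ; first by exists 0%N.
have [k1 k1P] := cx b (sQ _ (mem_head _ _)) eps eps0.
have [a as_|k2 k2P] := ih; first by apply: sQ; rewrite inE as_ orbT.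
exists (maxn k1 k2) => k; rewrite geq_max => /andP[k1k k2k] a.
by rewrite inE => /predU1P[->|as_]; [exact: k1P|exact: k2P].
Qed.

(** The k-th sign depends on the sum of the earlier humps, so the recursion carries both. It selects
    the larger of the sums over [s k] for y + u and y - u, where u is the new hump. *)
Definition hump_sign (h : nat -> T) (s : nat -> seq I) : nat -> (I -> R[i]) * bool :=
  fix F k :=
    let y := if k is k'.+1 then
      (fun a => (F k').1 a + ((-1) ^+ (F k').2 * 3 ^- k') * v (h k') a) else fun=> 0 in
    (y, q (s k) (fun a => y a + 3 ^- k * v (h k) a) <
        q (s k) (fun a => y a - 3 ^- k * v (h k) a)).

(** Choose [s n] so that the supremum [t n] of the coefficient sums over [s n] exceeds 4^n, and
    [h n] that nearly attains it. The n-th hump contributes at least (3/4) 3^-n t_n on [s n], the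
    later ones change this by at most t_n sum_(k > n) 3^-k = t_n 3^-n / 2. The limit thus has sums
    of at least (4/3)^n / 4, which are unbounded. *)
Lemma uniform_boundedness : exists C : R, forall h (s : seq I), uniq s ->
  (forall a, a \in s -> Q a) -> \sum_(a <- s) cmod (v h a) <= C.
Proof.
apply: contrapT => unbounded.
have big (C : R) : exists s : seq I, [/\ uniq s, forall a, a \in s -> Q a &
    exists h, C < q s (v h)].
  apply: contrapT => nC; apply: unbounded; exists C => h s us sQ.
  rewrite leNgt; apply/negP => Cs; apply: nC; exists s; split => //; by exists h.
have [s sP] := choice (fun n : nat => big (4 ^+ n)).
pose A n := [set r | exists h, r = q (s n) (v h)].
have A_sup n : has_sup (A n).
  split; first by exists (q (s n) (v h0)); exists h0.
  exists (\sum_(a <- s n) 1) => _ [h ->].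
  have [_ sQ _] := sP n; rewrite /q big_seq [leRHS]big_seq.
  by apply: ler_sum => a /sQ; exact: v1.
pose t n := sup (A n).
have t4 n : 4 ^+ n < t n.
  have [_ _ [h hC]] := sP n; apply: lt_le_trans hC _.
  by apply: sup_upper_bound => //; exists h.
have t0 n : 0 < t n by apply: lt_trans (t4 n); rewrite exprn_gt0.
have qt n h : q (s n) (v h) <= t n by apply: sup_upper_bound => //; exists h.
(* Any proportion above the 1/2 lost to the later humps would do. *)
have [h hP] : {h : nat -> T & forall n, 3 / 4 * t n < q (s n) (v (h n))}.
  apply: (@choice _ _ (fun n h => 3 / 4 * t n < q (s n) (v h))) => n.
  have e0 : 0 < 1 / 4 * t n by rewrite mulr_gt0// divr_gt0.
  have [_ [h ->] hlt] := sup_adherent e0 (A_sup n).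
  exists h; apply: le_lt_trans hlt; rewrite -/(t n).
  by rewrite le_eqVlt; apply/orP; left; apply/eqP; field.
pose e k := (hump_sign h s k).2.
have yE k : (hump_sign h s k).1 = hump_sum h e k.
  elim: k => [|k ih] //=; apply/funext => a.
  by rewrite -ih.
have signP k : 3 ^- k * q (s k) (v (h k)) <= q (s k) (hump_sum h e k.+1).
  set y := hump_sum h e k.
  have c3 : cmod (3 ^- k : R[i]) = 3 ^- k.
    by rewrite cmodV cmodX (cmod_natr 3).
  (* The triangle inequality for 2 u = (y + u) - (y - u): one of the two signs gives a sum at least
     that of u. *)
  have two : 2 * (3 ^- k * q (s k) (v (h k))) <=
      q (s k) (fun a => y a + 3 ^- k * v (h k) a) +
      q (s k) (fun a => y a - 3 ^- k * v (h k) a).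
    have -> : 2 * (3 ^- k * q (s k) (v (h k))) =
        q (s k) (fun a => (y a + 3 ^- k * v (h k) a) + - (y a - 3 ^- k * v (h k) a)).
      rewrite -c3 -qZ -(cmod_natr 2) -qZ /q; apply: eq_bigr => a _.
      by congr cmod; ring.
    apply: le_trans (qD _ _ _) _; rewrite lerD2l.
    by rewrite le_eqVlt; apply/orP; left; apply/eqP; apply: eq_bigr => a _; rewrite cmodN.
  have eE : e k = (q (s k) (fun a => y a + 3 ^- k * v (h k) a) <
                   q (s k) (fun a => y a - 3 ^- k * v (h k) a)).
    rewrite /y -yE /e; by case: (k).
  have -> : q (s k) (hump_sum h e k.+1) =
      q (s k) (fun a => y a + (-1) ^+ e k * 3 ^- k * v (h k) a) by [].
  move: eE; case: ltP => lt ->.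
    have -> : q (s k) (fun a => y a + (-1) ^+ true * 3 ^- k * v (h k) a) =
        q (s k) (fun a => y a - 3 ^- k * v (h k) a).
      by apply: eq_bigr => a _; rewrite expr1 mulN1r mulNr.
    by lra.
  have -> : q (s k) (fun a => y a + (-1) ^+ false * 3 ^- k * v (h k) a) =
      q (s k) (fun a => y a + 3 ^- k * v (h k) a).
    by apply: eq_bigr => a _; rewrite expr0 mul1r.
  by lra.
(* after the step k = n the later humps change q (s n) by at most half of it *)
have tail n j : 3 ^- n * q (s n) (v (h n)) - t n * (3 ^- n / 2 * (1 - 3 ^- j)) <=
    q (s n) (hump_sum h e (n.+1 + j)).
  elim: j => [|j ih].
    by rewrite expr0 invr1 subrr !mulr0 subr0 addn0; exact: signP.
  rewrite addnS; set k := (n.+1 + j)%N in ih *.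
  have := qD (s n) (hump_sum h e k.+1) (fun a => - ((-1) ^+ e k * 3 ^- k * v (h k) a)).
  have -> : q (s n) (fun a => hump_sum h e k.+1 a - (-1) ^+ e k * 3 ^- k * v (h k) a) =
      q (s n) (hump_sum h e k).
    by apply: eq_bigr => a _; rewrite /= addrK.
  have -> : q (s n) (fun a => - ((-1) ^+ e k * 3 ^- k * v (h k) a)) =
      3 ^- k * q (s n) (v (h k)).
    rewrite /q mulr_sumr; apply: eq_bigr => a _; rewrite cmodN !cmodM.
    rewrite cmodX cmodN cmod1 expr1n mul1r cmodV cmodX (cmod_natr 3).
    by [].
  have : 3 ^- k * q (s n) (v (h k)) <= 3 ^- k * t n.
    by rewrite ler_wpM2l// invr_ge0 exprn_ge0.
  have -> : 3 ^- k * t n = t n * (3 ^- n / 2 * (1 - 3 ^- j.+1)) -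
      t n * (3 ^- n / 2 * (1 - 3 ^- j)) :> R.
    rewrite /k addSn !exprS exprD; field.
    by rewrite !expf_neq0.
  by lra.
have [x [cx [K xK]]] := complete h e.
(* With eps = 1 / (1 + size of s n), replacing a late partial sum by its limit x costs at most 1. *)
have large n : 3 ^- n * t n / 4 <= K + 1.
  have [us sQ _] := sP n.
  pose eps : R := (1 + \sum_(a <- s n) 1)^-1.
  have sz : 0 <= \sum_(a <- s n) (1 : R) by apply: sumr_ge0.
  have eps0 : 0 < eps by rewrite invr_gt0 ltr_pwDl.
  have [k0 k0P] := eventually_close eps0 sQ cx.
  have kk : (k0 <= n.+1 + k0)%N by rewrite leq_addl.
  have := tail n k0; have := hP n; have := xK _ us sQ; rewrite -/(q (s n) x).
  have close : q (s n) (hump_sum h e (n.+1 + k0)) <= q (s n) x + 1.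
    apply: (@le_trans _ _ (q (s n) x +
        q (s n) (fun a => - (x a - hump_sum h e (n.+1 + k0) a)))).
      apply: le_trans (qD _ _ _); rewrite le_eqVlt; apply/orP; left; apply/eqP.
      by apply: eq_bigr => a _; congr cmod; ring.
    rewrite lerD2l; apply: (@le_trans _ _ (\sum_(a <- s n) 1 * eps)).
      rewrite /q big_seq [leRHS]big_seq; apply: ler_sum => a as_.
      by rewrite cmodN mul1r; exact: k0P.
    rewrite -mulr_suml /eps ler_pdivrMr ?ltr_pwDl// mul1r.
    by rewrite lerDr.
  have P3 : 0 < 3 ^- n :> R by rewrite invr_gt0 exprn_gt0.
  have P3' : 0 <= 3 ^- k0 :> R by rewrite invr_ge0 exprn_ge0.
  have g1 : 3 ^- n * (3 / 4 * t n) <= 3 ^- n * q (s n) (v (h n)).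
    by rewrite ler_pM2l// ltW.
  have g2 : t n * (3 ^- n / 2 * (1 - 3 ^- k0)) <= t n * (3 ^- n / 2).
    rewrite ler_pM2l//; apply: ler_piMr; first by rewrite divr_ge0// ltW.
    by rewrite gerBl.
  have E : 3 ^- n * t n / 4 = 3 ^- n * (3 / 4 * t n) - t n * (3 ^- n / 2).
    have E' (u w : R) : u * w / 4 = u * (3 / 4 * w) - w * (u / 2) by field.
    exact: E'.
  by move=> *; rewrite E; lra.
have K0 : 0 <= K by have := xK [::] isT; rewrite big_nil; apply.
have y1 : 1 < 4 / 3 :> R by lra.
have c0 : 0 <= 4 * (K + 1) by rewrite mulr_ge0// addr_ge0.
have [n] := geometric_beats_polynomial 1 y1 c0.
rewrite expr1 ltNge => /negP; apply.
have : (4 / 3) ^+ n <= 4 * (K + 1).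
  have := large n; have := t4 n; rewrite expr_div_n.
  have P3 : 0 < 3 ^- n :> R by rewrite invr_gt0 exprn_gt0.
  move=> t4n; have : 3 ^- n * 4 ^+ n <= 3 ^- n * t n by rewrite ler_pM2l// ltW.
  by rewrite (mulrC (4 ^+ n)); lra.
case: n => [|n]; first by rewrite expr0 mulr0 add0r.
move=> h1; apply: le_trans h1 _.
rewrite -[leLHS]addr0; apply: lerD => //.
by rewrite ler_peMr// ler1n.
Qed.

End gliding_hump.

(** * Limits of geometrically dominated series *)

Section dominated_series.
Context {R : realType}.
Local Notation P := (torus_measure R).

Lemma geometric_partial_sum_le (u : nat -> R) (c : R) :
  (forall k, u k <= (2 / 3) ^+ k * c) -> 0 <= c ->
  forall n, \sum_(k < n) u k <= 3 * c.
Proof.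
move=> uc c0 n.
apply: (@le_trans _ _ (\sum_(k < n) (2 / 3) ^+ k * c)); first exact: ler_sum.
rewrite -mulr_suml ler_wpM2r//.
suff -> : \sum_(k < n) (2 / 3 : R) ^+ k = 3 * (1 - (2 / 3) ^+ n).
  have : 0 <= (2 / 3 : R) ^+ n by rewrite exprn_ge0//; lra.
  lra.
elim: n => [|n ih]; first by rewrite big_ord0 expr0 subrr mulr0.
by rewrite big_ord_recr /= ih exprS; lra.
Qed.

Lemma geometric_series_bounded_cvg (u : nat -> R) (c : R) :
  (forall k, `|u k| <= (2 / 3) ^+ k * c) ->
  exists l, (fun n => \sum_(k < n) u k) @ \oo --> l /\ `|l| <= 3 * c.
Proof.
move=> uc; have c0 : 0 <= c.
  by have := uc 0%N; rewrite expr0 mul1r; apply: le_trans.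
have c23 : `|2 / 3 : R| < 1 by rewrite ger0_norm; lra.
have cvg_u : cvgn (series u).
  apply: normed_cvg; apply: (@series_le_cvg _ _ (geometric c (2 / 3))).
  - by move=> n; exact: normr_ge0.
  - by move=> n; rewrite /= mulr_ge0// exprn_ge0//; lra.
  - by move=> n; rewrite /= mulrC; exact: uc.
  - exact: is_cvg_geometric_series.
have E : (fun n => \sum_(k < n) u k) = series u.
  by apply/funext => n; rewrite /series /= big_mkord.
exists (limn (series u)); split; first by rewrite E.
have bound n : `|series u n| <= 3 * c.
  rewrite /series /= big_mkord; apply: le_trans (ler_norm_sum _ _ _) _.
  exact: geometric_partial_sum_le uc c0 n.
have cn : (fun n => `|series u n|) @ \oo --> `|limn (series u)|.
  exact: cvg_norm.
rewrite -(cvg_lim _ cn)//; apply: limr_le; first exact: cvgP cn.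
exact: nearW.
Qed.

Lemma Rintegral_dominated_cvg (u : nat -> torus R -> R) (l G : torus R -> R) :
  (forall k, measurable_fun [set: torus R] (u k)) ->
  (forall w, (fun k => u k w) @ \oo --> l w) ->
  (forall k w, `|u k w| <= G w) -> P.-integrable setT (EFin \o G) ->
  (fun k => \int[P]_w u k w) @ \oo --> \int[P]_w l w.
Proof.
move=> mu ul uG IG.
have ml : measurable_fun [set: torus R] l.
  by apply: (measurable_fun_cvg (h := u)) => // w _; exact: ul.
have [|||||Il _ h] := @dominated_convergence _ _ _ P setT measurableT
  (fun k w => (u k w)%:E) (fun w => (l w)%:E) (EFin \o G).
- by move=> k; exact/measurable_EFinP.
- exact/measurable_EFinP.
- by apply: aeW => w _; apply: cvg_EFin; [exact: nearW|exact: ul].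
- exact: IG.
- by apply: aeW => w k _ /=; rewrite lee_fin.
by move: h; rewrite -EFin_Rintegral// => /fine_cvg.
Qed.

(** The ratio 2/3 is the weight 3^-k of a hump times the growth 2^k that the majorant allows. Real
    and imaginary parts are each bounded by 3 D, hence the 6. *)
Lemma dominated_series_limit (g : nat -> torus R -> R[i]) (D : torus R -> R) :
  (forall k, Cmeasurable (g k)) ->
  (forall k w, cmod (g k w) <= (2 / 3) ^+ k * D w) ->
  P.-integrable setT (EFin \o D) ->
  exists x : torus R -> R[i], [/\ Cmeasurable x, forall w, cmod (x w) <= 6 * D w &
    forall a (eps : R), 0 < eps -> exists k0, forall k, (k0 <= k)%N ->
      cmod (fourier_coeff x a - \sum_(i < k) fourier_coeff (g i) a) <= eps].
Proof.
move=> mg gD ID.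
have re w := @geometric_series_bounded_cvg (fun k => complex.Re (g k w)) (D w)
  (fun k => le_trans (ler_Re_cmod _) (gD k w)).
have im w := @geometric_series_bounded_cvg (fun k => complex.Im (g k w)) (D w)
  (fun k => le_trans (ler_Im_cmod _) (gD k w)).
have [xr xrP] := choice re; have [xi xiP] := choice im.
pose x (w : torus R) : R[i] := (xr w : R) +i* (xi w : R).
pose X k (w : torus R) : R[i] := \sum_(i < k) g i w.
have ReX k w : complex.Re (X k w) = \sum_(i < k) complex.Re (g i w).
  by rewrite /X; elim/big_rec2 : _ => // i s t _ <-; rewrite ReD.
have ImX k w : complex.Im (X k w) = \sum_(i < k) complex.Im (g i w).
  by rewrite /X; elim/big_rec2 : _ => // i s t _ <-; rewrite ImD.
have cR w : (fun k => complex.Re (X k w)) @ \oo --> xr w.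
  by under eq_fun do rewrite ReX; exact: (xrP w).1.
have cI w : (fun k => complex.Im (X k w)) @ \oo --> xi w.
  by under eq_fun do rewrite ImX; exact: (xiP w).1.
have mX k : Cmeasurable (X k).
  rewrite /X; elim: k => [|k ih].
    by rewrite (_ : (fun _ => _) = fun=> 0); [exact: Cmeasurable_cst|
      apply/funext => w; rewrite big_ord0].
  rewrite (_ : (fun _ => _) = fun w => (\sum_(i < k) g i w) + g k w).
    exact: CmeasurableD.
  by apply/funext => w; rewrite big_ord_recr.
have bX k w : cmod (X k w) <= 6 * D w.
  apply: le_trans (ler_cmod_sum _ _ _) _.
  have D0 : 0 <= D w by have := gD 0%N w; rewrite mul1r; apply: le_trans; exact: cmod_ge0.
  apply: le_trans (geometric_partial_sum_le (fun i => gD i w) D0 k) _.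
  by rewrite ler_wpM2r// ler_nat.
exists x; split.
- split.
    by apply: (measurable_fun_cvg (h := fun k w => complex.Re (X k w))) => [k|w _];
      [exact: (mX k).1|exact: cR].
  by apply: (measurable_fun_cvg (h := fun k w => complex.Im (X k w))) => [k|w _];
      [exact: (mX k).2|exact: cI].
- move=> w; apply: le_trans (ler_cmod_ReIm _) _ => /=.
  by have := (xrP w).2; have := (xiP w).2; lra.
move=> a eps eps0.
pose u (w : torus R) : R[i] := (monomial (torus_coords w) a)^-1.
have bu := @Cbounded_monomialV R a.
have I6 : P.-integrable setT (EFin \o (fun w => 6 * D w)).
  exact: (integrableZl measurableT 6 ID).
have bXu k w : cmod (X k w * u w) <= 6 * D w.
  by rewrite cmodM cmodV cmod_monomial_torus invr1 mulr1.
have mXu k : Cmeasurable (fun w => X k w * u w) by apply: CmeasurableM (mX k) bu.1.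
have K1 : (fun k => \int[P]_w complex.Re (X k w * u w)) @ \oo -->
    \int[P]_w complex.Re (x w * u w).
  apply: (@Rintegral_dominated_cvg _ _ (fun w => 6 * D w)) => //.
  - by move=> k; exact: (mXu k).1.
  - move=> w; rewrite ReM; under eq_fun do rewrite ReM.
    by apply: cvgB; apply: cvgMl.
  - by move=> k w; apply: le_trans (ler_Re_cmod _) (bXu k w).
have K2 : (fun k => \int[P]_w complex.Im (X k w * u w)) @ \oo -->
    \int[P]_w complex.Im (x w * u w).
  apply: (@Rintegral_dominated_cvg _ _ (fun w => 6 * D w)) => //.
  - by move=> k; exact: (mXu k).2.
  - move=> w; rewrite ImM; under eq_fun do rewrite ImM.
    by apply: cvgD; apply: cvgMl.
  - by move=> k w; apply: le_trans (ler_Im_cmod _) (bXu k w).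
have Ig i : Cintegrable (g i).
  apply: cmod_integrable => //.
  have : P.-integrable setT (EFin \o (fun w => (2 / 3) ^+ i * D w)).
    exact: (integrableZl measurableT ((2 / 3) ^+ i) ID).
  apply: le_integrable => //; first by apply/measurable_EFinP; exact: measurable_cmod.
  by move=> w _ /=; rewrite lee_fin ger0_norm ?cmod_ge0// (le_trans (gD i w))// ler_norm.
have FX k : fourier_coeff (X k) a = \sum_(i < k) fourier_coeff (g i) a.
  rewrite -(proj1 (Cintegral_sum (index_enum 'I_k) _)).
    by apply: eq_Cintegral => w; rewrite /X mulr_suml.
  by move=> i; exact: CintegrableM (Ig i) bu.
have e2 : 0 < eps / 2 by rewrite divr_gt0.
move/cvgrPdist_le/(_ _ e2) : K1 => [k1 _ k1P].
move/cvgrPdist_le/(_ _ e2) : K2 => [k2 _ k2P].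
exists (maxn k1 k2) => k; rewrite geq_max => /andP[k1k k2k]; rewrite -FX.
apply: le_trans (ler_cmod_ReIm _) _; rewrite ReD ImD.
have ReN (t : R[i]) : complex.Re (- t) = - complex.Re t by case: t.
have ImN (t : R[i]) : complex.Im (- t) = - complex.Im t by case: t.
rewrite ReN ImN (splitr eps); apply: lerD.
  exact: k1P.
exact: k2P.
Qed.

End dominated_series.

(** * Hump series of Hardy functions *)

Section hardy_limits.
Context {R : realType}.
Local Notation P := (torus_measure R).

Lemma Lp_norm_le (p : \bar R) (f g : torus R -> R[i]) : (1 <= p)%E ->
  Cmeasurable f -> Cmeasurable g -> (forall w, cmod (f w) <= cmod (g w)) ->
  (Lp_norm p f <= Lp_norm p g)%E.
Proof.
move=> p1 mf mg fg.
have P0 : (0 < P [set: torus R])%E by rewrite torus_measure_setT.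
have mc (h : torus R -> R[i]) r : Cmeasurable h ->
    measurable_fun setT (fun w => (`|(EFin \o (@cmod R \o h)) w| `^ r)%E).
  move=> mh; apply: (@measurableT_comp _ _ _ _ _ _ (fun x : \bar R => x `^ r)%E).
    exact: measurable_poweR.
  apply: measurableT_comp => //; apply/measurable_EFinP; exact: measurable_cmod.
rewrite /Lp_norm unlock /Lnorm; case: p p1 => [r r1| _|//].
- have r0 : 0 < r by rewrite lee_fin in r1; exact: lt_le_trans r1.
  apply: gt0_ler_poweR; rewrite ?in_itv/= ?andbT ?leey ?integral_ge0//.
  + by rewrite invr_ge0 ltW.
  apply: ge0_le_integral => //.
  + exact: mc.
  + exact: mc.
  + by move=> w _; rewrite lee_fin ge0_ler_powR ?nnegrE ?(ltW r0)// !ger0_norm ?cmod_ge0.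
- rewrite !ifT//; apply: le_ess_sup; apply: nearW => w /=.
  by rewrite lee_fin !ger0_norm ?cmod_ge0.
Qed.

(** Vanishing Fourier coefficients pass to the limit, and the norm of the limit is finite because 6
    D dominates it. *)
Lemma hardy_hom_limit m (p : \bar R) (g : nat -> torus R -> R[i]) (D : torus R -> R) :
  (1 <= p)%E -> (forall k, Cmeasurable (g k)) ->
  (forall k w, cmod (g k w) <= (2 / 3) ^+ k * D w) ->
  P.-integrable setT (EFin \o D) -> (Lp_norm p (fun w => (6 * D w)%:C) < +oo)%E ->
  (forall k a, fourier_coeff (g k) a != 0 -> nonneg_indices a /\ degree a = m%:Z) ->
  exists2 x, hardy_hom m p x & forall a (eps : R), 0 < eps ->
    exists k0, forall k, (k0 <= k)%N ->
      cmod (fourier_coeff x a - \sum_(i < k) fourier_coeff (g i) a) <= eps.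
Proof.
move=> p1 mg gD ID Dp ga.
have [x [mx xD xa]] := dominated_series_limit mg gD ID; exists x => //.
have x0 a : (forall k, fourier_coeff (g k) a = 0) -> fourier_coeff x a = 0.
  move=> g0; apply/eqP; rewrite -cmod_eq0 eq_le cmod_ge0 andbT.
  apply/ler_addgt0Pr => eps eps0; rewrite add0r.
  have [k0 /(_ k0 (leqnn _))] := xa a eps eps0.
  by rewrite big1 ?subr0.
split; first split.
- split; [exact: mx.1|exact: mx.2|].
  apply: le_lt_trans Dp; apply: Lp_norm_le => //.
    split; last exact: measurable_cst.
    apply/measurable_EFinP; apply: measurable_int.
    exact: (integrableZl measurableT 6 ID).
  by move=> w; rewrite cmod_realC; apply: le_trans (xD w) (ler_norm _).
- move=> a na; apply: x0 => k; apply/eqP; apply: contraT => /ga[a0 _].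
  by case: na.
- move=> a xa0; apply: contrapT => am; case/eqP: xa0; apply: x0 => k.
  by apply/eqP; apply: contraT => /ga[_].
Qed.

(** Polynomials in any number of variables; [ball] will be the unit ball for the supremum norm if p
    = oo and for the L_2 norm if p < oo. *)
Definition normalized m (ball : forall N, mpoly N R[i] -> Prop) :=
  {h : {N : nat & mpoly N R[i]} | homogeneous m (projT2 h) /\ ball _ (projT2 h)}.

Definition normalized_fun m ball (h : normalized m ball) : torus R -> R[i] :=
  torus_eval (projT2 (sval h)).

(** Instance of [uniform_boundedness] with the terms of the monomial series as coordinates. The
    humps may be replaced by functions g_k with the same Fourier coefficients, so that the majorant
    can hold at every point. *)
Lemma mon_uniform_bound m (p : \bar R) (ball : forall N, mpoly N R[i] -> Prop)
    (z : nat -> R[i]) : (1 <= p)%E -> mon_hardy_hom m p z ->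
  (forall N (q : mpoly N R[i]) a, homogeneous m q -> ball N q ->
    cmod (fourier_coeff (torus_eval q) a) <= 1) ->
  (forall h : nat -> normalized m ball, exists (g : nat -> torus R -> R[i]) (D : torus R -> R),
    [/\ forall k, Cmeasurable (g k), forall k w, cmod (g k w) <= 2 ^+ k * D w,
      P.-integrable setT (EFin \o D), (Lp_norm p (fun w => (6 * D w)%:C) < +oo)%E &
      forall k a, fourier_coeff (g k) a = fourier_coeff (normalized_fun (h k)) a]) ->
  exists C : R, forall N (q : mpoly N R[i]) (s : seq (multinom N)), uniq s ->
    homogeneous m q -> ball N q ->
    \sum_(a <- s) cmod (mcoeff a q * monomial z (mnm_index a)) <= C.
Proof.
move=> p1 [z1 zmon] ball1 ballh.
have zle j : cmod (z j) <= 1.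
  rewrite -lee_fin; apply: le_trans (ltW z1).
  by apply: ereal_sup_ubound; exists j.
have mle a : nonneg_indices a -> cmod (monomial z a) <= 1.
  move=> a0; rewrite cmod_monomial; apply: prodr_ile1 => j _.
  move: (a0 j); case: (a j) => // n _.
  by rewrite exprn_ge0 ?cmod_ge0//= exprn_ile1// cmod_ge0.
(* [uniform_boundedness] needs one hump to start from; without any, the bound is vacuous. *)
have [[h0]|nh] := pselect (inhabited (normalized m ball)); last first.
  exists 0 => N q s us hq bq; case: nh; constructor.
  by exists (existT _ N q); split.
have [||C CP] := @uniform_boundedness R multi_index _ h0 (fun a => nonneg_indices a)
  (fun h a => fourier_coeff (normalized_fun h) a * monomial z a).
- move=> [[N q] [/= hq bq]] a a0; rewrite cmodM mulr_ile1 ?cmod_ge0 ?mle//.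
  exact: ball1.
- move=> h e; have [g [D [mg gD ID Dp gh]]] := ballh h.
  pose c k : R[i] := (-1) ^+ e k * 3 ^- k.
  have cE k : cmod (c k) = 3 ^- k.
    by rewrite cmodM cmodX cmodN cmod1 expr1n mul1r cmodV cmodX (cmod_natr 3).
  have Ig k : Cintegrable (g k).
    apply: cmod_integrable => //.
    have : P.-integrable setT (EFin \o (fun w => 2 ^+ k * D w)).
      exact: (integrableZl measurableT (2 ^+ k) ID).
    apply: le_integrable => //; first by apply/measurable_EFinP; exact: measurable_cmod.
    by move=> w _ /=; rewrite lee_fin ger0_norm ?cmod_ge0// (le_trans (gD k w))// ler_norm.
  have Fc k a : fourier_coeff (fun w => c k * g k w) a = c k * fourier_coeff (g k) a.
    rewrite /fourier_coeff -CintegralZ; first by apply: eq_Cintegral => w; rewrite mulrA.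
    by apply: CintegrableM => //; exact: Cbounded_monomialV.
  have [||x xm xa] := @hardy_hom_limit m p (fun k w => c k * g k w) D p1
    (fun k => CmeasurableM (Cmeasurable_cst _) (mg k)) _ ID Dp.
  + move=> k w; rewrite cmodM cE expr_div_n mulrAC [leRHS]mulrC.
    by rewrite ler_pM2l// invr_gt0 exprn_gt0.
  + move=> k a; rewrite Fc gh mulf_eq0 negb_or => /andP[_].
    case: (h k) => -[N q] [/= hq bq]; rewrite /normalized_fun /= => qa.
    have [b bq' ba] : exists2 b, b \in msupp q & mnm_index b = a.
      apply: contrapT => nb; case/eqP: qa; apply: fourier_coeff_torus_eval0 => b bq'.
      by apply/negP => /eqP ba; apply: nb; exists b.
    by rewrite -ba degree_mnm (hq b bq'); split => //; exact: mnm_index_nonneg.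
  + exists (fun a => fourier_coeff x a * monomial z a); split.
      move=> a a0 eps eps0; have [k0 k0P] := xa a eps eps0; exists k0 => k k0k.
      have -> : hump_sum (fun h a => fourier_coeff (normalized_fun h) a * monomial z a)
          h e k a = (\sum_(i < k) fourier_coeff (fun w => c i * g i w) a) * monomial z a.
        elim: (k) => [|j ih]; first by rewrite big_ord0 mul0r.
        by rewrite /= ih big_ord_recr /= mulrDl Fc gh mulrA.
      rewrite -mulrBl cmodM -[leRHS]mulr1.
      by apply: ler_pM; rewrite ?cmod_ge0 ?k0P ?mle.
    have := zmon x xm; set E := (\esum_(_ in _) _)%E => Efin.
    exists (fine E) => s us s0.
    have E0 : (0 <= E)%E by apply: esum_ge0 => a _; rewrite lee_fin cmod_ge0.
    rewrite -lee_fin fineK ?ge0_fin_numE// -sumEFin.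
    apply: ereal_sup_ubound; exists [set` s].
      by split; [exact: finite_seq|move=> a /=; exact: s0].
    by rewrite -fsbig_seq.
- exists C => N q s us hq bq.
  pose h : normalized m ball := exist _ (existT _ N q) (conj hq bq).
  have um : uniq [seq mnm_index a | a <- s].
    by rewrite map_inj_uniq//; exact: mnm_index_inj.
  apply: le_trans (CP h _ um _); last by move=> _ /mapP[a _ ->]; exact: mnm_index_nonneg.
  rewrite big_map le_eqVlt; apply/orP; left; apply/eqP; apply: eq_bigr => a _.
  by rewrite /normalized_fun /= fourier_coeff_mnm.
Qed.

End hardy_limits.

(** * Uniform bounds on the two unit balls *)

Section mon_bounds.
Context {R : realType}.
Local Notation P := (torus_measure R).

(* G is the a.e. finite sum of the series of the 2^-(k+1) u_k. *)
Lemma common_majorant (u : nat -> torus R -> R) (C : R) :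
  (forall k, measurable_fun [set: torus R] (u k)) -> (forall k w, 0 <= u k w) ->
  (forall k, P.-integrable setT (EFin \o u k)) ->
  (forall k, \int[P]_w u k w <= C) ->
  exists (G chi : torus R -> R), [/\ P.-integrable setT (EFin \o G), forall w, 0 <= G w,
    measurable_fun [set: torus R] chi /\ {ae P, forall w, chi w = 1},
    forall w, chi w = 0 \/ chi w = 1 &
    forall k w, chi w * u k w <= 2 ^+ k * G w].
Proof.
move=> mu u0 Iu uC.
have C0 : 0 <= C by apply: le_trans (uC 0%N); exact: Rintegral_ge0.
pose t k w : R := u k w / (2 ^ k.+1)%:R.
have t0 k w : (0 <= (t k w)%:E)%E by rewrite lee_fin divr_ge0.
have mt k : measurable_fun [set: torus R] (fun w => (t k w)%:E).
  by apply/measurable_EFinP; apply: measurable_funM.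
pose M w := (\sum_(k <oo) (t k w)%:E)%E.
have M0 w : (0 <= M w)%E by apply: nneseries_ge0.
have mM : measurable_fun [set: torus R] M.
  exact: (@ge0_emeasurable_sum _ _ _ _ (fun k w => (t k w)%:E) xpredT).
have IM : (\int[P]_w M w <= C%:E)%E.
  rewrite integral_nneseries//; apply: le_trans (epsilon_trick0 _ C0).
  apply: lee_nneseries => [k _ _|k _]; first by apply: integral_ge0 => w _; exact: t0.
  have It : P.-integrable setT (EFin \o t k).
    have : P.-integrable setT (EFin \o (fun w => (2 ^ k.+1)%:R^-1 * u k w)).
      exact: (integrableZl measurableT _ (Iu k)).
    by apply: eq_integrable => // w _; rewrite /t /= mulrC.
  rewrite -EFin_Rintegral// lee_fin /t.
  rewrite (_ : \int[P]_w _ = (2 ^ k.+1)%:R^-1 * \int[P]_w u k w).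
    by rewrite mulrC ler_pM2r// invr_gt0.
  rewrite -RintegralZl//; apply: eq_Rintegral => w _; by rewrite mulrC.
have intM : P.-integrable setT M.
  apply/integrableP; split => //; apply: le_lt_trans (ltry C).
  by apply: le_trans IM; rewrite le_eqVlt; apply/orP; left; apply/eqP;
    apply: eq_integral => w _; rewrite gee0_abs.
have intF : P.-integrable setT (EFin \o (fun w => fine (M w))).
  apply: le_integrable intM => //.
    by apply/measurable_EFinP; exact: (measurableT_comp (fine_measurable measurableT) mM).
  by move=> w _ /=; rewrite ger0_norm ?fine_ge0// gee0_abs//; case: (M w) (M0 w).
pose E := [set w | M w \is a fin_num].
have mE : measurable E by rewrite -[E]setTI; exact: emeasurable_fin_num.
exists (fun w => 2 * fine (M w)), \1_E; split.
- exact: (integrableZl measurableT 2 intF).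
- by move=> w; rewrite mulr_ge0// fine_ge0.
- split; first exact: measurable_indic.
  have := integrable_ae measurableT intM; apply: filterS => w /(_ I) Mw.
  by rewrite indicE mem_set.
- by move=> w; rewrite indicE; case: (_ \in _); [right|left].
- move=> k w; rewrite indicE; case: (boolP (w \in E)) => [|_]; last first.
    by rewrite mul0r mulr_ge0// mulr_ge0// fine_ge0.
  rewrite inE => Mw; rewrite mul1r mulrA -exprSr.
  have tM : t k w <= fine (M w).
    rewrite -lee_fin fineK//; apply: le_trans (nneseries_lim_ge k.+1 _) => //.
    by rewrite big_nat_recr//= leeDr// sume_ge0.
  by rewrite -ler_pdivrMl ?exprn_gt0// mulrC -natrX.
Qed.

Lemma ae_eq_Cintegral (f g : torus R -> R[i]) : Cmeasurable f -> Cmeasurable g ->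
  {ae P, forall w, f w = g w} -> Cintegral f = Cintegral g.
Proof.
move=> [f1 f2] [g1 g2] fg; apply: complex_eq; rewrite /Cintegral /= /Rintegral;
  congr fine; apply: ae_eq_integral => //; try exact/measurable_EFinP.
- by apply: filterS fg => w -> .
- by apply: filterS fg => w -> .
Qed.

Lemma mon_uniform_bound_sup m (z : nat -> R[i]) : mon_hardy_hom m +oo%E z ->
  exists C : R, forall N (q : mpoly N R[i]) (s : seq (multinom N)), uniq s ->
    homogeneous m q -> (forall w, cmod (torus_eval q w) <= 1) ->
    \sum_(a <- s) cmod (mcoeff a q * monomial z (mnm_index a)) <= C.
Proof.
move=> zm; apply: (@mon_uniform_bound _ m +oo%E
  (fun N q => forall w, cmod (torus_eval q w) <= 1) z _ zm) => //.
  by rewrite leey.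
- move=> N q a _ q1.
  have I := Cbounded_integrable (Cbounded_torus_eval q).
  apply: le_trans (ler_fourier_coeff a I) _; rewrite -(@Rintegral_prob_cst R 1).
  apply: le_Rintegral => //; first exact: integrable_cmod.
  by apply: (@bounded_integrable _ _ 1) => // w; rewrite normr1.
- move=> h; exists (fun k => normalized_fun (h k)), (fun=> 1); split => //.
  + by move=> k; exact: (Cbounded_torus_eval _).1.
  + move=> k w; rewrite mulr1 /normalized_fun; case: (h k) => -[N q] [/= _ q1].
    have {}q1 := q1 w.
    by apply: le_trans q1 _; rewrite exprn_ege1// ler1n.
  + by apply: (@bounded_integrable _ _ 1) => // w; rewrite normr1.
  + have P0 : (0 < P [set: torus R])%E by rewrite torus_measure_setT.
    rewrite /Lp_norm unlock /Lnorm ifT//.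
    apply: le_lt_trans (ltry `|6 * 1 : R|); apply/ess_supP; apply: nearW => w /=.
    by rewrite lee_fin cmod_realC normr_id.
Qed.

(** On the L_2 ball the integrals of |P_k|^n are bounded for n = 2^(i + 1) >= p, by
    [coeff_sqnorm_power_le]; [common_majorant] applies to these powers. *)
Lemma mon_uniform_bound_l2 m (p : \bar R) (z : nat -> R[i]) : (1 <= p)%E ->
  (p < +oo)%E -> mon_hardy_hom m p z ->
  exists C : R, forall N (q : mpoly N R[i]) (s : seq (multinom N)), uniq s ->
    homogeneous m q -> coeff_sqnorm q <= 1 ->
    \sum_(a <- s) cmod (mcoeff a q * monomial z (mnm_index a)) <= C.
Proof.
case: p => [r| |//] r1 // _ zm; rewrite lee_fin in r1.
have [i ri] : exists i, r <= (2 ^ i.+1)%:R.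
  exists (Num.bound r); apply: le_trans (ltW (archi_boundP (le_trans ler01 r1))) _.
  by rewrite ler_nat ltnW// (leq_trans (ltn_expl _ (ltnSn 1)))// leq_pexp2l.
pose n := (2 ^ i.+1)%N.
have n0 : (0 < n)%N by rewrite expn_gt0.
have [C C0 CP] := @coeff_sqnorm_power_le R m i.
apply: (@mon_uniform_bound _ m r%:E (fun N q => coeff_sqnorm q <= 1) z _ zm).
- by rewrite lee_fin.
- move=> N q a _ q1.
  have [[b _ ba]|nb] := pselect (exists2 b, b \in msupp q & mnm_index b = a).
    rewrite -ba fourier_coeff_mnm -(@expr_le1 _ 2) ?cmod_ge0//.
    apply: le_trans q1; have := @ler_coeff_sqnorm R N q [:: b] isT.
    by rewrite big_seq1.
  rewrite fourier_coeff_torus_eval0 ?cmod0// => b bq; apply/negP => /eqP ba.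
  by apply: nb; exists b.
move=> h; pose u k w := cmod (normalized_fun (h k) w) ^+ n.
have Iu k : P.-integrable setT (EFin \o u k) by exact: integrable_cmod_torus_eval.
have mu k : measurable_fun [set: torus R] (u k).
  by apply/measurable_EFinP; exact: (measurable_int _ (Iu k)).
have uC k : \int[P]_w u k w <= C.
  rewrite /u /normalized_fun; have [hq q1] := svalP (h k).
  move: (projT2 (sval (h k))) hq q1 => q hq q1.
  apply: (@le_trans _ _ (coeff_sqnorm (q ^+ (2 ^ i)))).
    rewrite -Parseval le_eqVlt; apply/orP; left; apply/eqP.
    apply: eq_Rintegral => w _.
    by rewrite torus_evalX cmodX -exprM -expnSr.
  apply: le_trans (CP _ _ hq) _; rewrite -[leRHS]mulr1 ler_wpM2l//.
  by rewrite exprn_ile1// coeff_sqnorm_ge0.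
have u0 k w : 0 <= u k w by rewrite exprn_ge0// cmod_ge0.
have [G [chi [IG G0 [mchi chi1] chi01 chiG]]] := common_majorant mu u0 Iu uC.
(* The n-th root undoes the power in u. The summand 1 gives D >= 1, so that D and D^r are dominated
   by the integrable D^n. *)
pose D w := (1 + G w) `^ n%:R^-1.
have mG : measurable_fun [set: torus R] G.
  by apply/measurable_EFinP; exact: (measurable_int _ IG).
have mD : measurable_fun [set: torus R] D.
  by apply: (measurableT_comp (measurable_powR _)); exact: measurable_funD.
have I1G : P.-integrable setT (EFin \o (fun w => 1 + G w)).
  have I1 : P.-integrable setT (EFin \o (fun=> 1)).
    by apply: (@bounded_integrable _ _ 1) => // w; rewrite normr1.
  exact: (integrableD measurableT I1 IG).
have Dn w : D w ^+ n = 1 + G w.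
  rewrite -powR_mulrn ?powR_ge0// -powRrM mulVf ?pnatr_eq0 -?lt0n//.
  by rewrite powRr1// addr_ge0.
have D1 w : 1 <= D w.
  by rewrite -(@ler_pXn2r _ n) ?nnegrE ?powR_ge0// expr1n Dn lerDl.
have D0 w : 0 <= D w by rewrite (le_trans ler01).
(* The factor [chi] kills the null set where the majorant fails and leaves the Fourier coefficients
   unchanged. *)
exists (fun k w => (chi w)%:C * normalized_fun (h k) w), D.
have mg k : Cmeasurable (fun w => (chi w)%:C * normalized_fun (h k) w).
  apply: CmeasurableM (Cbounded_torus_eval _).1.
  by split => //; exact: measurable_cst.
split=> //.
- move=> k w; rewrite cmodM cmod_realC.
  have [->|c1] := chi01 w; first by rewrite normr0 mul0r mulr_ge0.
  rewrite c1 normr1 mul1r -(@ler_pXn2r _ n) ?nnegrE ?cmod_ge0 ?mulr_ge0//.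
  have := chiG k w; rewrite c1 mul1r => /le_trans; apply.
  rewrite exprMn Dn ler_pM ?exprn_ge0 ?lerDr//.
  by rewrite -exprM ler_eXn2l ?ltr1n// leq_pmulr.
- apply: le_integrable I1G => //; first exact/measurable_EFinP.
  move=> w _ /=; rewrite lee_fin !ger0_norm ?addr_ge0// -Dn.
  by rewrite -[leLHS]expr1 ler_weXn2l.
- have I6 : P.-integrable setT (EFin \o (fun w => 6 ^+ n * (1 + G w))).
    exact: (integrableZl measurableT (6 ^+ n) I1G).
  rewrite /Lp_norm unlock /Lnorm; apply: poweR_lty.
  apply: le_lt_trans (integrable_lty measurableT I6).
  apply: ge0_le_integral => //.
  + by move=> w _; exact: poweR_ge0.
  + apply: (measurableT_comp (measurable_poweR _)) => /=.
    apply: measurableT_comp => //; apply/measurable_EFinP.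
    have m6 : Cmeasurable (fun w => (6 * D w)%:C).
      by split; [exact: measurable_funM|exact: measurable_cst].
    by apply/measurable_EFinP; apply: measurableT_comp => //; exact: measurable_cmod m6.
  + by apply/measurable_EFinP; apply: measurable_funM => //; exact: measurable_funD.
  + move=> w _ /=; rewrite cmod_realC normr_id lee_fin ger0_norm ?mulr_ge0// -Dn -exprMn.
    rewrite -powR_mulrn ?mulr_ge0//; apply: ler_powR => //.
    have := D1 w; lra.
- move=> k a; apply: ae_eq_Cintegral.
  + exact: CmeasurableM (mg k) (Cbounded_monomialV a).1.
  + exact: CmeasurableM (Cbounded_torus_eval _).1 (Cbounded_monomialV a).1.
  + by apply: filterS chi1 => w ->; rewrite mul1r.
Qed.

End mon_bounds.

(** * Necessary conditions *)

Section l2_necessary.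
Context {R : realType}.

Lemma monomial_mnmD N (a b : multinom N) (z : nat -> R[i]) :
  monomial z (mnm_index (mnm_add a b)) =
  monomial z (mnm_index a) * monomial z (mnm_index b).
Proof.
rewrite !monomial_mnm -big_split /=; apply: eq_bigr => j _.
by rewrite mnmDE exprD.
Qed.

Lemma monomial_mnm1 N (i : 'I_N) (z : nat -> R[i]) :
  monomial z (mnm_index (mnm1 i)) = z i.
Proof.
rewrite monomial_mnm (bigD1 i)//= mnm1E eqxx expr1 big1 ?mulr1// => j ji.
by rewrite mnm1E eq_sym (negbTE ji) expr0.
Qed.

Lemma monomial_mnmMn N (a : multinom N) n (z : nat -> R[i]) :
  monomial z (mnm_index (mnm_muln a n)) = monomial z (mnm_index a) ^+ n.
Proof.
rewrite !monomial_mnm -prodrXl; apply: eq_bigr => j _.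
by rewrite mulmnE exprM.
Qed.

Lemma mon_hardy_hom_l2 m (p : \bar R) (z : nat -> R[i]) : (0 < m)%N -> (1 <= p)%E ->
  (p < +oo)%E -> mon_hardy_hom m p z -> (l2_norm z < +oo)%E.
Proof.
move=> m0 p1 pfin zm.
have [C CP] := mon_uniform_bound_l2 p1 pfin zm.
have [[j0 zj0]|z0] := pselect (exists j, z j != 0); last first.
  apply: (@l2_norm_fin _ z 0) => // N; rewrite big1// => j _.
  have [->|zj] := eqVneq (z j) 0; first by rewrite cmod0 expr0n.
  by case: z0; exists (val j).
have zj0_gt0 : 0 < cmod (z j0) by rewrite lt_neqAle eq_sym cmod_eq0 zj0 cmod_ge0.
(* The test polynomial, divided by sqrt S to have L_2 norm 1, yields |z_j0|^(m - 1) sqrt S <= C with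
   C independent of n. *)
pose D := C / cmod (z j0) ^+ m.-1.
apply: (@l2_norm_fin _ z (D ^+ 2)); first exact: sqr_ge0.
move=> n; set S := \sum_(j < n) _.
have S0 : 0 <= S by apply: sumr_ge0 => j _; rewrite exprn_ge0 ?cmod_ge0.
have [->|Sn0] := eqVneq S 0; first exact: sqr_ge0.
have sS : 0 < Num.sqrt S by rewrite sqrtr_gt0 lt_neqAle eq_sym Sn0.
pose N := maxn n j0.+1.
have nN : (n <= N)%N by exact: leq_maxl.
have jN : (j0 < N)%N by exact: leq_maxr.
pose g (i : 'I_n) : multinom N :=
  mnm_add (mnm_muln (mnm1 (Ordinal jN)) m.-1) (mnm1 (widen_ord nN i)).
have g_inj : injective g.
  move=> i i' /addmI /mnmP /(_ (widen_ord nN i)); rewrite !mnm1E eqxx.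
  by case: eqP => // /(f_equal val) /= ii' _; apply: val_inj.
pose c (i : 'I_n) : R[i] := (z i)^*%C / (Num.sqrt S)%:C.
have cE i : cmod (c i) = cmod (z i) / Num.sqrt S.
  by rewrite cmodM cmodV cmod_conj cmod_realC gtr0_norm.
pose q := \sum_(i : 'I_n) c i *: mpolyX R[i] (g i).
have hq : homogeneous m q.
  move=> a /msupp_sumX_sub[i ->]; rewrite mdegD mdegMn !mdeg1 mul1n addn1.
  by rewrite prednK.
have q1 : coeff_sqnorm q <= 1.
  rewrite (coeff_sqnorm_sumX _ g_inj).
  under eq_bigr do rewrite cE expr_div_n sqr_sqrtr//.
  by rewrite -mulr_suml divff.
have us : uniq [seq g i | i <- index_enum 'I_n].
  by rewrite map_inj_uniq// index_enum_uniq.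
have := CP N q _ us hq q1; rewrite big_map => h.
have {}h : cmod (z j0) ^+ m.-1 * Num.sqrt S <= C.
  apply: le_trans h; rewrite -[X in _ * X](mulfK (lt0r_neq0 sS)) -expr2 sqr_sqrtr//.
  rewrite le_eqVlt; apply/orP; left; apply/eqP.
  rewrite mulr_suml mulr_sumr; apply: eq_bigr => i _.
  rewrite (mcoeff_sumX _ g_inj) monomial_mnmD monomial_mnmMn !monomial_mnm1 /=.
  rewrite [RHS]cmodM cE cmodM cmodX; ring.
rewrite -(sqr_sqrtr S0) lerXn2r ?nnegrE ?sqrtr_ge0 //.
  by rewrite divr_ge0 ?exprn_ge0 ?cmod_ge0// (le_trans _ h)// mulr_ge0 ?exprn_ge0 ?cmod_ge0 ?sqrtr_ge0.
by rewrite ler_pdivlMr ?exprn_gt0// mulrC.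
Qed.

End l2_necessary.

(** * Products of Hadamard matrices and their polynomials *)

Section chain_polynomials.
Context {R : realType}.

(** Sylvester's matrix of order 2^k: rows and columns are bit vectors, and the entries are the
    values of the characters of (Z/2)^k. *)
Definition hadamard k (a b : {ffun 'I_k -> bool}) : R[i] :=
  \prod_(i < k) (-1) ^+ (a i && b i).

Lemma cmod_hadamard k a b : cmod (@hadamard k a b) = 1.
Proof.
by rewrite cmod_prod big1// => i _; rewrite cmodX cmodN cmod1 expr1n.
Qed.

Lemma hadamard_orthogonal k (b b' : {ffun 'I_k -> bool}) :
  \sum_a hadamard a b * (hadamard a b')^*%C = (2 ^ k)%:R *+ (b == b').
Proof.
under eq_bigr => a _.
  have -> : (hadamard a b')^*%C = hadamard a b'.
    by rewrite /hadamard rmorph_prod; apply: eq_bigr => i _; rewrite rmorphXn rmorphN1.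
  rewrite -big_split /=; over.
(* The sum over bit vectors factors over the k positions; a position where b and b' differ
   contributes 1 - 1 = 0. *)
rewrite -(bigA_distr_bigA (fun i (t : bool) =>
  (-1) ^+ (t && b i) * (-1) ^+ (t && b' i) : R[i])) /=.
have [->|nb] := eqVneq b b'.
  rewrite (eq_bigr (fun=> 2)); last first.
    by move=> i _; rewrite big_bool /=; case: (b' i); rewrite ?expr1 ?expr0 ?mulrNN ?mulr1.
  by rewrite prodr_const card_ord natrX.
have [i bi] : exists i, b i != b' i.
  apply/existsP; apply: contraNT nb; rewrite negb_exists => /forallP h.
  by apply/eqP/ffunP => i; apply/eqP; have := h i; rewrite negbK.
rewrite (bigD1 i)//= big_bool /=.
by case: (b i) (b' i) bi => -[]//= _; rewrite ?expr0 ?expr1 ?mulr1 ?mul1r addNr mul0r.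
Qed.

Lemma hadamard_isometry k (V : {ffun 'I_k -> bool} -> R[i]) :
  \sum_a cmod (\sum_b hadamard a b * V b) ^+ 2 = (2 ^ k)%:R * \sum_b cmod (V b) ^+ 2.
Proof.
apply: (@complexI R); rewrite rmorphM rmorph_nat !rmorph_sum /=.
transitivity (\sum_a \sum_b \sum_b' (hadamard a b * (hadamard a b')^*%C) *
    (V b * (V b')^*%C)).
  apply: eq_bigr => a _; rewrite cmod_sqrC rmorph_sum mulr_suml.
  apply: eq_bigr => b _; rewrite mulr_sumr; apply: eq_bigr => b' _.
  by rewrite rmorphM mulrACA.
rewrite exchange_big mulr_sumr; apply: eq_bigr => b _ /=.
rewrite exchange_big (bigD1 b)//= [X in _ + X]big1 ?addr0.
  by rewrite -mulr_suml hadamard_orthogonal eqxx cmod_sqrC.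
by move=> b' bb'; rewrite -mulr_suml hadamard_orthogonal eq_sym (negbTE bb') mulr0n mul0r.
Qed.

(** [v s a] is the variable with label a in block s; the m blocks with s < m are disjoint. *)
Variables (k N m : nat) (v : nat -> {ffun 'I_k -> bool} -> 'I_N).
Local Notation I := {ffun 'I_k -> bool}.
Hypothesis v_inj : forall s t a b, (s < m)%N -> (t < m)%N -> v s a = v t b ->
  s = t /\ a = b.

(** Sequences of t + 1 labels, newest first, as iterated products, so that coefficients and
    monomials recurse on the head. *)
Fixpoint chain (t : nat) : finType :=
  if t is t'.+1 then (I * chain t')%type : finType else I.

Definition chain_head t : chain t -> I :=
  if t is t'.+1 return chain t -> I then fst else id.

Fixpoint chain_coeff t : chain t -> R[i] :=
  if t is t'.+1 return chain t -> R[i]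
  then fun f => hadamard f.1 (chain_head f.2) * chain_coeff f.2 else fun=> 1.

Fixpoint chain_mnm t : chain t -> multinom N :=
  if t is t'.+1 return chain t -> multinom N
  then fun f => mnm_add (mnm1 (v t'.+1 f.1)) (chain_mnm f.2) else fun a => mnm1 (v 0 a).

Lemma card_chain t : #|chain t| = ((2 ^ k) ^ t.+1)%N.
Proof.
elim: t => [|t ih] /=; first by rewrite card_ffun card_bool card_ord expn1.
by rewrite card_prod ih card_ffun card_bool card_ord [RHS]expnS.
Qed.

Lemma cmod_chain_coeff t (f : chain t) : cmod (chain_coeff f) = 1.
Proof.
elim: t f => [|t ih] f /=; first exact: cmod1.
by rewrite cmodM cmod_hadamard ih mul1r.
Qed.

Lemma mdeg_chain_mnm t (f : chain t) : mdeg (chain_mnm f) = t.+1.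
Proof. by elim: t f => [|t ih] f /=; rewrite ?mdegD mdeg1 ?ih. Qed.

Lemma chain_mnm_fresh t s (f : chain t) b : (t < s < m)%N ->
  chain_mnm f (v s b) = 0%N.
Proof.
have fresh t' a : (t' < s < m)%N -> mnm1 (v t' a) (v s b) = 0%N.
  move=> /andP[ts sm]; rewrite mnm1E; case: eqP => // /v_inj[||t's _]//.
    exact: ltn_trans sm.
  by move: ts; rewrite t's ltnn.
elim: t f => [|t ih] f tsm /=; first exact: fresh.
rewrite mnmDE fresh// ih//; move/andP: tsm => [ts ->]; rewrite andbT.
exact: ltn_trans ts.
Qed.

Lemma chain_mnm_inj t : (t < m)%N -> injective (@chain_mnm t).
Proof.
elim: t => [|t ih] tm f g /=.
  move=> /mnmP /(_ (v 0 f)); rewrite !mnm1E eqxx; case: eqP => // gf _.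
  by have [_ ->] := v_inj tm tm gf.
move=> fg; have fg1 : f.1 = g.1.
  have /mnmP /(_ (v t.+1 f.1)) := fg.
  rewrite !mnmDE !chain_mnm_fresh ?ltnSn// !addn0 !mnm1E eqxx.
  by case: eqP => // gf _; have [_ ->] := v_inj tm tm gf.
move: fg; rewrite fg1 => /addmI /(ih (ltnW tm)).
by case: f g fg1 => [f1 f2] [g1 g2] /= -> ->.
Qed.

(** Transfer matrix form of the sum over the chains with head a: multiply by the Hadamard matrix,
    then by the diagonal of the variables of the next block. *)
Fixpoint transfer (y : nat -> R[i]) t (a : I) : R[i] :=
  if t is t'.+1 then y (v t a) * \sum_b hadamard a b * transfer y t' b else y (v 0 a).

(** The weight h on the head is general because in the induction the Hadamard row of the next label
    takes its place. *)
Lemma chain_sum y t (h : I -> R[i]) :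
  \sum_(f : chain t) h (chain_head f) * chain_coeff f * monomial y (mnm_index (chain_mnm f)) =
  \sum_a h a * transfer y t a.
Proof.
elim: t h => [|t ih] h /=.
  by apply: eq_bigr => a _; rewrite mulr1 monomial_mnm1.
rewrite -(pair_bigA _ (fun a (f : chain t) => h a * (hadamard a (chain_head f) *
  chain_coeff f) * monomial y (mnm_index (mnm_add (mnm1 (v t.+1 a)) (chain_mnm f))))) /=.
apply: eq_bigr => a _; rewrite -ih mulrA mulr_sumr; apply: eq_bigr => f _.
by rewrite monomial_mnmD monomial_mnm1; ring.
Qed.

(** Unimodular diagonals preserve the l_2 norm, and each Hadamard matrix multiplies its square by
    2^k. *)
Lemma transfer_sqnorm y t : (forall j, cmod (y j) = 1) ->
  \sum_a cmod (transfer y t a) ^+ 2 = (2 ^ k)%:R ^+ t.+1.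
Proof.
move=> y1; elim: t => [|t ih] /=.
  under eq_bigr do rewrite y1 expr1n.
  by rewrite sumr_const card_ffun card_bool card_ord expr1.
under eq_bigr do rewrite cmodM y1 mul1r.
by rewrite hadamard_isometry ih [RHS]exprS.
Qed.

(** Adding up the 2^k entries of [transfer] by Cauchy-Schwarz costs one more factor 2^k. *)
Lemma chain_sum_le y t : (forall j, cmod (y j) = 1) ->
  cmod (\sum_(f : chain t) chain_coeff f * monomial y (mnm_index (chain_mnm f))) ^+ 2 <=
  (2 ^ k)%:R ^+ t.+2.
Proof.
move=> y1; have := chain_sum y t (fun=> 1).
under eq_bigr do rewrite mul1r; move=> ->; under eq_bigr do rewrite mul1r.
rewrite [leRHS]exprS -(transfer_sqnorm t y1).
have := cauchy_schwarz_seq (index_enum {ffun 'I_k -> bool}) (fun=> 1 : R)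
  (fun a => cmod (transfer y t a)).
rewrite expr1n sumr_const card_ffun card_bool card_ord; apply: le_trans.
rewrite lerXn2r ?nnegrE ?cmod_ge0//.
  by apply: sumr_ge0 => a _; rewrite mul1r cmod_ge0.
by apply: le_trans (ler_cmod_sum _ _ _) _; apply: ler_sum => a _; rewrite mul1r.
Qed.

Lemma chain_monomial_ge (z : nat -> R[i]) (c : R) t (f : chain t) : 0 <= c -> (t < m)%N ->
  (forall s a, (s < m)%N -> c <= cmod (z (v s a))) ->
  c ^+ t.+1 <= cmod (monomial z (mnm_index (chain_mnm f))).
Proof.
move=> c0 tm zc; elim: t f tm => [|t ih] f tm /=.
  by rewrite monomial_mnm1 expr1 zc.
rewrite monomial_mnmD monomial_mnm1 cmodM exprS.
by rewrite ler_pM ?exprn_ge0 ?zc ?ih// ltnW.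
Qed.

End chain_polynomials.

(** * Decay of the decreasing rearrangement on mon *)

Section weak_necessary.
Context {R : realType}.

(** Greedy choice: removing fewer than r chosen indices leaves a supremum above c, hence another
    index. *)
Lemma exists_large_indices (z : nat -> R[i]) (c : R) r : (c%:E < decr_rearr z r)%E ->
  exists s : seq nat, [/\ uniq s, size s = r & forall j, j \in s -> c < cmod (z j)].
Proof.
move=> cz; suff : forall k, (k <= r)%N ->
    exists s : seq nat, [/\ uniq s, size s = k & forall j, j \in s -> c < cmod (z j)].
  exact.
elim=> [|k ih] kr; first by exists [::].
have [s [us sk sc]] := ih (ltnW kr).
pose J : {fset nat} := seq_fset tt s.
have Jr : (#|` J| < r)%N by rewrite size_seq_fset undup_id// sk.
have : (c%:E < ereal_sup [set (cmod (z j))%:E | j in [set j | j \notin J]])%E.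
  by apply: lt_le_trans cz _; apply: ereal_inf_lbound; exists J.
move=> /ereal_sup_gt[_ [j /= jJ <-]]; rewrite lte_fin => cj.
exists (j :: s); split=> /=; rewrite ?sk//.
  by rewrite us andbT; apply: contra jJ; rewrite seq_fsetE.
by move=> i; rewrite inE => /predU1P[->|/sc].
Qed.

(* With n = 2 ^ k, testing on a chain polynomial in m n variables z_j of modulus
   > c gives n^m c^m <= C n^((m + 1) / 2). *)
Lemma large_indices_bound m (z : nat -> R[i]) : (0 < m)%N -> mon_hardy_hom m +oo%E z ->
  exists2 K : R, 0 <= K & forall k (c : R), 0 <= c ->
    (c%:E < decr_rearr z (m * 2 ^ k))%E ->
    c ^+ (2 * m) * (2 ^ k)%:R ^+ m.-1 <= K.
Proof.
case: m => // t _ zm; have [C CP] := mon_uniform_bound_sup zm.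
exists (C ^+ 2); first exact: sqr_ge0.
move=> k c c0 /exists_large_indices[s [us ss sc]].
pose I : finType := {ffun 'I_k -> bool}.
have cardI : #|I| = (2 ^ k)%N by rewrite card_ffun card_bool card_ord.
pose N := (\max_(j <- s) j).+1.
have sN j : j \in s -> (j < N)%N by move=> js; rewrite ltnS; exact: leq_bigmax_seq.
pose pos (i : nat) (a : I) := (i * 2 ^ k + enum_rank a)%N.
have rankI (a : I) : (enum_rank a < 2 ^ k)%N by rewrite -[X in (_ < X)%N]cardI.
have pos_lt i a : (i < t.+1)%N -> (pos i a < size s)%N.
  move=> it; rewrite ss /pos; apply: (@leq_trans (i.+1 * 2 ^ k)).
    by rewrite mulSn addnC ltn_add2r.
  by rewrite leq_mul2r it orbT.
pose v (i : nat) (a : I) : 'I_N := inord (nth 0%N s (pos i a)).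
have vE i a : (i < t.+1)%N -> val (v i a) = nth 0%N s (pos i a).
  by move=> it; rewrite /v /= inordK// sN// mem_nth// pos_lt.
have v_inj i j a b : (i < t.+1)%N -> (j < t.+1)%N -> v i a = v j b -> i = j /\ a = b.
  move=> it jt /(f_equal val); rewrite !vE// => /eqP.
  rewrite nth_uniq ?pos_lt// => /eqP ij.
  have n0 : (0 < 2 ^ k)%N by rewrite expn_gt0.
  have ij' : i = j.
    have := f_equal (fun x => x %/ 2 ^ k)%N ij.
    by rewrite /pos !divnMDl// !divn_small// !addn0.
  by split=> //; move: ij; rewrite /pos ij' => /addnI /val_inj /enum_rank_inj.
pose L : R := Num.sqrt ((2 ^ k)%:R ^+ t.+2).
have n0 : 0 < (2 ^ k)%:R :> R by rewrite ltr0n expn_gt0.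
have L0 : 0 < L by rewrite sqrtr_gt0 exprn_gt0.
pose J := chain k t.
have g_inj : injective (@chain_mnm k N v t) by apply: (chain_mnm_inj v_inj).
pose cf (f : J) : R[i] := L^-1%:C * chain_coeff f.
have cfE f : cmod (cf f) = L^-1.
  by rewrite cmodM cmod_chain_coeff mulr1 cmod_realC ger0_norm// invr_ge0 ltW.
pose q := \sum_(f : J) cf f *: mpolyX R[i] (chain_mnm v f).
have hq : homogeneous t.+1 q.
  by move=> a /msupp_sumX_sub[f ->]; exact: mdeg_chain_mnm.
have q1 w : cmod (torus_eval q w) <= 1.
  rewrite torus_eval_sumX//; under eq_bigr do rewrite /cf -mulrA.
  rewrite -mulr_sumr cmodM cmod_realC ger0_norm ?invr_ge0 ?(ltW L0)//.
  rewrite ler_pdivrMl// mulr1 -(@ler_pXn2r _ 2) ?nnegrE ?cmod_ge0 ?(ltW L0)//.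
  rewrite sqr_sqrtr ?exprn_ge0 ?(ltW n0)//.
  by apply: chain_sum_le => j; exact: cmod_circle.
have um : uniq [seq chain_mnm v f | f <- index_enum J].
  by rewrite map_inj_uniq// index_enum_uniq.
have := CP N q _ um hq q1; rewrite big_map => h.
have zc i a : (i < t.+1)%N -> c <= cmod (z (v i a)).
  by move=> it; rewrite vE//; apply/ltW/sc; rewrite mem_nth// pos_lt.
have {}h : (2 ^ k)%:R ^+ t.+1 * c ^+ t.+1 <= C * L.
  rewrite -ler_pdivrMr//; apply: le_trans h.
  apply: (@le_trans _ _ (\sum_(f : J) c ^+ t.+1 / L)).
    by rewrite sumr_const card_chain -[leRHS]mulr_natl [in leRHS]natrX mulrA.
  apply: ler_sum => f _; rewrite (mcoeff_sumX _ g_inj) cmodM cfE mulrC.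
  by rewrite ler_pM2l ?invr_gt0// (chain_monomial_ge f c0 (ltnSn t) zc).
have l0 : 0 <= (2 ^ k)%:R ^+ t.+1 * c ^+ t.+1 :> R.
  by rewrite mulr_ge0 ?exprn_ge0// ltW.
have h2 := lerXn2r 2 l0 (le_trans l0 h) h.
rewrite [leRHS]exprMn sqr_sqrtr ?exprn_ge0 ?(ltW n0)// in h2.
rewrite -(@ler_pM2r _ ((2 ^ k)%:R ^+ t.+2)) ?exprn_gt0//; apply: le_trans h2.
rewrite le_eqVlt; apply/orP; left; apply/eqP => /=.
rewrite exprMn -!exprM [(2 * _)%N]mulnC -mulrA -exprD mulrC.
by congr (_ ^+ _ * _); rewrite muln2 -addnn addSn addnS.
Qed.

Lemma decr_rearr_le_linf (z : nat -> R[i]) r : (0 < r)%N -> (decr_rearr z r <= linf_norm z)%E.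
Proof.
move=> r0; apply: le_trans (_ : ereal_sup [set (cmod (z j))%:E | j in
    [set j | j \notin (fset0 : {fset nat})]] <= _)%E.
  by apply: ereal_inf_lbound; exists fset0; rewrite //= cardfs0.
by apply: ge_ereal_sup => _ [j _ <-]; apply: ereal_sup_ubound; exists j.
Qed.

Lemma mon_hardy_hom_weak m (z : nat -> R[i]) : (0 < m)%N -> mon_hardy_hom m +oo%E z ->
  (weak_norm (weak_exponent R m) z < +oo)%E.
Proof.
move=> m0 zm; have z1 : (linf_norm z < 1)%E := zm.1.
rewrite /weak_exponent; have [m1|m1] := eqVneq m 1%N; first exact: lt_trans z1 (ltry 1).
have [K K0 KP] := large_indices_bound m0 zm.
(* The maximum covers r < m, where |z_j| < 1 suffices; the power of 2 m pays for replacing r by 2^k,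
   as r <= 2 m 2^k. *)
pose K' := Num.max K 1 * (2 * m)%:R ^+ m.-1.
have max1 : 1 <= Num.max K 1 by rewrite le_max lexx orbT.
have m2_gt0 : (0 < 2 * m)%N by rewrite muln_gt0.
have K'0 : 0 <= K' by rewrite mulr_ge0 ?exprn_ge0// (le_trans ler01).
have main r (c : R) : (0 < r)%N -> 0 <= c -> (c%:E < decr_rearr z r)%E ->
    c ^+ (2 * m) * r%:R ^+ m.-1 <= K'.
  move=> r0 c0 cr; have [rm|mr] := ltnP r m.
    rewrite ler_pM ?exprn_ge0//.
      rewrite (le_trans _ max1)// exprn_ile1//.
      by rewrite -lee_fin (le_trans (ltW cr))// (le_trans (decr_rearr_le_linf z r0))// ltW.
    by rewrite lerXn2r ?nnegrE// ler_nat (leq_trans (ltnW rm))// leq_pmull.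
  (* The largest k with m 2^k <= r; the rearrangement is nonincreasing, so the bound at m 2^k
     applies. *)
  pose k := trunc_log 2 (r %/ m).
  have rm0 : (0 < r %/ m)%N by rewrite divn_gt0.
  have kr : (m * 2 ^ k <= r)%N by rewrite mulnC -leq_divRL// trunc_logP.
  have rk : (r <= 2 * m * 2 ^ k)%N.
    rewrite -mulnA mulnCA -expnS mulnC ltnW// -ltn_divLR//.
    exact: trunc_log_ltn.
  apply: (@le_trans _ _ (c ^+ (2 * m) * (2 ^ k)%:R ^+ m.-1 * (2 * m)%:R ^+ m.-1)).
    rewrite -mulrA -exprMn ler_wpM2l ?exprn_ge0// lerXn2r ?nnegrE//.
    by rewrite -natrM ler_nat mulnC.
  rewrite ler_wpM2r ?exprn_ge0// (le_trans (KP k c c0 _)) ?le_max ?lexx//.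
  apply: lt_le_trans cr _; apply: ereal_inf_le_tmp => _ [J /= Jr <-].
  by exists J => //=; exact: leq_trans Jr kr.
pose e : R := ((2 * m)%:R / (m - 1)%:R)^-1.
have m10 : (m - 1)%:R != 0 :> R by rewrite pnatr_eq0 subn_eq0 -ltnNge ltn_neqAle eq_sym m1.
(* With K' + 1 instead of K', a rearrangement above B r^-e would give K' + 1 <= K'. *)
pose B := (K' + 1) `^ (2 * m)%:R^-1.
have BE : B ^+ (2 * m) = K' + 1.
  rewrite -powR_mulrn ?powR_ge0// -powRrM mulVf ?pnatr_eq0 -?lt0n//.
  by rewrite powRr1// addr_ge0.
apply: (@le_lt_trans _ _ B%:E); last exact: ltry.
apply: ge_ereal_sup => _ [r /= r0 <-]; rewrite leNgt; apply/negP => h.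
have x0 : 0 < r%:R `^ e by rewrite powR_gt0// ltr0n.
have xE : (r%:R `^ e) ^+ (2 * m) = r%:R ^+ m.-1 :> R.
  rewrite -powR_mulrn ?powR_ge0// -powRrM /e invf_div divfK.
    by rewrite subn1 powR_mulrn.
  by rewrite pnatr_eq0 -lt0n.
have c0 : 0 <= B / r%:R `^ e by rewrite divr_ge0 ?powR_ge0.
have := main r (B / r%:R `^ e) r0 c0.
rewrite EFinM lte_pdivrMr// => /(_ h).
by rewrite -xE -exprMn divfK ?lt0r_neq0// BE gerDl ler10.
Qed.

End weak_necessary.

Theorem theorem4p4 (R : realType) :
  (forall m : nat, (1 <= m)%N ->
     (forall p : \bar R, (1 <= p)%E -> (p < +oo)%E ->
        mon_hardy_hom m p = l2 R `&` polydisc R) /\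
     mon_hardy_hom m +oo%E = weak_l (weak_exponent R m) `&` polydisc R) /\
  exists C : R, 0 < C /\
    forall (m : nat) (p : \bar R), (1 <= m)%N -> (1 <= p)%E ->
    forall z, mon_hardy_hom m p z ->
    forall f, hardy_hom m p f ->
      (\esum_(a in [set a | nonneg_indices a /\ degree a = m%:Z])
          (cmod (fourier_coeff f a * monomial z a))%:E
       <= (C ^+ m)%:E * seq_norm m p z ^+ m * Lp_norm p f)%E.
Proof.
have fin m (s l : \bar R) : (0 <= s)%E -> (s < +oo)%E -> (0 <= l)%E -> (l < +oo)%E ->
    ((@coeff_const R ^+ m)%:E * s ^+ m * l < +oo)%E.
  move=> s0 sfin l0 lfin.
  rewrite -(@fineK _ s) ?ge0_fin_numE// -(@fineK _ l) ?ge0_fin_numE//.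
  by rewrite -EFin_expe -!EFinM ltry.
have l2_ge0 z : (0 <= @l2_norm R z)%E by exact: poweR_ge0.
split=> [m m1|]; first split=> [p p1 pfin|].
- apply/seteqP; split=> z.
    by move=> zm; split; [exact: mon_hardy_hom_l2 zm|exact: zm.1].
  move=> [z2 zp]; split=> // f fm; have [[[_ _ ffin] _] _] := fm.
  apply: le_lt_trans (esum_coeff_le_l2 m1 p1 fm z2 _) _ => //.
  by apply: fin => //; exact: Lp_norm_ge0.
- apply/seteqP; split=> z.
    move=> zm; have zp := zm.1; split=> //; split; last exact: mon_hardy_hom_weak.
    exact: lt_trans zp (ltry 1).
  move=> [[_ z2] zp]; split=> // f fm; have [[[_ _ ffin] _] _] := fm.
  apply: le_lt_trans (esum_coeff_le_weak m1 fm z2 _) _ => //.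
  by apply: fin => //; [exact: weak_norm_ge0|exact: Lp_norm_ge0].
exists (@coeff_const R); split; first exact: coeff_const_gt0.
move=> m p m1 p1 z zm f fm; rewrite /seq_norm.
have I0 : [set a | nonneg_indices a /\ degree a = m%:Z] `<=` nonneg_indices by move=> a [].
case: eqP => [pE|/eqP pE].
  move: zm fm; rewrite pE => zm fm.
  exact: esum_coeff_le_weak (mon_hardy_hom_weak m1 zm) I0.
apply: esum_coeff_le_l2 => //; apply: mon_hardy_hom_l2 zm => //.
by rewrite ltey.
Qed.
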